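(* Let $\mathcal{M}$ be a dependency model over a finite set $\mathbf{V}$ and let $\mathcal{K}=\langle\mathbf{F},\mathbf{R}\rangle$ be background knowledge. Consider the procedure consisting of Phases I, II, III and IV described in the context, which involves no backtracking. Assume either that $\mathcal{M}$ is closed under the graphoid axioms, or that Phase IV is carried out in its alternative form. If there exists a complete causal explanation for $\mathcal{M}$ consistent with $\mathcal{K}$, then any choice of edge and orientation made in Phase III is consistent, in the sense that the graph $\Pi_{III}$ resulting from Phase III is, whatever the choices, a complete causal explanation for $\mathcal{M}$ consistent with $\mathcal{K}$. If there is no complete causal explanation for $\mathcal{M}$ consistent with $\mathcal{K}$, then, in the event that the procedure reaches Phase IV with some graph, that graph fails Phase IV.
   Context: A dependency model over $\mathbf{V}$ is a list $\mathcal{M}$ of statements $\mathbf{A}\perp\!\!\!\perp\mathbf{B}\mid\mathbf{S}$ with $\mathbf{A},\mathbf{B},\mathbf{S}$ disjoint subsets of $\mathbf{V}$; $\mathcal{M}\models \mathbf{A}\perp\!\!\!\perp\mathbf{B}\mid\mathbf{S}$ means the statement is in the list. The graphoid axioms are, for disjoint sets: symmetry ($\mathbf{A}\perp\!\!\!\perp\mathbf{B}\mid\mathbf{S}$ implies $\mathbf{B}\perp\!\!\!\perp\mathbf{A}\mid\mathbf{S}$); decomposition ($\mathbf{A}\perp\!\!\!\perp\mathbf{B}\cup\mathbf{D}\mid\mathbf{S}$ implies $\mathbf{A}\perp\!\!\!\perp\mathbf{B}\mid\mathbf{S}$); weak union ($\mathbf{A}\perp\!\!\!\perp\mathbf{B}\cup\mathbf{D}\mid\mathbf{S}$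 implies $\mathbf{A}\perp\!\!\!\perp\mathbf{B}\mid\mathbf{S}\cup\mathbf{D}$); contraction ($\mathbf{A}\perp\!\!\!\perp\mathbf{B}\mid\mathbf{S}$ and $\mathbf{A}\perp\!\!\!\perp\mathbf{D}\mid\mathbf{S}\cup\mathbf{B}$ imply $\mathbf{A}\perp\!\!\!\perp\mathbf{B}\cup\mathbf{D}\mid\mathbf{S}$); intersection ($\mathbf{A}\perp\!\!\!\perp\mathbf{B}\mid\mathbf{S}\cup\mathbf{D}$ and $\mathbf{A}\perp\!\!\!\perp\mathbf{D}\mid\mathbf{S}\cup\mathbf{B}$ imply $\mathbf{A}\perp\!\!\!\perp\mathbf{B}\cup\mathbf{D}\mid\mathbf{S}$). For a directed acyclic graph (DAG) $G$ on $\mathbf{V}$, $\mathrm{Markov}(G)$ is the set of probability measures over the variables $\mathbf{V}$ for which every $W\in\mathbf{V}$ is independent of the set of its non-descendants conditional on the set of its parents in $G$. $G$ entails $\mathbf{A}\perp\!\!\!\perp\mathbf{B}\mid\mathbf{S}$, written $G\models \mathbf{A}\perp\!\!\!\perp\mathbf{B}\mid\mathbf{S}$, if this independence holds in every measure in $\mathrm{Markov}(G)$. A DAG $G$ is a complete causal explanation of $\mathcal{M}$ if the set of conditional independence statements entailed by $G$ is exactly the set of statements in $\mathcal{M}$. Background knowledge is a pair $\mathcal{K}=\langle \mathbf{F},\mathbf{R}\rangle$ of a set $\mathbf{F}$ of forbidden directed edges and a set $\mathbf{R}$ of required directed edges; a DAG is consistent with $\mathcal{K}$ if it contains every edge of $\mathbf{R}$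 and no edge of $\mathbf{F}$. A partially directed graph may have both undirected ($A-B$) and directed ($A\to B$) edges, with at most one edge between any pair of vertices; vertices are adjacent if joined by an edge of either kind; $pa(A)$ is the set of vertices with a directed edge to $A$. Phase I. Form an undirected graph on $\mathbf{V}$ in which $A,B$ are adjacent iff there is no $\mathbf{S}\subseteq\mathbf{V}\setminus\{A,B\}$ with $\mathcal{M}\models A\perp\!\!\!\perp B\mid\mathbf{S}$; if there is such an $\mathbf{S}$, let $\mathrm{Sep}(A,B)=\mathbf{S}$. Then for every triple $\langle A,B,C\rangle$ with $A,B$ adjacent, $B,C$ adjacent and $A,C$ not adjacent, orient $A\to B$ and $C\to B$ if $B\notin \mathrm{Sep}(A,C)$. The result is $\Pi_I$. Phase II. First close $\Pi_I$ under rules R1, R2, R3 (apply them until none is applicable). Then, modifying the resulting graph as the phase proceeds: S1: if there is an edge $A\to B$ in $\mathbf{F}$ such that $A\to B$ is in the current graph, then fail. S1': if there is an edge $A\to B$ in $\mathbf{R}$ such that $B\to A$ is in the current graph or $A$ is not adjacent to $B$, then fail. S2: randomly choose one edge $A\to B$ from $\mathbf{R}$ and remove it from $\mathbf{R}$. S3: orient $A\to B$ in the current graph and close orientations under R1, R2, R3 and R4. S4: if $\mathbf{R}$ is not empty, go to S1. (If $\mathbf{R}$ is empty at the start, S2 and S3 are vacuous.) The result is $\Pi_{II}$. Phase III. Starting from $\Pi_{II}$, as long as there is an unoriented edge, choose an unoriented edge $A-B$, orient it $A\to B$, and close orientations under R1, R2, R3 and R4. The final graph is $\Pi_{III}$.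 Phase IV. S1: if $\Pi_{III}$ is cyclic, then fail. S2: test that every statement in $\mathcal{M}$ is entailed by $\Pi_{III}$. S3: let $\prec$ be a total ordering of the vertices which agrees with the orientations in $\Pi_{III}$ ($A\to B$ implies $A\prec B$), and let $A_\prec$ be the set of vertices before $A$ in $\prec$; for all vertices $A$ test whether $\mathcal{M}\models A\perp\!\!\!\perp (A_\prec\setminus pa(A))\mid pa(A)$. The graph fails Phase IV if it fails S1 or any of these tests. Alternative form of Phase IV: replace S2 and S3 by the single step of checking that for all disjoint $\mathbf{A},\mathbf{B},\mathbf{C}\subseteq\mathbf{V}$, $\mathcal{M}\models\mathbf{A}\perp\!\!\!\perp\mathbf{B}\mid\mathbf{C}$ if and only if $\Pi_{III}\models\mathbf{A}\perp\!\!\!\perp\mathbf{B}\mid\mathbf{C}$. Orientation rules (in each rule the named vertices are distinct; applying a rule replaces an undirected edge by a directed one): R1: if $X\to Y$, $Y-Z$, and $X,Z$ are not adjacent, then orient $Y\to Z$. R2: if $X\to Y$, $Y\to Z$ and $X-Z$, then orient $X\to Z$. R3: if $X-Y$, $X-Z$, $X-W$, $Y\to W$, $Z\to W$, and $Y,Z$ are not adjacent, then orient $X\to W$. R4: if $X-Y$, $X-W$, $Y\to Z$, $Z\to W$, $X$ and $Z$ are adjacent (by an edge of any kind), and $Y,W$ are not adjacent, then orient $X\to W$.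
   Formalization: V is nonempty; that Π_III avoids F is claimed only if Π_II has no undirected A−B with A→B in F; failure of Phase IV is claimed only if moreover Π_II contains no edge of F. Otherwise Phase III may choose a forbidden edge, which Phase IV does not test. *)

(* Defs.v *)
From mathcomp Require Import all_boot.

Set Implicit Arguments.
Unset Strict Implicit.
Unset Printing Implicit Defensive.

(* A partially directed graph is given by a set of arcs: [a -> b] is encoded by
   the arc (a, b) alone and [a - b] by the two arcs (a, b) and (b, a).  Hence
   there is at most one edge between two vertices by construction.  A loop
   (a, a) counts as an undirected edge; the procedure never creates one, and
   [is_dag] excludes them. *)
Definition pdgraph (V : finType) : Type := {set V * V}.

Definition dir (V : finType) (G : pdgraph V) : rel V :=
  fun a b => ((a, b) \in G) && ((b, a) \notin G).

Definition undir (V : finType) (G : pdgraph V) : rel V :=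
  fun a b => ((a, b) \in G) && ((b, a) \in G).

Definition adj (V : finType) (G : pdgraph V) : rel V :=
  fun a b => ((a, b) \in G) || ((b, a) \in G).

Definition pa (V : finType) (G : pdgraph V) (a : V) : {set V} :=
  [set b | dir G b a].

Definition orient (V : finType) (G : pdgraph V) (a b : V) : pdgraph V :=
  (a, b) |: (G :\ (b, a)).

Definition cyclic (V : finType) (G : pdgraph V) : bool :=
  [exists a, exists b, dir G a b && connect (dir G) b a].

Definition fully_directed (V : finType) (G : pdgraph V) : bool :=
  [forall a, forall b, ~~ undir G a b].

Definition is_dag (V : finType) (G : pdgraph V) : bool :=
  fully_directed G && ~~ cyclic G.

(* Every vertex is a descendant of itself, so [a] is not a member of
   [nondesc G a]; the parents of [a] are members when G is acyclic. *)
Definition nondesc (V : finType) (G : pdgraph V) (a : V) : {set V} :=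
  [set b | ~~ connect (dir G) a b].

(* The triple (A, B, S) stands for "A is independent of B given S". *)
Definition ci_stmt (V : finType) : Type := ({set V} * {set V} * {set V})%type.

Definition disjoint3 (V : finType) (A B S : {set V}) : bool :=
  [&& [disjoint A & B], [disjoint A & S] & [disjoint B & S]].

Definition dependency_model (V : finType) (M : seq (ci_stmt V)) : Prop :=
  forall A B S, (A, B, S) \in M -> disjoint3 A B S.

Definition disjoint4 (V : finType) (A B D S : {set V}) : bool :=
  [&& disjoint3 A B S, disjoint3 A D S & [disjoint B & D]].

(* Symmetry, decomposition, weak union, contraction and intersection. *)
Definition graphoid (V : finType) (M : seq (ci_stmt V)) : Prop :=
  [/\ forall A B S, disjoint3 A B S -> (A, B, S) \in M -> (B, A, S) \in M,
      forall A B D S, disjoint4 A B D S ->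
        (A, B :|: D, S) \in M -> (A, B, S) \in M,
      forall A B D S, disjoint4 A B D S ->
        (A, B :|: D, S) \in M -> (A, B, S :|: D) \in M,
      forall A B D S, disjoint4 A B D S ->
        (A, B, S) \in M -> (A, D, S :|: B) \in M -> (A, B :|: D, S) \in M
    & forall A B D S, disjoint4 A B D S ->
        (A, B, S :|: D) \in M -> (A, D, S :|: B) \in M ->
        (A, B :|: D, S) \in M].

Record background (V : finType) : Type := Background {
  forbidden : {set V * V};
  required : {set V * V} }.

Definition has_required (V : finType) (K : background V) (G : pdgraph V) :=
  forall a b, (a, b) \in required K -> dir G a b.

Definition has_no_forbidden (V : finType) (K : background V) (G : pdgraph V) :=
  forall a b, (a, b) \in forbidden K -> ~~ dir G a b.

Definition consistent (V : finType) (K : background V) (G : pdgraph V) : Prop :=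
  has_required K G /\ has_no_forbidden K G.

(* [rule_i G a b]: the rule applies to G and orients [a - b] into [a -> b]. *)

Definition rule1 (V : finType) (G : pdgraph V) (a b : V) : Prop :=
  exists x, [/\ uniq [:: x; a; b], dir G x a, undir G a b & ~~ adj G x b].

Definition rule2 (V : finType) (G : pdgraph V) (a b : V) : Prop :=
  exists y, [/\ uniq [:: a; y; b], dir G a y, dir G y b & undir G a b].

Definition rule3 (V : finType) (G : pdgraph V) (a b : V) : Prop :=
  exists y z, [/\ uniq [:: a; y; z; b],
                  [/\ undir G a y, undir G a z & undir G a b],
                  dir G y b, dir G z b & ~~ adj G y z].

Definition rule4 (V : finType) (G : pdgraph V) (a b : V) : Prop :=
  exists y z, [/\ uniq [:: a; y; z; b],
                  undir G a y /\ undir G a b,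
                  dir G y z /\ dir G z b,
                  adj G a z & ~~ adj G y b].

Definition rules123 (V : finType) (G : pdgraph V) (a b : V) : Prop :=
  [\/ rule1 G a b, rule2 G a b | rule3 G a b].

Definition rules1234 (V : finType) (G : pdgraph V) (a b : V) : Prop :=
  [\/ rule1 G a b, rule2 G a b, rule3 G a b | rule4 G a b].

(* [closes rules G G']: G' is obtained from G by applying the rules one at a
   time, in some order, until none is applicable. *)
Inductive closes (V : finType) (rules : pdgraph V -> V -> V -> Prop) :
    pdgraph V -> pdgraph V -> Prop :=
| closes_done G :
    (forall a b, ~ rules G a b) -> closes rules G G
| closes_step G a b G' :
    rules G a b -> closes rules (orient G a b) G' -> closes rules G G'.

(* S separates the unordered pair {a, b} in M; M need not be symmetric, so the
   statement may be listed either way around. *)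
Definition separates (V : finType) (M : seq (ci_stmt V)) (a b : V)
    (S : {set V}) : bool :=
  (S \subset ~: [set a; b]) &&
  ((([set a], [set b], S) \in M) || (([set b], [set a], S) \in M)).

Definition skeleton (V : finType) (M : seq (ci_stmt V)) : pdgraph V :=
  [set p | (p.1 != p.2) && ~~ [exists S, separates M p.1 p.2 S]].

(* The values of [Sep] at adjacent or equal vertices are irrelevant. *)
Definition is_Sep (V : finType) (M : seq (ci_stmt V)) (Sep : V -> V -> {set V})
    : Prop :=
  forall a b, a != b -> [exists S, separates M a b S] ->
    separates M a b (Sep a b) /\ Sep a b = Sep b a.

Definition collider_triple (V : finType) (M : seq (ci_stmt V))
    (Sep : V -> V -> {set V}) (t : V * V * V) : bool :=
  let: (a, b, c) := t in
  [&& a != c, adj (skeleton M) a b, adj (skeleton M) b c,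
      ~~ adj (skeleton M) a c & b \notin Sep a c].

(* The triples are processed one after the other, in any order; when two of
   them (for a model without causal explanation) ask for opposite orientations
   of an edge, the later one prevails. *)
Definition phaseI (V : finType) (M : seq (ci_stmt V)) (PiI : pdgraph V)
    : Prop :=
  exists (Sep : V -> V -> {set V}) (ts : seq (V * V * V)),
    [/\ is_Sep M Sep, ts =i collider_triple M Sep
      & PiI = foldl (fun G t => let: (a, b, c) := t in
                       orient (orient G a b) c b) (skeleton M) ts].

Definition failS1 (V : finType) (F : {set V * V}) (G : pdgraph V) : bool :=
  [exists a, exists b, ((a, b) \in F) && dir G a b].

Definition failS1' (V : finType) (R : {set V * V}) (G : pdgraph V) : bool :=
  [exists a, exists b, ((a, b) \in R) && (dir G b a || ~~ adj G a b)].

(* [phaseII_loop F G R o]: started at S1 with current graph G and remaining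
   required edges R, the loop may end with outcome o, [None] being failure.
   As in the procedure, S1 and S1' are not run again once R has been
   exhausted by S2. *)
Inductive phaseII_loop (V : finType) (F : {set V * V}) :
    pdgraph V -> {set V * V} -> option (pdgraph V) -> Prop :=
| phaseII_fail G R :
    failS1 F G || failS1' R G -> phaseII_loop F G R None
| phaseII_nothing_required G :
    ~~ failS1 F G -> phaseII_loop F G set0 (Some G)
| phaseII_last G R a b G' :
    ~~ failS1 F G -> ~~ failS1' R G -> (a, b) \in R ->
    closes (@rules1234 V) (orient G a b) G' ->
    R :\ (a, b) = set0 -> phaseII_loop F G R (Some G')
| phaseII_next G R a b G' o :
    ~~ failS1 F G -> ~~ failS1' R G -> (a, b) \in R ->
    closes (@rules1234 V) (orient G a b) G' ->
    R :\ (a, b) != set0 -> phaseII_loop F G' (R :\ (a, b)) o ->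
    phaseII_loop F G R o.

Definition phaseII (V : finType) (K : background V) (PiI : pdgraph V)
    (o : option (pdgraph V)) : Prop :=
  exists2 G, closes (@rules123 V) PiI G
           & phaseII_loop (forbidden K) G (required K) o.

Definition phasesI_II (V : finType) (M : seq (ci_stmt V)) (K : background V)
    (o : option (pdgraph V)) : Prop :=
  exists2 PiI, phaseI M PiI & phaseII K PiI o.

(* Phase III ignores the forbidden edges, so it may direct a forbidden edge that
   Phase II left undirected. *)
Definition forbidden_settled (V : finType) (K : background V) (G : pdgraph V)
    : Prop :=
  forall a b, (a, b) \in forbidden K -> ~~ undir G a b.

Inductive phaseIII (V : finType) : pdgraph V -> pdgraph V -> Prop :=
| phaseIII_done G : fully_directed G -> phaseIII G G
| phaseIII_choose G a b G1 G2 :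
    undir G a b -> closes (@rules1234 V) (orient G a b) G1 ->
    phaseIII G1 G2 -> phaseIII G G2.

From mathcomp Require Import all_algebra all_classical all_reals all_analysis.

Local Open Scope classical_set_scope.
Local Open Scope ring_scope.
Local Open Scope ereal_scope.

(* [g] is a version of the conditional probability of the event E given the
   sub-sigma-algebra H. *)
Definition cond_prob (R : realType) (d : measure_display)
    (W : measurableType d) (P : probability W R) (H : set (set W))
    (E : set W) (g : W -> R) : Prop :=
  [/\ forall Y : set R, measurable Y -> H (g @^-1` Y),
      P.-integrable setT (EFin \o g)
    & forall C, H C -> \int[P]_(w in C) (g w)%:E = P (E `&` C)].

(* The sigma-algebra generated by the variables X v, v in A. *)
Definition sigma_vars (V : finType) (d : measure_display)
    (W : measurableType d) (dT : V -> measure_display)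
    (T : forall v, measurableType (dT v)) (X : forall v, {mfun W >-> T v})
    (A : {set V}) : set (set W) :=
  <<s \bigcup_(v in [set` A]) preimage_set_system setT (X v) measurable >>.

(* Conditional independence of (X v), v in A, and (X v), v in B, given
   (X v), v in S.  Versions of the conditional probabilities always exist and
   are unique up to P-null sets. *)
Definition cond_indep (V : finType) (R : realType) (d : measure_display)
    (W : measurableType d) (P : probability W R) (dT : V -> measure_display)
    (T : forall v, measurableType (dT v)) (X : forall v, {mfun W >-> T v})
    (A B S : {set V}) : Prop :=
  forall (E F : set W) (gE gF gEF : W -> R),
    sigma_vars X A E -> sigma_vars X B F ->
    cond_prob P (sigma_vars X S) E gE ->
    cond_prob P (sigma_vars X S) F gF ->
    cond_prob P (sigma_vars X S) (E `&` F) gEF ->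
    {ae P, forall w, gEF w = (gE w * gF w)%R}.

Definition Markov (V : finType) (R : realType) (G : pdgraph V)
    (d : measure_display) (W : measurableType d) (P : probability W R)
    (dT : V -> measure_display) (T : forall v, measurableType (dT v))
    (X : forall v, {mfun W >-> T v}) : Prop :=
  forall v, cond_indep P X [set v]%SET (nondesc G v) (pa G v).

(* A probability measure over the variables in V is presented as the joint law
   of a family of random variables with values in arbitrary measurable
   spaces. *)
Definition entails (R : realType) (V : finType) (G : pdgraph V)
    (A B S : {set V}) : Prop :=
  forall (d : measure_display) (W : measurableType d) (P : probability W R)
    (dT : V -> measure_display) (T : forall v, measurableType (dT v))
    (X : forall v, {mfun W >-> T v}),
    Markov G P X -> cond_indep P X A B S.

Definition same_statements (R : realType) (V : finType) (M : seq (ci_stmt V))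
    (G : pdgraph V) : Prop :=
  forall A B S, disjoint3 A B S -> ((A, B, S) \in M <-> entails R G A B S).

Definition complete_causal_explanation (R : realType) (V : finType)
    (M : seq (ci_stmt V)) (G : pdgraph V) : Prop :=
  is_dag G /\ same_statements R M G.

Definition agreeing_total_order (V : finType) (G : pdgraph V) (prec : rel V)
    : Prop :=
  [/\ irreflexive prec, transitive prec,
      forall a b, a != b -> prec a b || prec b a
    & forall a b, dir G a b -> prec a b].

Definition passS2 (R : realType) (V : finType) (M : seq (ci_stmt V))
    (G : pdgraph V) : Prop :=
  forall A B S, (A, B, S) \in M -> entails R G A B S.

Definition passS3 (V : finType) (M : seq (ci_stmt V)) (G : pdgraph V)
    (prec : rel V) : Prop :=
  forall a, ([set a]%SET, [set b | prec b a]%SET :\: pa G a, pa G a) \in M.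

Inductive phaseIV_form : Type := Standard | Alternative.

(* In the standard form the graph has to fail for every choice of the total
   order in S3. *)
Definition fails_phaseIV (R : realType) (V : finType) (form : phaseIV_form)
    (M : seq (ci_stmt V)) (G : pdgraph V) : Prop :=
  cyclic G \/
  match form with
  | Standard => forall prec, agreeing_total_order G prec ->
                  ~ (passS2 R M G /\ passS3 M G prec)
  | Alternative => ~ same_statements R M G
  end.

(* Main.v *)
(* Three facts give the theorem.
   (1) Entailment is d-separation.  Conditional independence is a separoid, so
   the local Markov property gives separation in moral graphs; conversely an
   active walk carries fair bits along its collider-free segments, and sums of
   two bits at its colliders, which makes its ends dependent.  Hence Phase I
   finds the skeleton and the immoralities of any explanation, and S3 of Phase
   IV puts all entailed statements into a graphoid.
   (2) DAGs with the same skeleton and immoralities are joined by reversals of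
   covered arcs (Chickering), which preserve the Markov property.
   (3) In a graph closed under the rules every undirected edge can be oriented
   both ways (Meek).  The undirected components of the closure under R1-R3 are
   chordal and can be oriented separately; inside one, a consistent ordering
   with a before b arises by removing potential sinks other than a, and these
   exist by a variant of Dirac's theorem on simplicial vertices. *)

Require Import Defs.
From HB Require Import structures.
From mathcomp Require Import all_boot.
From mathcomp Require Import all_reals.
From mathcomp Require Import boolp zify measure probability.

Set Implicit Arguments.
Unset Strict Implicit.
Unset Printing Implicit Defensive.

(** * Active walks *)

(** The two halves of d-separation serve different ends. Completeness, an active walk refutes
    entailment, concerns measures. Soundness is proved for an abstract [separoid] and applied to the
    list M itself. Passing between graphs of one equivalence class is a separoid argument too,
    applied to conditional independence of random variables.

    The obstacle in Phase III is that required edges and earlier choices leave a graph [Pi] whose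
    undirected components are not independent of each other: there may be flags, a -> b and b - c
    without a -> c. So two graphs are carried along, the closure [C0] of Phase I under R1-R3, which
    has no flags and never changes, and the current [Pi]. An edge of [Pi] is oriented at will by
    re-ordering one component of [C0], inside which the arcs of [Pi] act as constraints; R4 enters
    there, to shorten directed paths beside an undirected edge. *)

Section Dag.
Variables (V : finType) (G : pdgraph V).

Definition dag_rank (a : V) : nat := #|[set x | connect (dir G) x a]|.

Lemma dag_rankP : ~~ cyclic G -> forall a b, dir G a b -> dag_rank a < dag_rank b.
Proof.
move=> acy a b ab; apply: proper_card; apply/properP; split.
  apply/subsetP => x; rewrite !inE => xa.
  by apply: connect_trans xa _; exact: connect1.
exists b; rewrite ?inE ?connect0//; apply: contra acy => ba.
by apply/existsP; exists a; apply/existsP; exists b; rewrite ab.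
Qed.

Lemma rank_acyclic (rank : V -> nat) :
  (forall a b, dir G a b -> rank a < rank b) -> ~~ cyclic G.
Proof.
move=> rankP; apply/existsP => -[a /existsP [b /andP [ab /connectP [p bp ap]]]].
suff : rank b <= rank a by rewrite leqNgt rankP.
rewrite {}ap {ab}; elim: p b bp => //= c p IHp b /andP [/rankP bc /IHp].
by apply: leq_trans; exact: ltnW.
Qed.

End Dag.

(* A walk from A is active given S when its colliders are in S and its other
   inner vertices are not; [active G A S true v] says that one ends in v
   through an edge out of v (or without any edge), [active G A S false v] that
   one ends in v through an edge into v. *)
Inductive active (V : finType) (G : pdgraph V) (A S : {set V}) : bool -> V -> Prop :=
| active_start a : a \in A -> active G A S true a
| active_up_up v p : active G A S true v -> v \notin S -> dir G p v -> active G A S true p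
| active_up_down v c : active G A S true v -> v \notin S -> dir G v c -> active G A S false c
| active_down_down v c : active G A S false v -> v \notin S -> dir G v c -> active G A S false c
| active_down_up v p : active G A S false v -> v \in S -> dir G p v -> active G A S true p.

Section ActiveModel.
Variables (V : finType) (G : pdgraph V) (A S : {set V}).

(* Bits are numbered by the collider-free segments of the walk; [cp u i] says
   that u carries a copy of bit i, [xr u i] that u carries the sum of the bits
   i and i + 1, and [own i] is the vertex at which bit i is drawn. *)
Record active_model (k : nat) (own : nat -> V) (cp xr : V -> nat -> bool) : Prop := {
  am_start : exists2 a, a \in A & cp a 0;
  am_xr : forall u i, xr u i -> [/\ i < k, exists2 p, dir G p u & cp p i
                               & exists2 p, dir G p u & cp p i.+1];
  am_link : forall i, i < k -> exists2 s, s \in S & xr s i;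
  am_le : forall u i, cp u i -> i <= k }.

(** Makes the copy of bit i at u a function of the parents of u and of the bits drawn at u. Copies
    stay outside S, so that the conditioned vertices reveal sums of bits only. *)
Definition justified (own : nat -> V) (cp : V -> nat -> bool) u i :=
  u \notin S /\ (own i = u \/ exists2 p, dir G p u & cp p i).

(** State while the walk climbs: bit k has reached v, but the vertex at which it is drawn may lie
    further up, so v is exempt from justification and [own] counts only below k. *)
Definition up_model v k own cp xr :=
  [/\ active_model k own cp xr, cp v k
    & forall u i, cp u i -> (u = v /\ i = k) \/
        u \notin S /\ (own i = u /\ i < k \/ exists2 p, dir G p u & cp p i)].

(** State while the walk descends: v need not hold bit k yet, because the next step decides whether
    v copies it or, as a collider, sums it. *)
Definition down_model v k own cp xr :=
  [/\ active_model k own cp xr, exists2 p, dir G p v & cp p k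
    & forall u i, cp u i -> justified own cp u i].

Definition add (r : V -> nat -> bool) v k : V -> nat -> bool := fun u i => r u i || ((u == v) && (i == k)).

Implicit Types (r : V -> nat -> bool).

Lemma addl r v k u i : r u i -> add r v k u i.
Proof. by rewrite /add => ->. Qed.

Lemma addr r v k : add r v k v k.
Proof. by rewrite /add !eqxx orbT. Qed.

Lemma addP r v k u i : add r v k u i -> r u i \/ u = v /\ i = k.
Proof. by case/orP => [?|/andP [/eqP -> /eqP ->]]; [left|right]. Qed.

Lemma active_model_cp k own own' cp xr v : active_model k own cp xr ->
  active_model k own' (add cp v k) xr.
Proof.
case=> [[a aA a0] xrP link le]; split => //.
- by exists a => //; exact: addl.
- by move=> u i /xrP [ik [p pu pi] [q qu qi]]; split => //; [exists p|exists q] => //; exact: addl.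
- by move=> u i /addP [/le//|[_ ->]].
Qed.

Lemma active_has_model b v : active G A S b v -> exists k own cp xr,
  if b then up_model v k own cp xr else down_model v k own cp xr.
Proof.
elim=> {b v} [a aA|v p _ [k [own [cp [xr [am vk J]]]]] vS pv|v c _ [k [own [cp [xr [am vk J]]]]] vS vc|
   v c _ [k [own [cp [xr [am pk J]]]]] vS vc|v p _ [k [own [cp [xr [am [q qv qk] J]]]]] vS pv].
- exists 0, (fun=> a), (add (fun _ _ => false) a 0), (fun _ _ => false).
  split; [split => //| |].
  + by exists a => //; exact: addr.
  + by move=> u i /addP [//|[_ ->]].
  + exact: addr.
  + by move=> u i /addP [//|]; left.
- exists k, own, (add cp p k), xr; split; [exact: active_model_cp am|exact: addr|].
  move=> u i /addP [|]; last by left.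
  case/J => [[-> ->]|[uS [[]|[q qu qi]]]]; right; split => //.
  + by right; exists p => //; exact: addr.
  + by left.
  + by right; exists q => //; exact: addl.
- exists k, (fun i => if i == k then v else own i), cp, xr; split.
  + by case: am => *; split.
  + by exists v.
  + move=> u i /J [[-> ->]|[uS [[o ik]|[q qu qi]]]]; split => //.
    * by left; rewrite eqxx.
    * by left; rewrite ltn_eqF.
    * by right; exists q.
- exists k, own, (add cp v k), xr; split; first exact: active_model_cp am.
    by exists v => //; exact: addr.
  have [p pv pk'] := pk.
  move=> u i /addP [/J [uS [o|[q qu qi]]]|[-> ->]]; split => //.
  + by left.
  + by right; exists q => //; exact: addl.
  + by right; exists p => //; exact: addl.
(* v is a collider: it takes the sum of bit k and a fresh bit k.+1, which p holds without an owner
   so far. *)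
- exists k.+1, own, (add cp p k.+1), (add xr v k); split; last 2 first.
  + exact: addr.
  + move=> u i /addP [cui|]; last by left.
    have [[a aA a0] xrP link le] := am.
    case: (J _ _ cui) => uS [o|[r ru ri]]; right; split => //.
    * by left; split => //; rewrite ltnS (le _ _ cui).
    * by right; exists r => //; exact: addl.
  + have [[a aA a0] xrP link le] := am; split.
    * by exists a => //; exact: addl.
    * move=> u i /addP [/xrP [ik [r ru ri] [s su si]]|[-> ->]].
        split; [exact: ltnW|exists r => //; exact: addl|exists s => //; exact: addl].
      by split => //; [exists q => //; exact: addl|exists p => //; exact: addr].
    * move=> i; rewrite ltnS leq_eqVlt => /predU1P [->|/link [s sS si]].
        by exists v => //; exact: addr.
      by exists s => //; exact: addl.
    * by move=> u i /addP [/le/leqW|[_ ->]].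
Qed.

Lemma active_final_model b v : active G A S b v -> v \notin S ->
  exists k own cp xr, [/\ active_model k own cp xr, cp v k
    & forall u i, cp u i -> justified own cp u i].
Proof.
move=> /active_has_model [k [own [cp [xr]]]]; case: b => -[am vk J] vS.
- exists k, (fun i => if i == k then v else own i), cp, xr; split => //.
    by case: am => *; split.
  move=> u i /J [[-> ->]|[uS [[o ik]|[q qu qi]]]]; split => //.
  + by left; rewrite eqxx.
  + by left; rewrite ltn_eqF.
  + by right; exists q.
- exists k, own, (add cp v k), xr; split; [exact: active_model_cp am|exact: addr|].
  have [p pv pk'] := vk.
  move=> u i /addP [/J [uS [o|[q qu qi]]]|[-> ->]]; split => //.
  + by left.
  + by right; exists q => //; exact: addl.
  + by right; exists p => //; exact: addl.
Qed.

End ActiveModel.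

(** * Separoids and the global Markov property *)

(** Dawid's axioms, for arbitrary and possibly overlapping sets. Intersection is left out because
    conditional independence of random variables violates it in general. *)
Record separoid (V : finType) (I : {set V} -> {set V} -> {set V} -> Prop) : Prop := {
  separoid_sym : forall A B S : {set V}, I A B S -> I B A S;
  separoid_sub : forall A B C S : {set V}, C \subset B -> I A B S -> I A C S;
  separoid_weak_union : forall A B C S : {set V}, C \subset B -> I A B S -> I A B (S :|: C);
  separoid_contraction : forall A B C S, I A B S -> I A C (S :|: B) -> I A (B :|: C) S;
  separoid_self : forall A S, I A S S }.

Section Separoid.
Variables (V : finType) (I : {set V} -> {set V} -> {set V} -> Prop) (sI : separoid I).
Implicit Types (A B C S D : {set V}) (v x y : V) (s p q : seq V) (G : pdgraph V).

Lemma separoid_subl A B C S : C \subset A -> I A B S -> I C B S.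
Proof. by move=> CA /(separoid_sym sI) h; apply/(separoid_sym sI)/(separoid_sub sI CA). Qed.

Lemma separoidUr A B S : I A B S -> I A (S :|: B) S.
Proof.
move=> h; apply: (separoid_contraction sI); first exact: (separoid_self sI).
by rewrite setUid.
Qed.

Lemma separoid_shift A B S D : S \subset D -> D \subset S :|: B -> I A B S -> I A B D.
Proof.
move=> SD DSB /separoidUr h.
have -> : D = S :|: (D :&: (S :|: B)) by rewrite (setIidPl DSB) (setUidPr SD).
apply: (separoid_sub sI (B := S :|: B)); first exact: subsetUr.
by apply: (separoid_weak_union sI) h; exact: subsetIr.
Qed.

(** The Markov property along an enumeration. Unlike [local_Markov] it passes to initial segments,
    which permits induction on the last vertex. *)
Definition ordered_Markov G s :=
  forall p v q, s = p ++ v :: q ->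
    {subset pa G v <= p} /\ I [set v] [set x in p] (pa G v).

Lemma ordered_Markov_prefix G s q : ordered_Markov G (s ++ q) -> ordered_Markov G s.
Proof. by move=> om p v q' E; apply: (om p v (q' ++ q)); rewrite E -catA. Qed.

Lemma ordered_Markov_rcons G s v : ordered_Markov G (rcons s v) ->
  [/\ ordered_Markov G s, {subset pa G v <= s} & I [set v] [set x in s] (pa G v)].
Proof.
rewrite -cats1 => om; have [pv Iv] := om s v [::] erefl.
by split=> //; exact: ordered_Markov_prefix om.
Qed.

(* The hypotheses say that S separates A from B in the moral graph of the
   ancestral set formed by the three of them. *)
Lemma ordered_Markov_moral G s A B S : uniq s -> ordered_Markov G s ->
  [disjoint A & B] -> [disjoint A & S] -> [disjoint B & S] ->
  (forall c, c \in A :|: B :|: S -> pa G c \subset A :|: B :|: S) ->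
  (forall a b, a \in A -> b \in B -> ~~ dir G a b && ~~ dir G b a) ->
  (forall a b c, a \in A -> b \in B -> c \in S -> ~~ (dir G a c && dir G b c)) ->
  I [set x in s | x \in A] [set x in s | x \in B] [set x in s | x \in S].
Proof.
move=> us om dAB dAS dBS anc nadj nchild.
elim/last_ind: s us om => [_ _|s v IHs].
  have e0 D : [set x in [::] | x \in D] = set0 by apply/setP => x; rewrite !inE.
  by rewrite !e0; exact: (separoid_self sI).
rewrite rcons_uniq => /andP [vs us] /ordered_Markov_rcons [om pas Iv].
have {IHs us om} IH := IHs us om.
have setr D : v \in D -> [set x in rcons s v | x \in D] = v |: [set x in s | x \in D].
  move=> vD; apply/setP => x; rewrite !inE mem_rcons inE.
  by case: eqP => // ->; rewrite vD.
have setn D : v \notin D -> [set x in rcons s v | x \in D] = [set x in s | x \in D].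
  move=> /negPf vD; apply/setP => x; rewrite !inE mem_rcons inE.
  by case: eqP => // ->; rewrite vD !andbF.
have disjE C D x : [disjoint C & D] -> x \in C -> x \notin D.
  by move=> /disjointFr h /h ->.
(* v comes last, hence is independent of all of s given its parents; if these lie in C and S, it is
   independent of D given C and S. *)
have step C D : (forall x, x \in pa G v -> x \in C :|: S) -> [disjoint C & D] ->
    I [set v] [set x in s | x \in D] ([set x in s | x \in C] :|: [set x in s | x \in S]).
  move=> paC dCD.
  have paC' : pa G v \subset [set x in s | x \in C] :|: [set x in s | x \in S].
    apply/subsetP => x xv; have := paC x xv; rewrite !inE.
    by rewrite (pas _ xv).
  apply: (separoid_sub sI (B := [set x in s])); first by apply/subsetP => x; rewrite !inE => /andP [].
  apply: separoid_shift Iv => //.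
  by apply/subsetP => x; rewrite !inE => /orP [/andP [->]|/andP [->]]; rewrite orbT.
case vA: (v \in A).
  rewrite (setr A vA) (setn B (disjE _ _ _ dAB vA)) (setn S (disjE _ _ _ dAS vA)).
  rewrite setUC; apply: (separoid_sym sI); apply: (separoid_contraction sI).
    exact: (separoid_sym sI).
  apply: (separoid_sym sI); rewrite setUC; apply: step => // x xv.
  have := subsetP (anc v _) x xv; rewrite !inE vA => /(_ isT).
  case/orP => [/orP [->//|xB]|->]; last by rewrite orbT.
  by have := nadj v x vA xB; move: xv; rewrite inE => ->; rewrite andbF.
case vB: (v \in B).
  rewrite (setn A (negbT vA)) (setr B vB) (setn S (disjE _ _ _ dBS vB)).
  rewrite setUC; apply: (separoid_contraction sI) => //.
  apply: (separoid_sym sI); rewrite setUC; apply: step => [x xv|]; last by rewrite disjoint_sym.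
  have := subsetP (anc v _) x xv; rewrite !inE vB orbT => /(_ isT).
  case/orP => [/orP [xA|->//]|->]; last by rewrite orbT.
  by have := nadj x v xA vB; move: xv; rewrite inE => ->.
case vS: (v \in S); last first.
  by rewrite (setn A (negbT vA)) (setn B (negbT vB)) (setn S (negbT vS)).
rewrite (setn A (negbT vA)) (setn B (negbT vB)) (setr S vS) setUC.
have add A' B' S' : I A' B' S' -> I [set v] B' (A' :|: S') -> I A' B' (S' :|: [set v]).
  move=> h1 /(separoid_sym sI) h2; apply: (separoid_sym sI).
  apply: (separoid_sub sI (B := A' :|: [set v])); first exact: subsetUl.
  apply: (separoid_weak_union sI); first exact: subsetUr.
  by apply: (separoid_contraction sI); [exact: (separoid_sym sI)|rewrite setUC].
have paU x : x \in pa G v -> [|| x \in A, x \in B | x \in S].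
  by move=> xv; have := subsetP (anc v _) x xv; rewrite !inE vS orbT -orbA => /(_ isT).
have [/existsP [a /andP [av aA]]|nA] := boolP [exists x, (x \in pa G v) && (x \in A)].
  apply: add => //; apply: step => // x xv; rewrite inE.
  case/or3P: (paU x xv) => [->//|xB|->]; last by rewrite orbT.
  by have := nchild a x v aA xB vS; move: av xv; rewrite !inE => -> ->.
apply: (separoid_sym sI); apply: add; first exact: (separoid_sym sI).
apply: step => [x xv|]; last by rewrite disjoint_sym.
rewrite inE; case/or3P: (paU x xv) => [xA|->//|->]; last by rewrite orbT.
by case/negP: nA; apply/existsP; exists x; rewrite xv.
Qed.

Definition topological G s :=
  [/\ uniq s, forall v, v \in s & pairwise (fun a b => ~~ dir G b a) s].

Lemma topologicalP G s p v q : topological G s -> s = p ++ v :: q ->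
  {subset pa G v <= p}.
Proof.
move=> [_ all pw] Es x; rewrite inE => xv; have := all x.
rewrite Es mem_cat inE => /or3P [//|/eqP xE|xq].
  by move: xv; rewrite xE /dir andbN.
move: pw; rewrite Es pairwise_cat /= => /and3P [_ _ /andP [/allP /(_ x xq)]].
by rewrite xv.
Qed.

Lemma topological_exists G : ~~ cyclic G -> exists s, topological G s.
Proof.
move=> acy; pose le a b := dag_rank G a <= dag_rank G b.
exists (sort le (enum V)); split.
- by rewrite sort_uniq enum_uniq.
- by move=> v; rewrite mem_sort mem_enum.
- have /sorted_pairwise : transitive le by move=> ? ? ?; exact: leq_trans.
  move=> h; have : sorted le (sort le (enum V)).
    by apply: sort_sorted => a b; exact: leq_total.
  rewrite h; apply: sub_pairwise => a b; rewrite /le leqNgt; apply: contra.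
  exact: dag_rankP.
Qed.

Lemma topological_index G s a b : topological G s -> dir G a b -> index a s < index b s.
Proof.
move=> ts ab; have [us all _] := ts.
have /path.splitPr bs : b \in s by exact: all.
case: bs ts us => p q ts us.
have : a \in p by apply: (topologicalP ts erefl); rewrite inE.
move: us; rewrite cat_uniq => /and3P [_ /hasPn nb _].
have bp : b \notin p by apply: nb; rewrite mem_head.
by move=> ap; rewrite !index_cat ap (negPf bp) /= eqxx addn0 index_mem.
Qed.

Lemma topological_nondesc G s p v q : topological G s -> s = p ++ v :: q ->
  [set x in p] \subset nondesc G v.
Proof.
move=> ts Es; apply/subsetP => x; rewrite !inE => xp; apply/negP => /connectP [r vr xE].
have : index v s <= index x s.
  rewrite {}xE {xp}; elim: r v vr {Es} => //= c r IHr v /andP [/(topological_index ts) vc /IHr].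
  by apply: leq_trans; exact: ltnW.
have [us _ _] := ts; rewrite Es index_cat.
have vp : v \notin p.
  by move: us; rewrite Es cat_uniq => /and3P [_ /hasPn /(_ v (mem_head _ _))].
by rewrite (negPf vp) /= eqxx addn0 leqNgt index_cat xp index_mem xp.
Qed.

Definition local_Markov G := forall v, I [set v] (nondesc G v) (pa G v).

Lemma local_ordered_Markov G s : topological G s -> local_Markov G -> ordered_Markov G s.
Proof.
move=> ts lm p v q Es; split; first exact: topologicalP ts Es.
exact: (separoid_sub sI (topological_nondesc ts Es)).
Qed.

(** The non-descendants of v that follow it are added by contraction in the order of the list. The
    parents of such a w are themselves non-descendants of v, hence already present, so w is
    independent of v given what is there. *)
Lemma ordered_local_Markov G s : (forall v, v \in s) -> ordered_Markov G s -> local_Markov G.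
Proof.
move=> all om v; have /path.splitPr vs := all v; case: vs om all => p q om all.
have [pav Iv] := om p v q erefl.
suff h q1 q2 : q = q1 ++ q2 ->
    I [set v] ([set x in p] :|: [set x in nondesc G v | x \in q1]) (pa G v).
  apply: (separoid_sub sI) (h q [::] _); last by rewrite cats0.
  apply/subsetP => x; rewrite !inE => nx; have := all x.
  rewrite mem_cat inE nx => /or3P [->//|/eqP xv|->]; last by rewrite orbT.
  by rewrite xv connect0 in nx.
elim/last_ind: q1 q2 => [q2 _|q1 w IHq q2 Eq].
  by apply: (separoid_sub sI) Iv; apply/subsetP => x; rewrite !inE andbF orbF.
have {}IHq := IHq (w :: q2); rewrite -cat_rcons in IHq; have {}IHq := IHq Eq.
set N := _ :|: _ in IHq.
case nw: (connect (dir G) v w).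
  apply: (separoid_sub sI) IHq; apply/subsetP => x; rewrite !inE mem_rcons inE.
  by case/orP => [->//|/andP [nx /predU1P [xw|->]]]; [rewrite xw nw in nx|rewrite nx orbT].
have [paw Iw] : {subset pa G w <= p ++ v :: q1} /\ I [set w] [set x in p ++ v :: q1] (pa G w).
  by apply: (om _ w q2); rewrite Eq -cats1 -!catA.
have Ivw : I [set v] [set w] (pa G v :|: N).
  apply: (separoid_sym sI); apply: (separoid_sub sI (B := [set x in p ++ v :: q1])).
    by rewrite sub1set inE mem_cat mem_head orbT.
  apply: separoid_shift Iw; apply/subsetP => x; last first.
    rewrite !inE !mem_cat inE => /orP [xv|]; last first.
      by case/orP => [->|/andP [_ ->]]; rewrite ?orbT.
    by rewrite (pav x) ?inE ?orbT.
  move=> xw; have := paw x xw; rewrite !inE mem_cat inE.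
  have -> : connect (dir G) v x = false.
    apply/negP => vx; have := connect_trans vx (connect1 _); rewrite inE in xw.
    by move=> /(_ _ xw); rewrite nw.
  case/or3P => [->|/eqP xv|->]; rewrite ?orbT //.
  by move: xw nw; rewrite inE xv => /connect1 ->.
apply: (separoid_sub sI) (separoid_contraction sI IHq Ivw).
apply/subsetP => x; rewrite !inE mem_rcons inE.
by case/orP => [->//|/andP [-> /predU1P [->|->]]]; rewrite ?eqxx ?orbT.
Qed.

(* Soundness of d-separation: the ancestors of A, B and S outside S that are
   reached by active walks are separated from the others in the moral graph. *)
Lemma local_Markov_inactive G A B S : ~~ cyclic G -> local_Markov G ->
  [disjoint A & S] -> [disjoint B & S] ->
  (forall d b, b \in B -> ~ active G A S d b) -> I A B S.
Proof.
move=> acy lm dAS dBS nact; have [s ts] := topological_exists acy.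
pose U := [set u | [exists x in A :|: B :|: S, connect (dir G) u x]].
have subU x : x \in A :|: B :|: S -> x \in U.
  by move=> xU; rewrite inE; apply/existsP; exists x; rewrite xU connect0.
have paU c : c \in U -> pa G c \subset U.
  rewrite inE => /existsP [x /andP [xU cx]]; apply/subsetP => z; rewrite !inE => zc.
  by apply/existsP; exists x; rewrite xU; apply: connect_trans cx; exact: connect1.
(* The walk follows a directed path from u towards A, B or S. If it meets S, it turns there and
   climbs back to u; if the path ends in A, a new walk starts there and climbs; an end in B is
   excluded by [nact]. *)
have bounce u : u \in U -> u \notin S -> active G A S false u -> active G A S true u.
  rewrite inE => /existsP [x /andP [xU /connectP [p up xE]]].
  elim: p u up xE => [u _ xE uS au|c p IHp u /= /andP [uc cp] xE uS au].
    move: xU; rewrite xE !inE (negPf uS) orbF => /orP [uA|uB]; first exact: active_start.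
    by case: (nact _ _ uB au).
  have ac := active_down_down au uS uc.
  have [cS|cS] := boolP (c \in S); first exact: active_down_up ac cS uc.
  apply: (active_up_up _ cS uc). exact: (IHp c cp xE cS ac).
pose A' := [set u in U | (u \notin S) && `[< active G A S true u >]].
pose B' := [set u in U | (u \notin S) && (u \notin A')].
have inA' d u : u \in U -> u \notin S -> active G A S d u -> u \in A'.
  move=> uU uS au; rewrite inE uU uS; apply/asboolP.
  by case: d au => //; exact: bounce.
have A'P u : u \in A' -> [/\ u \in U, u \notin S & active G A S true u].
  by rewrite inE => /and3P [? ? /asboolP ?].
have B'P u : u \in B' -> [/\ u \in U, u \notin S & u \notin A'].
  by rewrite inE => /and3P [].
have [us all _] := ts.
have := @ordered_Markov_moral G s A' B' S us (local_ordered_Markov ts lm).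
have setall D : [set x in s | x \in D] = D by apply/setP => x; rewrite inE all.
rewrite !setall => moral.
apply: (separoid_subl (A := A')); last apply: (separoid_sub sI (B := B')); last apply: moral.
- apply/subsetP => a aA; apply: (inA' true); last exact: active_start.
    by apply: subU; rewrite !inE aA.
  by rewrite (disjointFr dAS aA).
- apply/subsetP => b bB; rewrite inE subU; last by rewrite !inE bB orbT.
  rewrite (disjointFr dBS bB) /=.
  by apply/negP => /A'P [_ _ ab]; exact: (nact _ _ bB ab).
- rewrite disjoint_subset; apply/subsetP => u uA; rewrite inE; apply/negP => /B'P [_ _].
  by rewrite uA.
- by rewrite disjoint_subset; apply/subsetP => u /A'P [].
- by rewrite disjoint_subset; apply/subsetP => u /B'P [].
- have -> : A' :|: B' :|: S = U; last exact: paU.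
  apply/setP => u; apply/idP/idP.
    rewrite inE => /orP [/setUP [/A'P []//|/B'P []//]|uS].
    by apply: subU; rewrite inE uS orbT.
  move=> uU; rewrite in_setU in_setU; case uS: (u \in S); first by rewrite orbT.
  by rewrite orbF; case uA: (u \in A') => //=; rewrite inE uU uS uA.
- move=> a b /A'P [aU aS aa] /B'P [bU bS /negP nb]; apply/andP; split; apply/negP => h; apply: nb.
    by apply: (inA' false) => //; exact: active_up_down aa aS h.
  by apply: (inA' true) => //; exact: active_up_up aa aS h.
- move=> a b c /A'P [aU aS aa] /B'P [bU bS /negP nb] cS; apply/negP => /andP [ac bc]; apply: nb.
  apply: (inA' true) => //; apply: active_down_up cS bc.
  exact: active_up_down aa aS ac.
Qed.

End Separoid.

(** * Markov equivalence of DAGs *)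

Section OrderedMarkov.
Variables (V : finType) (I : {set V} -> {set V} -> {set V} -> Prop).

Lemma ordered_Markov_rconsI G s v : ordered_Markov I G s -> {subset pa G v <= s} ->
  I [set v] [set x in s] (pa G v) -> ordered_Markov I G (rcons s v).
Proof.
move=> om pav Iv p u q; elim/last_ind: q => [|q w _].
  by rewrite cats1 => /rcons_inj [<- <-].
by rewrite -rcons_cons -rcons_cat => /rcons_inj [Es _]; exact: om Es.
Qed.

Lemma eq_ordered_Markov G H s : (forall v, v \in s -> pa H v = pa G v) ->
  ordered_Markov I G s -> ordered_Markov I H s.
Proof.
move=> epa om p v q Es; rewrite epa; first exact: om Es.
by rewrite Es mem_cat mem_head orbT.
Qed.

End OrderedMarkov.

Section FullyDirected.
Variables (V : finType) (G : pdgraph V).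
Hypothesis dG : is_dag G.

Lemma dag_acyclic : ~~ cyclic G. Proof. by case/andP: dG. Qed.

Lemma dag_arc a b : (a, b) \in G -> (b, a) \notin G.
Proof.
move=> ab; apply/negP => ba; have /andP [/forallP /(_ a) /forallP /(_ b)] := dG.
by rewrite /undir ab ba.
Qed.

Lemma dag_dirE a b : dir G a b = ((a, b) \in G).
Proof. by rewrite /dir; case ab: (_ \in G) => //=; exact: dag_arc. Qed.

Lemma dag_adjE a b : adj G a b = dir G a b || dir G b a.
Proof. by rewrite !dag_dirE. Qed.

Lemma dag_irr a : dir G a a = false.
Proof. by rewrite /dir andbN. Qed.

Lemma dag_asym a b : dir G a b -> dir G b a = false.
Proof. by rewrite /dir => /andP [_ /negPf ->]. Qed.

Lemma dag_trans a b c : dir G a b -> dir G b c -> adj G a c -> dir G a c.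
Proof.
move=> ab bc; rewrite dag_adjE => /orP [//|ca].
have /dag_rankP r := dag_acyclic.
by have := ltn_trans (ltn_trans (r _ _ ab) (r _ _ bc)) (r _ _ ca); rewrite ltnn.
Qed.

End FullyDirected.

Definition vstructure (V : finType) (G : pdgraph V) (a b c : V) : bool :=
  [&& dir G a b, dir G c b, a != c & ~~ adj G a c].

(** * Reversal of one covered arc *)

Section CoveredFlip.
Variables (V : finType) (G : pdgraph V) (x y : V).
Hypotheses (dG : is_dag G) (xy : dir G x y) (cov : pa G y = x |: pa G x).
Local Notation G' := (orient G y x).

Let xNy : x != y.
Proof. by apply: contraTneq xy => ->; rewrite dag_irr. Qed.

Lemma flip_arc a b : ((a, b) \in G') = ((a, b) == (y, x)) || ((a, b) \in G) && ((a, b) != (x, y)).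
Proof. by rewrite !inE andbC. Qed.

Lemma flip_fully_directed : fully_directed G'.
Proof.
apply/forallP => a; apply/forallP => b; rewrite /undir !flip_arc.
apply/negP => /andP [/predU1P [[-> ->]|/andP [ab nab]] /predU1P [[E1 E2]|/andP [ba nba]]].
- by move: xNy; rewrite E1 eqxx.
- by rewrite eqxx in nba.
- by rewrite E1 E2 eqxx in nab.
- by have := dag_arc dG ab; rewrite ba.
Qed.

Lemma flip_dirE a b : dir G' a b = ((a, b) == (y, x)) || dir G a b && ((a, b) != (x, y)).
Proof.
transitivity ((a, b) \in G'); last by rewrite flip_arc dag_dirE.
rewrite /dir; case ab: ((a, b) \in G') => //=.
by have /forallP /(_ a) /forallP /(_ b) := flip_fully_directed; rewrite /undir ab.
Qed.

Lemma flip_adj a b : adj G' a b = adj G a b.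
Proof.
rewrite /adj !flip_arc; move: xy; rewrite dag_dirE// => xyG.
have swap c d : ((b, a) == (c, d)) = ((a, b) == (d, c)) by rewrite !xpair_eqE andbC.
rewrite !swap; case: (eqVneq (a, b) (y, x)) => [[-> ->]|_]; first by rewrite xyG orbT.
by case: (eqVneq (a, b) (x, y)) => [[-> ->]|_]; rewrite ?xyG ?orbT //= !andbT.
Qed.

Lemma flip_pa v : pa G' v = if v == x then y |: pa G x else if v == y then pa G x else pa G v.
Proof.
apply/setP => z; rewrite inE flip_dirE !xpair_eqE.
case: (eqVneq v x) => [->|vx].
  by rewrite !inE andbT (negPf xNy) andbF andbT.
case: (eqVneq v y) => [->|vy].
  have := congr1 (fun D : {set V} => z \in D) cov; rewrite /= !inE => ->.
  rewrite andbF andbT /=; case: eqVneq => [->|_]; rewrite ?andbT ?andbF//=.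
  by rewrite dag_irr.
by rewrite !andbF !andbT !inE.
Qed.

(** Coveredness keeps the arc out of all immoralities: the other parents of y are those of x, so
    before and after the reversal they are adjacent to both ends. *)
Lemma flip_vstructure a b c : vstructure G' a b c = vstructure G a b c.
Proof.
have paE (H : pdgraph V) z w : dir H z w = (z \in pa H w) by rewrite inE.
rewrite /vstructure flip_adj !(paE G') !(paE G) flip_pa.
have xadj z : z \in pa G x -> adj G x z /\ adj G z x.
  by rewrite inE dag_adjE // dag_adjE // => ->; rewrite orbT.
have yadj z : z \in pa G x -> adj G y z /\ adj G z y.
  move=> zx; have : z \in pa G y by rewrite cov inE zx orbT.
  by rewrite inE dag_adjE // dag_adjE // => ->; rewrite orbT.
case: (eqVneq b x) => [->|bx].
  rewrite !in_setU1; case: (eqVneq a y) => [->|ay] /=.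
    have -> : (y \in pa G x) = false by rewrite inE (dag_asym xy).
    case: (eqVneq c y) => [->|cy] /=; first by rewrite ?eqxx ?andbF.
    by case cx: (c \in pa G x) => //=; have [-> _] := yadj c cx; rewrite /= ?andbF.
  case: (eqVneq c y) => [->|cy] //=.
  have -> : (y \in pa G x) = false by rewrite inE (dag_asym xy).
  by case ax: (a \in pa G x) => //=; have [_ ->] := yadj a ax; rewrite /= ?andbF.
case: (eqVneq b y) => // ->.
rewrite cov !in_setU1; case: (eqVneq a x) => [->|ax] /=.
  have -> : (x \in pa G x) = false by rewrite inE dag_irr.
  case: (eqVneq c x) => [->|cx] /=; first by rewrite ?eqxx ?andbF.
  by case cp: (c \in pa G x) => //=; have [-> _] := xadj c cp; rewrite /= ?andbF.
case: (eqVneq c x) => [->|cx] //=.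
have -> : (x \in pa G x) = false by rewrite inE dag_irr.
by case ap: (a \in pa G x) => //=; have [_ ->] := xadj a ap; rewrite /= ?andbF.
Qed.

(** The proper ancestors of x come first, then x and y, then the rest. All parents of y other than x
    are parents of x, so nothing has to stand between the two. *)
Lemma covered_topological : exists s1 s2, topological G (s1 ++ x :: y :: s2).
Proof.
have [s [us all pw]] := topological_exists (dag_acyclic dG).
pose anc z := connect (dir G) z x.
exists [seq z <- s | anc z && (z != x)], [seq z <- s | ~~ anc z && (z != y)].
have acy := dag_acyclic dG.
have nback a : connect (dir G) a x -> dir G x a = false.
  move=> ax; apply: contraNF acy => xa.
  by apply/existsP; exists x; apply/existsP; exists a; rewrite xa ax.
have yanc : ~~ anc y by apply/negP => /nback; rewrite xy.
have xanc : anc x by exact: connect0.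
split.
- rewrite cat_uniq filter_uniq//=; apply/andP; split.
    rewrite !negb_or !mem_filter eqxx (negPf yanc) andbF /=.
    by apply/hasPn => z; rewrite /= !mem_filter => /andP [/andP [/negPf -> _] _].
  by rewrite inE negb_or xNy !mem_filter xanc eqxx andbF /= filter_uniq.
- move=> v; rewrite mem_cat !inE !mem_filter all.
  case: (eqVneq v x) => [_|vx]; first by rewrite orbT.
  case: (eqVneq v y) => [_|vy]; first by rewrite !orbT.
  by rewrite !andbT; case: (anc v).
- rewrite pairwise_cat /= !pairwise_filter// andbT.
  have ancP a b : anc b -> dir G a b -> anc a.
    by move=> bx ab; apply: connect_trans bx; exact: connect1.
  rewrite (dag_asym xy) /=; apply/and3P; split=> //.
  + apply/allrelP => b a; rewrite mem_filter => /andP [/andP [bx nbx] _].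
    rewrite !inE => /or3P [/eqP ->|/eqP ->|]; first by rewrite nback.
      by apply: contra yanc; exact: ancP.
    by rewrite mem_filter => /andP [/andP [na _] _]; apply: contra na; exact: ancP.
  + apply/allP => z; rewrite mem_filter => /andP [/andP [nz _] _].
    by apply: contra nz => zx; exact: connect1.
  + apply/allP => z; rewrite mem_filter => /andP [/andP [nz _] _]; apply: contra nz => zy.
    have : z \in pa G y by rewrite inE.
    by rewrite cov !inE => /orP [/eqP ->//|/connect1].
Qed.

Variables (I : {set V} -> {set V} -> {set V} -> Prop) (sI : separoid I).

(** Contraction turns the statements for x and y into one that is symmetric in them: s1 is
    independent of {x, y} given [pa G x]. It splits again in the other order, first y and then x
    given y. Later vertices keep their parents and the set of their predecessors. *)
Lemma flip_ordered_Markov s1 s2 : uniq (s1 ++ x :: y :: s2) ->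
  ordered_Markov I G (s1 ++ x :: y :: s2) -> ordered_Markov I G' (s1 ++ y :: x :: s2).
Proof.
elim/last_ind: s2 => [us om|s2 v IHs].
- have [om1 paxs Ix] : [/\ ordered_Markov I G s1, {subset pa G x <= s1} & I [set x] [set z in s1] (pa G x)].
    have [pxs Ix] := om s1 x [:: y] erefl.
    by split => //; exact: ordered_Markov_prefix om.
  have := om (rcons s1 x) y [::]; rewrite -cats1 -catA => /(_ erefl) [_].
  move: us; rewrite cat_uniq /= orbF negb_or => /and3P [_ /andP [xs ys] _].
  have -> : [set z in s1 ++ [:: x]] = [set z in s1] :|: [set x].
    by apply/setP => z; rewrite !inE mem_cat inE.
  rewrite cov setUC => Iy.
  have Iy' : I [set z in s1] [set y] (pa G x :|: [set x]).
    apply: (separoid_sym sI); rewrite setUC; apply: (separoid_sub sI) Iy; exact: subsetUr.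
  have Ixy := separoid_contraction sI (separoid_sym sI Ix) Iy'.
  rewrite -[s1 ++ _]cats0 -catA -!cat_rcons cats0.
  apply: ordered_Markov_rconsI; first apply: ordered_Markov_rconsI.
  + apply: eq_ordered_Markov om1 => v vs; rewrite flip_pa.
    by rewrite !ifN //; apply: contraTneq vs => ->.
  + by rewrite flip_pa eqxx eq_sym (negPf xNy) => z /paxs.
  + rewrite flip_pa eqxx eq_sym (negPf xNy); apply: (separoid_sym sI).
    by apply: (separoid_sub sI) Ixy; exact: subsetUr.
  + rewrite flip_pa eqxx => z; rewrite mem_rcons !inE => /orP [->//|zx].
    by rewrite paxs ?inE ?orbT.
  + rewrite flip_pa eqxx.
    have -> : [set z in rcons s1 y] = [set z in s1] :|: [set y].
      by apply/setP => z; rewrite !inE mem_rcons inE orbC.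
    have := separoid_weak_union sI (subsetUr [set x] [set y]) Ixy.
    move=> /(separoid_sub sI (subsetUl _ _)) /(separoid_sym sI) /(separoidUr sI).
    rewrite [y |: _]setUC => h; apply: (separoid_sub sI) h.
    by apply/subsetP => z; rewrite !inE => /orP [->//|->]; rewrite !orbT.
- rewrite -!rcons_cons -!rcons_cat rcons_uniq => /andP [vs us] /ordered_Markov_rcons [om pav Iv].
  move: vs; rewrite mem_cat !inE !negb_or => /and4P [vs1 vx vy vs2].
  have mem_swap z : (z \in s1 ++ y :: x :: s2) = (z \in s1 ++ x :: y :: s2).
    by rewrite !mem_cat !inE; case: (z == x); case: (z == y).
  apply: ordered_Markov_rconsI; first exact: IHs.
  + by rewrite flip_pa (negPf vx) (negPf vy) => z /pav; rewrite mem_swap.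
  + rewrite flip_pa (negPf vx) (negPf vy).
    by have -> : [set z in s1 ++ y :: x :: s2] = [set z in s1 ++ x :: y :: s2]
      by apply/setP => z; rewrite !inE mem_swap.
Qed.

End CoveredFlip.

Section MarkovEquivalence.
Variables (V : finType) (I : {set V} -> {set V} -> {set V} -> Prop) (sI : separoid I).
Implicit Types G H : pdgraph V.

Lemma flip_dag_Markov G x y : is_dag G -> dir G x y -> pa G y = x |: pa G x ->
  local_Markov I G -> is_dag (orient G y x) /\ local_Markov I (orient G y x).
Proof.
move=> dG xy cov lm; have [s1 [s2 ts]] := covered_topological dG xy cov.
have om := flip_ordered_Markov dG xy cov sI (let: And3 us _ _ := ts in us)
  (local_ordered_Markov sI ts lm).
have all v : v \in s1 ++ y :: x :: s2.
  have [_ /(_ v)] := ts; rewrite !mem_cat !inE.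
  by case: (v == x); case: (v == y).
split; last exact: (ordered_local_Markov sI all om).
rewrite /is_dag flip_fully_directed//=.
apply: (rank_acyclic (rank := fun v => index v (s1 ++ y :: x :: s2))) => a b ab.
have /path.splitPr bs := all b.
have [us _ _] := ts.
have us' : uniq (s1 ++ y :: x :: s2).
  by rewrite -(perm_uniq (s1 := s1 ++ x :: y :: s2)) // perm_cat2l; apply/permP => p /=; rewrite addnCA.
case: bs om us' {all} => p q om us'.
have [/(_ a) + _] := om p b q erefl; rewrite inE => /(_ ab) ap.
move: us'; rewrite cat_uniq /= => /and3P [_ /norP [bp _] _].
by rewrite !index_cat ap (negPf bp) /= eqxx addn0 index_mem.
Qed.

(* Chickering's argument: reverse the last arc into the first vertex at which
   the two graphs differ. *)
Lemma covered_difference G H : is_dag G -> is_dag H ->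
  (forall a b, adj G a b = adj H a b) ->
  (forall a b c, vstructure G a b c = vstructure H a b c) ->
  G != H -> exists x y, [/\ dir G x y, dir H y x & pa G y = x |: pa G x].
Proof.
move=> dG dH adjE vE nGH.
have rP := dag_rankP (dag_acyclic dG).
have adjP (K : pdgraph V) (dK : is_dag K) a b : adj K a b -> dir K a b \/ dir K b a.
  by rewrite dag_adjE// => /orP.
pose diff a b := dir G a b && dir H b a.
have [y0 /existsP [x0 xy0]] : exists y, [exists x, diff x y].
  have [/forallP allE|/forallPn [y /forallPn [x nxy]]] :=
    boolP [forall y, forall x, dir G x y == dir H x y].
    case/eqP: nGH; apply/setP => -[a b].
    by have /forallP /(_ a) /eqP := allE b; rewrite !dag_dirE.
  have Hadj : dir G x y || dir H x y by move: nxy; case: (dir G x y); case: (dir H x y).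
  have [xy|nGxy] := boolP (dir G x y).
    exists y; apply/existsP; exists x; rewrite /diff xy /=.
    have : adj H x y by rewrite -adjE dag_adjE// xy.
    by case/(adjP _ dH) => // h; rewrite xy h eqxx in nxy.
  have Hxy : dir H x y by move: Hadj; rewrite (negPf nGxy).
  exists x; apply/existsP; exists y; rewrite /diff Hxy andbT.
  have : adj G x y by rewrite adjE dag_adjE// Hxy.
  by case/(adjP _ dG) => // h; rewrite h in nGxy.
have [y /existsP [x1 xy1] ymin] := arg_minnP (dag_rank G) (P := fun y => [exists x, diff x y]) (i0 := y0)
  (introT existsP (ex_intro _ x0 xy0)).
have [x /andP [xy Hyx] xmax] := arg_maxnP (dag_rank G) (P := fun x => diff x y) (i0 := x1) xy1.
exists x, y; split => //.
have same a b : dag_rank G b < dag_rank G y -> dir G a b -> dir H a b.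
  move=> by_ ab; have : adj H a b by rewrite -adjE dag_adjE// ab.
  case/(adjP _ dH) => // ba; have : [exists a, diff a b].
    by apply/existsP; exists a; rewrite /diff ab.
  by move/ymin; rewrite leqNgt by_.
have yNx : y != x by apply: contraTneq xy => ->; rewrite dag_irr.
apply/setP => z; rewrite !inE; apply/idP/predU1P => [zy|[->//|zx]].
(* If z and x were not adjacent, z -> y <- x would be an immorality of G that H, with y -> x, lacks.
   If x -> z in G, H keeps this arc and must direct y -> z, against the choice of x as the last such
   parent. *)
- have [->|zNx] := eqVneq z x; [by left|right].
  have zNy : z != y by apply: contraTneq zy => ->; rewrite dag_irr.
  have zxa : adj G z x.
    apply/negPn/negP => nzx.
    have : vstructure G z y x by rewrite /vstructure zy xy zNx.
    by rewrite vE => /and3P [_]; rewrite (dag_asym Hyx).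
  case/(adjP _ dG): zxa => // xz.
  have Hxz : dir H x z by apply: same xz; exact: rP.
  have Hyz : dir H y z.
    by apply: (dag_trans dH Hyx Hxz); rewrite -adjE dag_adjE// zy orbT.
  have := xmax z; rewrite /diff zy Hyz => /(_ isT).
  by rewrite /= leqNgt rP.
- have Hzx : dir H z x by apply: same zx; exact: rP.
  have zNy : z != y.
    by apply: contraTneq zx => ->; rewrite (dag_asym xy).
  apply: (dag_trans dG zx xy); apply/negPn/negP => nzy.
  have : vstructure H z x y by rewrite /vstructure Hzx Hyx zNy -adjE nzy.
  by rewrite -vE => /and3P [_]; rewrite (dag_asym xy).
Qed.

Theorem Markov_equivalent G H : is_dag G -> is_dag H ->
  (forall a b, adj G a b = adj H a b) ->
  (forall a b c, vstructure G a b c = vstructure H a b c) ->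
  local_Markov I G -> local_Markov I H.
Proof.
have [n] := ubnP #|G :\: H|; elim: n G => // n IHn G ltn dG dH adjE vE lm.
have [<-//|nGH] := eqVneq G H.
have [x [y [xy Hyx cov]]] := covered_difference dG dH adjE vE nGH.
have [dG' lm'] := flip_dag_Markov dG xy cov lm.
apply: IHn lm' => // [|a b|a b c]; last 2 first.
- by rewrite flip_adj.
- by rewrite flip_vstructure.
rewrite -ltnS (leq_trans _ ltn)// ltnS; apply: proper_card; apply/properP; split.
  apply/subsetP => -[a b]; rewrite !inE => /andP [nH].
  case/predU1P => [[Ea Eb]|/andP [_ ->]]; last by rewrite nH.
  by move: nH; rewrite Ea Eb -dag_dirE// Hyx.
exists (x, y); rewrite !inE -!dag_dirE// xy (dag_asym Hyx)//.
by rewrite eqxx /= xpair_eqE; case: eqVneq xy => [->|]; rewrite ?dag_irr.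
Qed.

End MarkovEquivalence.

(** * Graphoids of listed statements *)

Lemma setU_setD (T : finType) (A B : {set T}) : A :|: (B :\: A) = A :|: B.
Proof. by apply/setP => x; rewrite !inE; case: (x \in A). Qed.

Section GraphoidSeparoid.
Variables (V : finType) (M : seq (ci_stmt V)).
Implicit Types A B C S : {set V}.

(** Extends the list to overlapping sets, as [separoid] demands: the condition is removed from both
    sides, and an overlap that remains counts as dependence. *)
Definition listed A B S : Prop :=
  [disjoint A :\: S & B :\: S] /\ (A :\: S, B :\: S, S) \in M.

Lemma listedP A B S : disjoint3 A B S -> listed A B S <-> (A, B, S) \in M.
Proof.
case/and3P => AB AS BS; rewrite /listed.
have /setDidPl -> := AS; have /setDidPl -> := BS.
by split=> [[]|].
Qed.

Lemma disjoint_setD A B : [disjoint A :\: B & B].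
Proof. by rewrite -setI_eq0 setIDAC setDIl setDv setI0. Qed.

Hypothesis gM : graphoid M.
Hypothesis M0 : forall B S, [disjoint B & S] -> (set0, B, S) \in M.

(** Once the condition is removed, [separoid_self] speaks of statements with an empty side. An empty
    list satisfies the graphoid axioms, so they cannot supply these; [M0] does. *)
Lemma listed_separoid : separoid listed.
Proof.
have [Msym Mdec Mwu Mcon _] := gM.
have dS A B S : [disjoint A :\: S & B :\: S] -> disjoint3 (A :\: S) (B :\: S) S.
  by move=> dAB; apply/and3P; split => //; exact: disjoint_setD.
have split_ B C : C \subset B -> B = C :|: (B :\: C) by move=> CB; rewrite setU_setD; exact/esym/setUidPr.
have sub A B C S : C \subset B -> listed A B S -> listed A C S.
  move=> CB [dAB MAB]; have CBS := setSD S CB.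
  have dAC := disjointWr CBS dAB; split => //.
  apply: (Mdec _ _ ((B :\: S) :\: (C :\: S))); last by rewrite -split_.
  rewrite /disjoint4 dS//= disjoint_sym disjoint_setD andbT.
  apply/and3P; split; rewrite ?disjoint_setD//; first by apply: disjointWr dAB; exact: subsetDl.
  by apply: disjointWl (disjoint_setD B S); exact: subsetDl.
have weak A B C S : C \subset B -> listed A B S -> listed A B (S :|: C).
  move=> CB [dAB MAB].
  have EA : A :\: (S :|: C) = A :\: S.
    rewrite -setDDl; apply/setDidPl; rewrite disjoint_subset; apply/subsetP => x xA.
    rewrite inE; apply/negP => xC; have := disjointFr dAB xA.
    by rewrite inE (subsetP CB)// andbT; move: xA; rewrite inE => /andP [->].
  have EB : B :\: (S :|: C) = (B :\: S) :\: (C :\: S).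
    by apply/setP => x; rewrite !inE; case: (x \in S) => //=; rewrite andbF.
  have ES : S :|: C = S :|: (C :\: S) by apply/setP => x; rewrite !inE; case: (x \in S).
  split; rewrite EA EB; first by apply: disjointWr dAB; exact: subsetDl.
  rewrite ES; apply: Mwu; last by rewrite setUC -split_//; exact: setSD.
  rewrite /disjoint4 disjoint_setD andbT; apply/andP; split; apply/and3P; split; rewrite ?disjoint_setD//.
  - by apply: disjointWr dAB; exact: subsetDl.
  - by apply: disjointWl (disjoint_setD B S); exact: subsetDl.
  - by apply: disjointWr dAB; exact: setSD.
split => //.
- by move=> A B S [dAB MAB]; split; [rewrite disjoint_sym|apply: Msym => //; exact: dS].
- move=> A B C S [dAB MAB] [dAC MAC].
  have EA : A :\: (S :|: B) = A :\: S.
    rewrite -setDDl; apply/setDidPl; rewrite disjoint_subset; apply/subsetP => x xA.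
    rewrite inE; apply/negP => xB; have := disjointFr dAB xA.
    by rewrite inE xB andbT; move: xA; rewrite inE => /andP [->].
  have EBC : (B :|: C) :\: S = (B :\: S) :|: (C :\: (S :|: B)).
    by apply/setP => x; rewrite !inE; case: (x \in S) => //=; case: (x \in B).
  have ES : S :|: B = S :|: (B :\: S) by apply/setP => x; rewrite !inE; case: (x \in S).
  rewrite EA in dAC MAC; split; rewrite EBC.
    by rewrite -setI_eq0 setIUr setU_eq0 !setI_eq0 dAB.
  have dCS : [disjoint C :\: (S :|: B) & S].
    by apply: disjointWr (disjoint_setD C (S :|: B)); exact: subsetUl.
  apply: Mcon => //; last by rewrite -ES.
  rewrite /disjoint4 dS//=; apply/andP; split; first by apply/and3P; split=> //; exact: disjoint_setD.
  rewrite disjoint_sym; apply: disjointWr (disjoint_setD C (S :|: B)).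
  by apply: subset_trans (subsetDl _ _) _; exact: subsetUr.
- move=> A S; split; rewrite setDv; first by rewrite disjoint_sym disjoints_subset sub0set.
  apply: Msym; first by apply/and3P; split; rewrite ?disjoint_setD// disjoints_subset sub0set.
  by apply: M0; exact: disjoint_setD.
Qed.

End GraphoidSeparoid.

Section OrderedBasis.
Variables (V : finType) (M : seq (ci_stmt V)) (gM : graphoid M) (V0 : 0 < #|V|).
Variables (H : pdgraph V) (prec : rel V).
Hypotheses (dH : is_dag H) (ato : agreeing_total_order H prec) (p3 : passS3 M H prec).

Let le a b := (a == b) || prec a b.
Let s := sort le (enum V).

Let all_s v : v \in s. Proof. by rewrite mem_sort mem_enum. Qed.

Let prec_asym a b : prec a b -> prec b a = false.
Proof.
have [irr tr _ _] := ato; move=> ab; apply/negP => ba.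
by have := tr _ _ _ ab ba; rewrite irr.
Qed.

Let prec_prefix p v q : s = p ++ v :: q -> [set x in p] = [set x | prec x v].
Proof.
have [irr tr tot _] := ato; move=> Es.
have le_tr : transitive le.
  move=> b a c /predU1P [->//|ab] /predU1P [<-|bc]; rewrite /le; first by rewrite ab orbT.
  by rewrite (tr _ _ _ ab bc) orbT.
have : sorted le s.
  apply: sort_sorted => a b; rewrite /le; have [->|ab] := eqVneq a b; first by [].
  by have := tot a b ab.
rewrite (sorted_pairwise le_tr) Es pairwise_cat /= => /and4P [/allrelP pq _ /allP vq _].
have us : uniq s by rewrite sort_uniq enum_uniq.
apply/setP => x; rewrite !inE; apply/idP/idP => [xp|xv].
  have := pq x v xp (mem_head _ _); rewrite /le; case: eqVneq => // xv.
  by move: us; rewrite Es -xv cat_uniq => /and3P [_ /hasPn /(_ x (mem_head _ _))]; rewrite /= xp.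
have := all_s x; rewrite Es mem_cat inE => /or3P [//|/eqP xE|/vq].
  by rewrite xE irr in xv.
rewrite /le => /predU1P [vx|/prec_asym]; last by rewrite xv.
by rewrite vx irr in xv.
Qed.

Let pa_prec v : pa H v \subset [set x | prec x v].
Proof. by have [_ _ _ ag] := ato; apply/subsetP => x; rewrite !inE => /ag. Qed.

Let p3' p v q : s = p ++ v :: q -> ([set v], [set x in p] :\: pa H v, pa H v) \in M.
Proof. by move/prec_prefix ->; exact: p3. Qed.

Let pre_disj3 p v q : s = p ++ v :: q -> disjoint3 [set v] ([set x in p] :\: pa H v) (pa H v).
Proof.
have [irr _ _ _] := ato.
move/prec_prefix ->; apply/and3P; split; rewrite ?disjoint_setD// disjoints1 !inE.
  by rewrite irr andbF.
by rewrite dag_irr.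
Qed.

(** All of them follow from the tests of S3. Weak union moves the predecessors of v into the
    condition, leaving v independent of the empty set; contraction along s collects all vertices,
    and decomposition and weak union descend to B and S. The start, with three empty sets, is taken
    from the first vertex, so V must be inhabited. *)
Lemma empty_listed (B S : {set V}) : [disjoint B & S] -> (set0, B, S) \in M.
Proof.
have [Msym Mdec Mwu Mcon _] := gM.
have d0 (A : {set V}) : [disjoint set0 & A] by rewrite disjoints_subset sub0set.
have d0' (A : {set V}) : [disjoint A & set0] by rewrite disjoint_sym d0.
have wu p v q : s = p ++ v :: q -> (set0, [set v], [set x in p]) \in M.
  move=> Es; have [d1 d2 d3] := and3P (pre_disj3 Es).
  have vp : [disjoint [set v] & [set x in p]].
    by rewrite (prec_prefix Es) disjoints1 inE; have [-> _ _ _] := ato.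
  apply: Msym; first by rewrite /disjoint3 d0' vp d0.
  have -> : [set x in p] = pa H v :|: ([set x in p] :\: pa H v).
    rewrite setU_setD; apply/esym/setUidPr.
    by rewrite (prec_prefix Es); exact: pa_prec.
  apply: Mwu; last by rewrite set0U; exact: p3' Es.
  by rewrite /disjoint4 /disjoint3 d0 d0' d1 d2 d3 /= d0.
have M00 : (set0, set0, set0) \in M.
  have /card_gt0P [v0 _] := V0.
  case Es: s => [|a q]; first by have := all_s v0; rewrite Es.
  have := wu [::] a q Es; rewrite (_ : [set x in [::]] = set0); last by apply/setP => x; rewrite !inE.
  rewrite -[[set a]]set0U => h; apply: Mdec h.
  by rewrite /disjoint4 /disjoint3 !d0 !d0'.
have Mp p q : s = p ++ q -> (set0, [set x in p], set0) \in M.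
  elim/last_ind: p q => [q _|p v IHp q].
    by rewrite (_ : [set x in [::]] = set0) //; apply/setP => x; rewrite !inE.
  rewrite -cats1 -catA /= => Es; have := IHp _ Es.
  rewrite (_ : [set x in p ++ [:: v]] = [set x in p] :|: [set v]); last first.
    by apply/setP => x; rewrite !inE mem_cat inE.
  move=> h; apply: Mcon => //; last by rewrite set0U; exact: wu Es.
  rewrite /disjoint4 /disjoint3 !d0 !d0' /= disjoint_sym (prec_prefix Es) disjoints1 inE.
  by have [-> _ _ _] := ato.
move=> dBS; have := Mp s [::]; rewrite cats0 => /(_ erefl).
have -> : [set x in s] = (B :|: S) :|: ~: (B :|: S) by rewrite setUCr; apply/setP => x; rewrite !inE all_s.
have dC (A : {set V}) : [disjoint A & ~: A] by rewrite disjoints_subset setCK.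
move=> /Mdec; rewrite /disjoint4 /disjoint3 !d0 !d0' dC /= => /(_ isT).
by move=> /Mwu; rewrite /disjoint4 /disjoint3 !d0 !d0' dBS /= set0U; exact.
Qed.

(** The tests of S3 are the ordered Markov property of [listed], so the soundness of d-separation
    for separoids applies to the list. *)
Lemma inactive_listed (A B S : {set V}) : disjoint3 A B S ->
  (forall d b, b \in B -> ~ active H A S d b) -> (A, B, S) \in M.
Proof.
move=> dABS nact; have [_ dAS dBS] := and3P dABS.
have sM := listed_separoid gM empty_listed.
apply/listedP => //; apply: (local_Markov_inactive sM (dag_acyclic dH) _ dAS dBS nact).
apply: (ordered_local_Markov sM all_s) => p v q Es; split.
  move=> x xv; have := subsetP (pa_prec v) x xv.
  by rewrite -(prec_prefix Es) inE.
apply: (separoid_sub sM (B := pa H v :|: ([set x in p] :\: pa H v))).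
  by rewrite setU_setD subsetUr.
apply: (separoidUr sM); apply/listedP; first exact: pre_disj3 Es.
exact: p3' Es.
Qed.

End OrderedBasis.

(** * Potential sinks of chordal graphs *)

Section Pdgraph.
Variables (V : finType) (G : pdgraph V).

Lemma adj_sym : symmetric (adj G).
Proof. by move=> a b; rewrite /adj orbC. Qed.

Lemma undir_sym : symmetric (undir G).
Proof. by move=> a b; rewrite /undir andbC. Qed.

Lemma dir_adj a b : dir G a b -> adj G a b.
Proof. by rewrite /dir /adj => /andP [->]. Qed.

Lemma undir_adj a b : undir G a b -> adj G a b.
Proof. by rewrite /undir /adj => /andP [->]. Qed.

Lemma dir_undirF a b : dir G a b -> undir G a b = false.
Proof. by rewrite /dir /undir => /andP [-> /negPf ->]. Qed.

Lemma undir_dirF a b : undir G a b -> dir G a b = false.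
Proof. by rewrite /dir /undir => /andP [-> ->]. Qed.

Lemma adj_cases a b : adj G a b -> [\/ dir G a b, dir G b a | undir G a b].
Proof.
rewrite /adj /dir /undir; case: ((a, b) \in G) => /=; case: ((b, a) \in G) => //= _.
- by constructor 3.
- by constructor 1.
- by constructor 2.
Qed.

End Pdgraph.

(** * Chordality, in the form of an acyclic orientation G without immoralities on [U0] *)

Section Chordal.
Variables (V : finType) (Pi G : pdgraph V) (U0 : {set V}).
Hypotheses (dG : is_dag G)
  (adjE : forall a b, adj Pi a b = adj G a b)
  (sub : forall a b, dir G a b -> (a, b) \in Pi)
  (perfect : forall a b c, a \in U0 -> b \in U0 -> c \in U0 ->
     dir G a c -> dir G b c -> a != b -> adj G a b)
  (R1 : forall a b, ~ rule1 Pi a b) (R2 : forall a b, ~ rule2 Pi a b)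
  (R4 : forall a b, ~ rule4 Pi a b).
Implicit Types U K X : {set V}.

Let rP := dag_rankP (dag_acyclic dG).

Let irrG a : adj G a a = false.
Proof. by rewrite dag_adjE// dag_irr. Qed.

Let dirG a b : dir Pi a b -> dir G a b.
Proof.
move=> ab; have : adj G a b by rewrite -adjE dir_adj.
rewrite dag_adjE// => /orP [//|/sub].
by move: ab; rewrite /dir => /andP [_ /negPf ->].
Qed.

Let dirN a b : dir Pi a b -> a != b.
Proof. by apply: contraTneq => ->; rewrite /dir andbN. Qed.

Let undirN a b : undir Pi a b -> a != b.
Proof. by apply: contraTneq => ->; apply/negP => /undir_adj; rewrite adjE irrG. Qed.

Let GadjP a b : adj G a b -> dir G a b \/ dir G b a.
Proof. by rewrite dag_adjE// => /orP. Qed.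

Let Pi1 a b : dir G a b -> undir Pi a b \/ dir Pi a b.
Proof. by move=> /sub; rewrite /undir /dir => ->; case: (_ \in Pi); [left|right]. Qed.

Let r1 x a b : dir Pi x a -> undir Pi a b -> adj G x b.
Proof.
move=> xa ab; apply/negPn/negP => nxb; apply: (R1 (a := a) (b := b)); exists x.
split => //; last by rewrite adjE.
rewrite /= !inE negb_or (dirN xa) (undirN ab) /= !andbT.
by apply: contraTneq xa => ->; rewrite /dir; move: ab; rewrite /undir => /andP [-> ->].
Qed.

Let r2 a y b : dir Pi a y -> dir Pi y b -> undir Pi a b -> False.
Proof.
move=> ay yb ab; apply: (R2 (a := a) (b := b)); exists y; split => //.
by rewrite /= !inE negb_or (dirN ay) (dirN yb) (undirN ab).
Qed.

Let r4 a y z b : undir Pi a y -> undir Pi a b -> dir Pi y z -> dir Pi z b ->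
  adj G a z -> adj G y b.
Proof.
move=> ay ab yz zb az; apply/negPn/negP => nyb.
apply: (R4 (a := a) (b := b)); exists y, z; split; rewrite ?adjE//.
have az' : a != z by apply: contraTneq az => ->; rewrite irrG.
have yb' : y != b.
  apply/eqP => E; have := ltn_trans (rP (dirG yz)) (rP (dirG zb)).
  by rewrite E ltnn.
by rewrite /= !inE !negb_or (undirN ay) az' (undirN ab) (dirN yz) yb' (dirN zb).
Qed.

Let e U a b := [&& a \in U, b \in U & dir Pi a b].

Let eG U a b := [&& a \in U, b \in U & dir G a b].

Let connect_rank U a b : connect (eG U) a b -> dag_rank G a <= dag_rank G b.
Proof.
move=> /connectP [p + ->]; elim: p a => //= c p IHp a /andP [/and3P [_ _ /rP ac] /IHp].
by apply: leq_trans; exact: ltnW.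
Qed.

Let connect_e_eG U a b : connect (e U) a b -> connect (eG U) a b.
Proof.
apply: connect_sub => {}a {}b /and3P [aU bU ab]; apply: connect1.
by rewrite /eG aU bU dirG.
Qed.

Let connect_dir U a b : connect (eG U) a b -> adj G a b -> dir G a b.
Proof.
move=> cab /GadjP [//|/rP]; by rewrite ltnNge (connect_rank cab).
Qed.

(** Induction on the path. If its last arc is w -> q and y - q, then y and w are both parents of q
    in G, hence adjacent; y -> w by induction, and R2 would orient y - q. *)
Let ancestor_dir U y p : U \subset U0 -> connect (e U) y p -> adj G y p -> dir Pi y p.
Proof.
move=> UU /connectP [r + ->]; elim/last_ind: r => [_|r q IHr]; first by rewrite irrG.
rewrite rcons_path last_rcons => /andP [yr /and3P [wU qU wq]] yq.
have yw : connect (e U) y (last y r) by apply/connectP; exists r.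
have yqG : dir G y q.
  apply: (connect_dir (U := U)) yq; apply: connect_e_eG.
  by apply: connect_trans yw _; apply: connect1; rewrite /e wU qU.
have [yq'|//] := Pi1 yqG.
have [Ey|yNw] := eqVneq y (last y r); first by rewrite {1}Ey.
have yU : y \in U by case: r yr wU {IHr wq yw yNw} => [|? ?] //= /andP [/and3P []].
have ywa : adj G y (last y r).
  by apply: (perfect (c := q)); rewrite ?(subsetP UU)// dirG.
by case: (r2 (IHr yr ywa) wq yq').
Qed.

(** When the walk steps from v back to a parent w, the directed path from r to v is retraced:
    without immoralities its vertex before v is adjacent to w, and either points to w or takes over
    the role of v, until r is reached. *)
Let common_source X u v : X \subset U0 -> u \in X ->
  connect (fun a b => [&& a \in X, b \in X & adj G a b]) u v ->
  exists2 r, r \in X & connect (eG X) r u /\ connect (eG X) r v.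
Proof.
move=> XU uX /connectP [p + ->]; elim/last_ind: p => [_|p w IHp].
  by exists u => //; rewrite connect0.
rewrite rcons_path last_rcons => /andP [/IHp [r rX [ru rv]] /and3P [vX wX]].
case/GadjP => [vw|wv].
  exists r => //; split => //; apply: connect_trans rv _.
  by apply: connect1; rewrite /eG vX wX.
suff [rw|wr] : connect (eG X) r w \/ connect (eG X) w r.
- by exists r.
- by exists w => //; split; [exact: connect_trans ru|exact: connect0].
case/connectP: rv => q rq E; rewrite {}E in vX wv.
elim/last_ind: q rq vX wv => [_ _ wr|q t IHq].
  by right; apply: connect1; rewrite /eG wX rX.
rewrite rcons_path last_rcons => /andP [rq /and3P [sX tX st]] _ wt.
have rs : connect (eG X) r (last r q) by apply/connectP; exists q.
have [<-|sNw] := eqVneq (last r q) w; first by left.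
have : adj G (last r q) w by apply: (perfect (c := t)); rewrite ?(subsetP XU).
case/GadjP => [sw|ws]; last exact: IHq.
by left; apply: connect_trans rs _; apply: connect1; rewrite /eG sX wX.
Qed.

(** The vertices that the algorithm of Dor and Tarsi removes: such an x may come last in an
    extension. *)
Definition potential_sink U x :=
  [/\ x \in U, forall y, y \in U -> ~~ dir Pi x y
    & forall y z, y \in U -> z \in U -> undir Pi x y -> adj G x z -> y != z -> adj G y z].

Let connect_last X a b : connect (eG X) a b -> a != b ->
  exists2 t, t \in X & connect (eG X) a t /\ dir G t b.
Proof.
move=> /connectP [p + ->]; elim/last_ind: p => [|p c _]; first by rewrite eqxx.
rewrite rcons_path last_rcons => /andP [ap /and3P [tX cX tc]] _.
by exists (last a p) => //; split => //; apply/connectP; exists p.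
Qed.

(** Otherwise a path from q to q' through X would close with z to a cycle without a chord at z. The
    absence of immoralities excludes it: a common source of q and q' in X forces q -> z and q' ->
    z. *)
Let neighbours_adj X z q q' : X \subset U0 -> z \in U0 -> q \in X -> q' \in X ->
  connect (fun a b => [&& a \in X, b \in X & adj G a b]) q q' ->
  (forall c, c \in X -> c != q -> c != q' -> (c != z) && ~~ adj G c z) ->
  adj G q z -> adj G q' z -> q != q' -> adj G q q'.
Proof.
move=> XU zU qX q'X cqq' nz qz q'z qq'; apply/negPn/negP => nadj.
have [r rX [rq rq']] := common_source XU qX cqq'.
have toz p : p \in X -> p = q \/ p = q' -> adj G p z -> r != p -> dir G p z.
  move=> pX pE pz rp; case/GadjP: (pz) => // zp.
  have rp' : connect (eG X) r p by case: pE => ->.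
  have [t tX [_ tp]] := connect_last rp' rp.
  have tz : t != z -> adj G t z by move=> ?; apply: (perfect (c := p)) => //; exact: (subsetP XU).
  have tq : t = q \/ t = q'.
    have [|tNq] := eqVneq t q; first by left.
    have [|tNq'] := eqVneq t q'; first by right.
    by have /andP [/tz tza] := nz t tX tNq tNq'; rewrite tza.
  case/negP: nadj; have tpa : adj G t p by rewrite dag_adjE// tp.
  have tNp : t != p by apply: contraTneq tp => ->; rewrite dag_irr.
  by case: tq pE tNp tpa => -> [] ->; rewrite ?eqxx // adj_sym.
have both : dir G q z -> dir G q' z -> False.
  by move=> h h'; case/negP: nadj; apply: (perfect (c := z)) => //; exact: (subsetP XU).
have [Er|rNq] := eqVneq r q.
  rewrite Er in rq'; have q'z' : dir G q' z by apply: toz; rewrite ?Er //; right.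
  apply: (both _ q'z'); case/GadjP: qz => // zq.
  by have := leq_trans (rP zq) (connect_rank rq'); rewrite ltnNge (ltnW (rP q'z')).
have qz' : dir G q z by apply: toz => //; left.
apply: (both qz'); have [Er|rNq'] := eqVneq r q'; last by apply: toz => //; right.
rewrite Er in rq; case/GadjP: q'z => // zq'.
by have := leq_trans (rP zq') (connect_rank rq); rewrite ltnNge (ltnW (rP qz')).
Qed.


Section Source.
Variables (U K : {set V}).
Hypotheses (UU : U \subset U0) (KU : K \subset U)
  (cliqueK : forall a b, a \in K -> b \in K -> a != b -> adj G a b).

Let above x := [exists k in K, connect (e U) x k].

Let aboveE x y : x \in U -> y \in U -> dir Pi x y -> above y -> above x.
Proof.
move=> xU yU xy /existsP [k /andP [kK yk]]; apply/existsP; exists k; rewrite kK.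
by apply: connect_trans yk; apply: connect1; rewrite /e xU yU.
Qed.

Let aboveK k : k \in K -> above k.
Proof. by move=> kK; apply/existsP; exists k; rewrite kK connect0. Qed.

Section NearParent.
Variable x : V.
Hypotheses (xU : x \in U) (nx : ~~ above x) (xK : forall k, k \in K -> adj G x k).

Let ndir p k : k \in K -> p \in U -> connect (e U) p k -> dir Pi x p = false.
Proof.
move=> kK pU pk; apply: contraNF nx => xp; apply: (aboveE xU pU xp).
by apply/existsP; exists k; rewrite kK.
Qed.

Let adjx k p : k \in K -> p \in U -> connect (e U) p k -> adj G x p ->
  undir Pi x p \/ dir Pi p x.
Proof.
move=> kK pU pk; rewrite -adjE => /adj_cases [|px|xp]; last by left.
- by rewrite (ndir kK pU pk).
- by right.
Qed.

(** The path ends next to x, and its first vertex adjacent to x is a parent of x: an undirected edge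
    there would by R1 make the preceding vertex adjacent to x, and an arc out of x would put x above
    K. *)
Let descent k p r : k \in K -> p \in U -> path (e U) p r -> k = last p r -> ~~ adj G x p ->
  exists2 p', connect (e U) p p' & dir Pi p' x.
Proof.
move=> kK; elim: r p => [|p2 r IHr] p pU /=; first by move=> _ <-; rewrite xK.
move=> /andP [pp2 p2r] kE nxp; have /and3P [_ p2U d12] := pp2.
have p2k : connect (e U) p2 k by apply/connectP; exists r.
have [xp2|nxp2] := boolP (adj G x p2); last first.
  have [p' p2p' p'x] := IHr p2 p2U p2r kE nxp2; exists p' => //.
  by apply: connect_trans p2p'; exact: connect1.
case: (adjx kK p2U p2k xp2) => [xp2'|p2x]; last by exists p2 => //; exact: connect1.
case/negP: nxp; rewrite adj_sym; apply: (r1 d12); by rewrite undir_sym.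
Qed.

(** Induction on the path, with p its second vertex. If p is not adjacent to x, [descent] gives a
    parent of x that y reaches, against R2. If x - p, induction gives p = k or p -> k, and in the
    latter case R4 makes y adjacent to k. *)
Lemma near_parent k y : k \in K -> y \in U -> undir Pi x y -> connect (e U) y k ->
  y = k \/ dir Pi y k.
Proof.
move=> kK yU xy /connectP [p yp kE]; elim: p y yU xy yp kE => [|p r IHr] y yU xy /=.
  by move=> _ ->; left.
move=> /andP [yp pr] kE; have /and3P [_ pU dyp] := yp.
have pk : connect (e U) p k by apply/connectP; exists r.
have yk : connect (e U) y k by apply: connect_trans pk; exact: connect1.
have yx : undir Pi y x by rewrite undir_sym.
have [xp|nxp] := boolP (adj G x p); last first.
  have [p' pp' p'x] := descent kK pU pr kE nxp.
  have yp' : connect (e U) y p' by apply: connect_trans pp'; exact: connect1.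
  have p'y := r1 p'x xy; rewrite adj_sym in p'y.
  by case: (r2 (ancestor_dir UU yp' p'y) p'x yx).
case: (adjx kK pU pk xp) => [xp'|px]; last by case: (r2 dyp px yx).
have [Ep|pk'] := IHr p pU xp' pr kE; first by right; rewrite -Ep.
right; have [xk|kx] : undir Pi x k \/ dir Pi k x.
- by apply: (adjx kK) (xK kK); [exact: (subsetP KU)|exact: connect0].
- by apply: (ancestor_dir UU yk); exact: r4 xy xk dyp pk' xp.
- by case: (r2 pk' kx); rewrite undir_sym.
Qed.

Let adjxK k : k \in K -> undir Pi x k \/ dir Pi k x.
Proof.
by move=> kK; apply: (adjx kK); [exact: (subsetP KU)|exact: connect0|exact: xK].
Qed.

Let parent_adj k k' z : k \in K -> k' \in K -> z \in U -> dir Pi z k' -> undir Pi x z ->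
  undir Pi x k -> z != k -> adj G z k.
Proof.
move=> kK k'K zU zk' xz xk zNk.
have [Ek|kNk'] := eqVneq k k'; first by rewrite Ek -adjE dir_adj.
have := cliqueK kK k'K kNk'; rewrite -adjE => /adj_cases [kk'|k'k|kk'].
- apply: (perfect (c := k')); rewrite ?dirG//; apply: (subsetP UU) => //; exact: (subsetP KU).
- exact: r4 xz xk zk' k'k (xK k'K).
- by apply: (r1 zk'); rewrite undir_sym.
Qed.

Hypothesis nK : forall b k, b \in U -> ~~ above b -> k \in K -> adj G b k.

(** By [near_parent], y, and also z if it is above K, is a member of K or a parent of one. What
    remains meets at a vertex of K: two arcs into it are closed by [perfect], a directed path
    through it by R4, an arc followed by an undirected edge by R1. *)
Lemma undir_above_adj y z : y \in U -> z \in U -> undir Pi x y -> undir Pi x z ->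
  y != z -> above y -> adj G y z.
Proof.
move=> yU zU xy xz yNz /existsP [k /andP [kK yk]].
have kU := subsetP KU k kK; have kU0 := subsetP UU k kU.
have yU0 := subsetP UU y yU; have zU0 := subsetP UU z zU.
have [az|naz] := boolP (above z); last first.
  have zk := nK zU naz kK.
  have [->|yk'] := near_parent kK yU xy yk; first by rewrite adj_sym.
  move: zk; rewrite adj_sym -adjE => /adj_cases [kz|zk|kz].
  - exact: r4 xy xz yk' kz (xK kK).
  - by case/negP: naz; exact: aboveE zU kU zk (aboveK kK).
  - exact: r1 yk' kz.
have /existsP [k' /andP [k'K zk]] := az.
have k'U := subsetP KU k' k'K; have k'U0 := subsetP UU k' k'U.
have [Ey|yk'] := near_parent kK yU xy yk; have [Ez|zk'] := near_parent k'K zU xz zk.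
- by rewrite Ey Ez; apply: cliqueK; rewrite // -Ey -Ez.
- rewrite adj_sym Ey; apply: (parent_adj kK k'K zU zk') => //; first by rewrite -Ey.
  by rewrite -Ey eq_sym.
- by rewrite Ez; apply: (parent_adj k'K kK yU yk') => //; rewrite -Ez.
have xk : undir Pi x k.
  by case: (adjxK kK) => // kx; case: (r2 yk' kx); rewrite undir_sym.
have xk' : undir Pi x k'.
  by case: (adjxK k'K) => // kx; case: (r2 zk' kx); rewrite undir_sym.
have [Ey|yNk'] := eqVneq y k'; first by rewrite Ey adj_sym -adjE dir_adj.
have := parent_adj k'K kK yU yk' xy xk' yNk'.
rewrite -adjE => /adj_cases [yk2|k'y|yk2].
- by apply: (perfect (c := k')) => //; exact: dirG.
- by rewrite adj_sym; exact: r4 xz xy zk' k'y (xK k'K).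
- by rewrite adj_sym; apply: (r1 zk'); rewrite undir_sym.
Qed.

End NearParent.

(* The witness is the last vertex that is not above K. *)
Lemma potential_sink_near b : b \in U -> ~~ above b ->
  (forall b k, b \in U -> ~~ above b -> k \in K -> adj G b k) ->
  exists2 x, x \notin K & potential_sink U x.
Proof.
move=> bU nb nK.
have Pb : (b \in U) && ~~ above b by rewrite bU.
have [x /andP [xU nx] xmax] := arg_maxnP (dag_rank G) (P := fun b => (b \in U) && ~~ above b) Pb.
exists x; first by apply: contra nx; exact: aboveK.
have nout y : y \in U -> ~~ dir Pi x y.
  move=> yU; apply/negP => xy; have [ay|nay] := boolP (above y).
    by case/negP: nx; exact: aboveE xU yU xy ay.
  by have := xmax y; rewrite yU nay /= leqNgt rP ?dirG// => /(_ isT).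
split=> // y z yU zU xy xz yNz; apply/negPn/negP => nyz.
have xz' : undir Pi x z.
  move: xz; rewrite -adjE => /adj_cases [xz|zx|//]; first by rewrite (negPf (nout z zU)) in xz.
  by case/negP: nyz; rewrite adj_sym; exact: r1 zx xy.
have aboveP w : w \in U -> dir G x w -> above w.
  move=> wU xw; apply: contraT => nw.
  by have := xmax w; rewrite wU nw /= leqNgt rP// => /(_ isT).
have xK k : k \in K -> adj G x k by exact: nK.
have [ay|nay] := boolP (above y).
  by case/negP: nyz; exact: (undir_above_adj xU nx xK nK yU zU xy xz' yNz ay).
have [az|naz] := boolP (above z).
  case/negP: nyz; rewrite adj_sym.
  by apply: (undir_above_adj xU nx xK nK zU yU xz' xy _ az); rewrite eq_sym.
(* Successors of x in G are above K by the choice of x, so y and z both precede x, and G has no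
   immorality at x. *)
case/negP: nyz; apply: (perfect (c := x)); rewrite ?(subsetP UU)//.
- move: xy => /undir_adj; rewrite adjE => /GadjP [/(aboveP y yU)|//].
  by rewrite (negPf nay).
- move: xz => /GadjP [/(aboveP z zU)|//].
  by rewrite (negPf naz).
Qed.

End Source.

(** Dirac's induction, with K as the end to be avoided. All arcs may lead into K, so a vertex b that
    does not reach K is required. If some such b' is not adjacent to a z in K, the component of b'
    away from z, with its boundary as the new clique, is a smaller instance. *)
Lemma exists_potential_sink U K b : U \subset U0 -> K \subset U ->
  (forall a a', a \in K -> a' \in K -> a != a' -> adj G a a') ->
  b \in U -> ~~ [exists k in K, connect (e U) b k] ->
  exists2 x, x \notin K & potential_sink U x.
Proof.
have [n] := ubnP #|U|; elim: n U K b => // n IHn U K b ltn UU KU cliqueK bU nb.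
have [[b' [z [b'U nb' [zK nb'z]]]]|nK] := pselect (exists b' z, [/\ b' \in U,
    ~~ [exists k in K, connect (e U) b' k] & z \in K /\ ~~ adj G b' z]); last first.
  apply: (potential_sink_near UU KU cliqueK bU nb) => b' k b'U nb' kK.
  by apply/negPn/negP => nb'k; apply: nK; exists b', k.
(* The component C of b' outside the neighbourhood of z, and its boundary Q,
   which is a clique of neighbours of z. *)
have zU := subsetP KU z zK; have zU0 := subsetP UU z zU.
have b'Nz : b' != z.
  by apply: contraNneq nb' => ->; apply/existsP; exists z; rewrite zK connect0.
pose far := [set v in U | (v != z) && ~~ adj G v z].
pose rel_far (u v : V) := [&& u \in far, v \in far & adj G u v].
pose C := [set v | connect rel_far b' v].
pose Q := [set q in U | (q \notin C) && [exists c in C, adj G q c]].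
have b'far : b' \in far by rewrite inE b'U b'Nz nb'z.
have Cfar c : c \in C -> c \in far.
  rewrite inE => /connectP [p + ->]; elim/last_ind: p => [//|p v _].
  by rewrite rcons_path last_rcons => /andP [_ /and3P []].
have farP c : c \in far -> [/\ c \in U, c != z & ~~ adj G c z].
  by rewrite inE => /and3P [].
have Cnext c v : c \in C -> v \in U -> adj G c v -> (v \in C) || (v \in Q).
  move=> cC vU cv; have [//|vC] := boolP (v \in C).
  by rewrite /= inE vU vC; apply/existsP; exists c; rewrite cC adj_sym.
have QP q : q \in Q -> [/\ q \in U, q \notin C & exists2 c, c \in C & adj G q c].
  by rewrite inE => /and3P [qU qC /existsP [c /andP [cC qc]]]; split => //; exists c.
have Qz q : q \in Q -> adj G q z.
  move=> /QP [qU qC [c cC qc]]; apply: contraT => nqz.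
  have [cU cz ncz] := farP c (Cfar c cC).
  case/negP: qC; rewrite inE; move: (cC); rewrite inE => b'c.
  apply: connect_trans b'c (connect1 _); rewrite /rel_far Cfar// adj_sym qc andbT inE qU nqz andbT.
  by apply: contraNneq ncz => <-; rewrite adj_sym.
have cliqueQ q q' : q \in Q -> q' \in Q -> q != q' -> adj G q q'.
  move=> qQ q'Q qq'; have [qU qC [c cC qc]] := QP q qQ; have [q'U q'C [c' c'C q'c']] := QP q' q'Q.
  pose X := [set q; q'] :|: C.
  have CX v : v \in C -> v \in X by move=> vC; rewrite inE vC orbT.
  have qX : q \in X by rewrite !inE eqxx.
  have q'X : q' \in X by rewrite !inE eqxx orbT.
  apply: (@neighbours_adj X z q q') => //; rewrite ?Qz//.
  - apply/subsetP => v; rewrite inE => /orP [|/Cfar/farP [vU _ _]]; last exact: (subsetP UU).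
    by case/set2P => ->; exact: (subsetP UU).
  - have cc' : connect rel_far c c'.
      move: cC c'C; rewrite !inE => b'c b'c'; apply: connect_trans b'c'.
      by rewrite (sym_connect_sym _) // => u v; rewrite /rel_far adj_sym andbCA.
    apply: (@connect_trans _ _ c); first by apply: connect1; rewrite qX (CX c cC).
    apply: (@connect_trans _ _ c'); last first.
      by apply: connect1; rewrite q'X (CX c' c'C) adj_sym.
    case/connectP: cc' => p cp ->; apply/connectP; exists p => //.
    elim: p c cC cp {qc} => //= v p IHp c cC /andP [cv vp].
    have vC : v \in C by move: cC; rewrite !inE => b'c; apply: connect_trans b'c (connect1 cv).
    by rewrite (CX c cC) (CX v vC); have /and3P [_ _ ->] := cv; exact: IHp.
  - by move=> v; rewrite in_setU => /orP [/set2P [] ->|/Cfar/farP [_ -> ->]]; rewrite ?eqxx.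
pose U' := C :|: Q.
have U'U : U' \subset U.
  by apply/subsetP => v /setUP [/Cfar/farP [] //|/QP []].
have nzU' : z \notin U'.
  apply/negP => /setUP [/Cfar/farP []|/Qz]; first by rewrite eqxx.
  by rewrite irrG.
have b'C : b' \in C by rewrite inE connect0.
have [||||||x xQ [xU' nout xs]] := IHn U' Q b'.
- apply: leq_trans (ltn : #|U| <= n); apply: proper_card; apply/properP; split => //.
  by exists z.
- exact: subset_trans U'U UU.
- exact: subsetUr.
- exact: cliqueQ.
- by rewrite inE b'C.
(* An arc u -> v from C into Q continues to z, for v - z would by R1, and z -> v by [perfect], make
   u adjacent to z. So b' would reach K. *)
- apply/existsP => -[q /andP [qQ /connectP [p b'p qE]]]; case/negP: nb'.
  apply/existsP; exists z; rewrite zK /=.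
  have eU u v : e U' u v -> e U u v.
    by case/and3P => uU vU uv; rewrite /e !(subsetP U'U).
  suff h p' u : u \in C -> path (e U') u p' -> q = last u p' ->
      connect (e U) b' u -> connect (e U) b' z by exact: (h p b').
  elim: p' u {p b'p qE} => [|v p IHp] u uC /=.
    by move=> _ E; have [_ /negP] := QP q qQ; rewrite E.
  move=> /andP [uv vp] qE b'u.
  have b'v : connect (e U) b' v by apply: connect_trans b'u _; apply/connect1/eU.
  have /and3P [_ vU' duv] := uv.
  have [vC|vC] := boolP (v \in C); first exact: (IHp v vC vp qE b'v).
  have vQ : v \in Q by move: vU'; rewrite inE (negPf vC).
  apply: connect_trans b'v (connect1 _); rewrite /e zU (subsetP U'U)//=.
  have [uU uz nuz] := farP u (Cfar u uC).
  have := Qz v vQ; rewrite -adjE => /adj_cases [//|zv|vz].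
    case/negP: nuz; apply: (perfect (c := v)); rewrite ?dirG// (subsetP UU)//.
    exact: (subsetP U'U).
  by case/negP: nuz; exact: r1 duv vz.
have xC : x \in C by move: xU'; rewrite inE (negPf xQ) orbF.
have [xU xz nxz] := farP x (Cfar x xC).
have nU' y : y \in U -> adj G x y -> y \in U'.
  by move=> yU xy; rewrite inE; exact: Cnext xC yU xy.
exists x.
  by apply: contra nxz => xK; apply: cliqueK.
split => // [y yU|y w yU wU xy xw].
  apply/negP => xy; have := nout y; rewrite xy => /(_ _)/negP; apply => //.
  by apply: nU' => //; rewrite -adjE dir_adj.
by apply: xs => //; apply: nU' => //; rewrite -adjE undir_adj.
Qed.

(** An orientation of U that extends Pi, given by ranks instead of arcs so that acyclicity is built
    in. The last condition excludes immoralities. *)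
Definition extension_rank U (r : V -> nat) :=
  [/\ forall u v, u \in U -> v \in U -> adj G u v -> r u != r v,
      forall u v, u \in U -> v \in U -> adj G u v -> r u < r v -> (u, v) \in Pi
    & forall u u' v, u \in U -> u' \in U -> v \in U -> adj G u v -> adj G u' v ->
        r u < r v -> r u' < r v -> u != u' -> adj G u u'].

Let extension_rank_dag U : U \subset U0 -> extension_rank U (dag_rank G).
Proof.
move=> UU; have dirr u v : adj G u v -> dag_rank G u < dag_rank G v -> dir G u v.
  by case/GadjP => // /rP vu uv; have := ltn_trans uv vu; rewrite ltnn.
split=> [u v _ _ /GadjP [/rP|/rP]|u v _ _ uv ruv|u u' v uU u'U vU uv u'v ruv ru'v].
- by rewrite neq_ltn => ->.
- by rewrite neq_ltn orbC => ->.
- by apply: sub; exact: dirr.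
- by apply: (perfect (c := v)); rewrite ?(subsetP UU)//; exact: dirr.
Qed.

(** x is ranked above all of U. Of two neighbours of x, one joined to it by an undirected edge is
    adjacent to the other by [potential_sink]; two arcs into x are arcs of G, which has no
    immoralities there. *)
Let extension_rank_sink U x r : U \subset U0 -> potential_sink U x ->
  extension_rank (U :\ x) r ->
  exists r', [/\ extension_rank U r', forall v, v \in U -> v != x -> r' v < r' x
    & forall v, v != x -> r' v = r v].
Proof.
move=> UU [xU nout xs] [rneq rPi rperf].
pose m := (\max_(v in U) r v).+1; pose r' v := if v == x then m else r v.
have lt_m v : v \in U -> r v < m by move=> vU; rewrite ltnS (leq_bigmax_cond _ vU).
have r'x : r' x = m by rewrite /r' eqxx.
have r'N v : v != x -> r' v = r v by rewrite /r' => /negPf ->.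
have inD v : v \in U -> v != x -> v \in U :\ x by move=> vU vx; rewrite !inE vx.
have toPi y : y \in U -> adj G y x -> (y, x) \in Pi.
  move=> yU; have := nout y yU; rewrite -adjE /dir /adj => nxy /orP [//|xy].
  by move: nxy; rewrite xy negbK.
exists r'; split => //; last by move=> v vU vx; rewrite r'x r'N// lt_m.
split.
- move=> u v uU vU uv; have [Eu|ux] := eqVneq u x; have [Ev|vx] := eqVneq v x.
  + by move: uv; rewrite Eu Ev irrG.
  + by rewrite Eu r'x r'N// neq_ltn orbC lt_m.
  + by rewrite Ev r'x r'N// neq_ltn lt_m.
  + by rewrite !r'N//; apply: rneq; rewrite // inD.
- move=> u v uU vU uv; have [Eu|ux] := eqVneq u x; have [Ev|vx] := eqVneq v x.
  + by move: uv; rewrite Eu Ev irrG.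
  + by rewrite Eu r'x r'N// => /(ltn_trans (lt_m v vU)); rewrite ltnn.
  + by rewrite Ev in uv * => _; exact: toPi.
  + by rewrite !r'N//; apply: rPi; rewrite // inD.
- move=> u u' v uU u'U vU uv u'v; have [Ev|vx] := eqVneq v x; last first.
    have lt_x w : w \in U -> r' w < r' v -> w != x.
      move=> wU; apply: contraTneq => ->; rewrite r'x r'N// -leqNgt ltnW// lt_m//.
    move=> ruv ru'v; have ux := lt_x u uU ruv; have u'x := lt_x u' u'U ru'v.
    by move: ruv ru'v; rewrite !r'N//; apply: rperf; rewrite // inD.
  move=> _ _ uNu'; rewrite Ev in uv u'v.
  have xu : adj G x u by rewrite adj_sym.
  have xu' : adj G x u' by rewrite adj_sym.
  case: (boolP (undir Pi x u)) => [xu2|nxu]; first exact: xs.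
  case: (boolP (undir Pi x u')) => [xu2|nxu'].
    by rewrite adj_sym; apply: xs; rewrite // eq_sym.
  have toD y : y \in U -> adj G y x -> ~~ undir Pi x y -> dir G y x.
    move=> yU yx ny; apply: dirG; move: ny; rewrite /undir /dir toPi// andbT.
    by move=> ->.
  by apply: (perfect (c := x)); rewrite ?(subsetP UU)//; exact: toD.
Qed.

Lemma extension_either U a b : U \subset U0 -> a \in U -> b \in U -> undir Pi a b ->
  exists2 r, extension_rank U r & r a < r b.
Proof.
have [n] := ubnP #|U|; elim: n U => // n IHn U ltn UU aU bU ab.
have [||||x xa px] := exists_potential_sink (U := U) (K := [set a]) (b := b) UU.
- by rewrite sub1set.
- by move=> u v /set1P -> /set1P ->; rewrite eqxx.
- exact: bU.
- apply/existsP => -[k /andP [/set1P -> ba]].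
  have : dir Pi b a by apply: (ancestor_dir UU ba); rewrite adj_sym -adjE undir_adj.
  by apply/negP; rewrite undir_dirF// undir_sym.
have [xU _ _] := px; rewrite inE in xa.
have DU : U :\ x \subset U0 by apply: subset_trans UU; exact: subsetDl.
(* When b itself is the sink, it goes last and G orders the remaining vertices, a among them. *)
have [Eb|bx] := eqVneq b x.
  have [r' [er' lt_x _]] := extension_rank_sink UU px (extension_rank_dag DU).
  by exists r' => //; rewrite Eb; apply: lt_x; rewrite // eq_sym.
have [|||||r er rab] := IHn (U :\ x); rewrite ?inE ?aU ?bU ?bx ?(eq_sym a) ?xa//.
  by apply: leq_trans (ltn : #|U| <= n); rewrite (cardsD1 x U) xU.
have [r' [er' _ r'N]] := extension_rank_sink UU px er.
by exists r' => //; rewrite !r'N// eq_sym.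
Qed.

End Chordal.

(** * Orienting edges *)

Section Refinement.
Variable V : finType.
Implicit Types (G Pi : pdgraph V) (a b u v : V).

Definition refinement Pi Pi' := Pi' \subset Pi /\ forall a b, adj Pi' a b = adj Pi a b.

Lemma refinement_refl Pi : refinement Pi Pi.
Proof. by split. Qed.

Lemma refinement_trans Pi1 Pi2 Pi3 :
  refinement Pi1 Pi2 -> refinement Pi2 Pi3 -> refinement Pi1 Pi3.
Proof.
move=> [s12 a12] [s23 a23]; split; first exact: subset_trans s23 s12.
by move=> a b; rewrite a23.
Qed.

Lemma refinement_dir Pi Pi' a b : refinement Pi Pi' -> dir Pi a b -> dir Pi' a b.
Proof.
move=> [/subsetP s12 a12] /andP [ab /negP nba].
have : adj Pi' a b by rewrite a12 /adj ab.
rewrite /adj /dir; have [/s12 //|_] := boolP ((b, a) \in Pi').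
by rewrite orbF => ->.
Qed.

Lemma refinement_undir Pi Pi' a b : refinement Pi Pi' -> undir Pi' a b -> undir Pi a b.
Proof. by move=> [/subsetP s12 _] /andP [/s12 ab /s12 ba]; rewrite /undir ab. Qed.

Lemma orient_arc Pi a b u v : ((u, v) \in orient Pi a b) =
  ((u, v) == (a, b)) || ((u, v) \in Pi) && ((u, v) != (b, a)).
Proof. by rewrite !inE andbC. Qed.

Lemma orient_dir Pi a b : a != b -> dir (orient Pi a b) a b.
Proof.
by move=> ab; rewrite /dir !orient_arc !xpair_eqE !eqxx /= andbF orbF (negPf ab) andbF.
Qed.

Lemma orient_dirP Pi a b u v : dir (orient Pi a b) u v -> (u, v) = (a, b) \/ dir Pi u v.
Proof.
rewrite /dir !orient_arc negb_or negb_and negbK.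
case/andP => /predU1P [->|/andP [uv _]]; first by left.
case/andP => _ /orP [vu|/eqP [-> ->]]; last by left.
by right; rewrite uv.
Qed.

Lemma orient_refinement Pi a b : a != b -> adj Pi a b -> ~~ dir Pi b a ->
  refinement Pi (orient Pi a b).
Proof.
move=> aNb ab nba; have abP : (a, b) \in Pi.
  by move: ab nba; rewrite /adj /dir; case: ((a, b) \in Pi) => //= ->.
split.
  by apply/subsetP => -[u v]; rewrite orient_arc => /predU1P [[-> ->]|/andP []].
move=> u v; rewrite /adj !orient_arc.
have sw : ((v, u) == (b, a)) = ((u, v) == (a, b)) by rewrite !xpair_eqE andbC.
have sw' : ((v, u) == (a, b)) = ((u, v) == (b, a)) by rewrite !xpair_eqE andbC.
rewrite sw sw'; case: eqVneq => [[-> ->]|_]; first by rewrite abP.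
by case: eqVneq => [[-> ->]|_]; rewrite ?abP ?orbT //= !andbT.
Qed.

Definition orients_edges (rules : pdgraph V -> V -> V -> Prop) :=
  forall Pi a b, rules Pi a b -> a != b /\ undir Pi a b.

Lemma rules1234_edges : orients_edges (@rules1234 V).
Proof.
move=> Pi a b.
have uneq (s : seq V) : uniq (a :: rcons s b) -> a != b.
  by rewrite /= mem_rcons inE negb_or => /andP [/andP []].
case=> [[x [us _ ab _]]|[y [us _ _ ab]]|[y [z [us [_ _ ab] _ _ _]]]|[y [z [us [_ ab] _ _ _]]]]; split => //.
- by move: us; rewrite /= !inE => /and3P [].
- exact: (uneq [:: y]).
- exact: (uneq [:: y; z]).
- exact: (uneq [:: y; z]).
Qed.

Lemma rules123_1234 Pi a b : rules123 Pi a b -> rules1234 Pi a b.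
Proof. by case=> h; [constructor 1|constructor 2|constructor 3]. Qed.

Lemma rules123_edges : orients_edges (@rules123 V).
Proof. by move=> Pi a b /rules123_1234; exact: rules1234_edges. Qed.

Section Closes.
Variables (rules : pdgraph V -> V -> V -> Prop) (oe : orients_edges rules).

Lemma closes_refinement Pi Pi' : closes rules Pi Pi' -> refinement Pi Pi'.
Proof.
elim=> {Pi Pi'} [Pi _|Pi a b Pi' r _]; first exact: refinement_refl.
apply: refinement_trans; have [ab uab] := oe r.
by apply: orient_refinement => //; [exact: undir_adj|rewrite undir_dirF// undir_sym].
Qed.

Lemma closes_closed Pi Pi' : closes rules Pi Pi' -> forall a b, ~ rules Pi' a b.
Proof. by elim. Qed.

Lemma orient_card Pi a b : a != b -> undir Pi a b -> #|orient Pi a b| < #|Pi|.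
Proof.
move=> aNb /andP [ab ba]; apply: proper_card; apply/properP; split.
  by apply/subsetP => -[u v]; rewrite orient_arc => /predU1P [[-> ->]|/andP []].
exists (b, a) => //; rewrite orient_arc eqxx andbF orbF.
by rewrite xpair_eqE eq_sym (negPf aNb).
Qed.

Lemma closes_exists Pi : exists Pi', closes rules Pi Pi'.
Proof.
have [n] := ubnP #|Pi|; elim: n Pi => // n IHn Pi ltn.
have [[a [b r]]|nr] := pselect (exists a b, rules Pi a b); last first.
  by exists Pi; constructor => a b r; apply: nr; exists a, b.
have [ab uab] := oe r.
have [|Pi' c] := IHn (orient Pi a b); first exact: leq_trans (orient_card ab uab) ltn.
by exists Pi'; exact: closes_step r c.
Qed.

End Closes.

Lemma phaseIII_exists Pi : (forall a, ~~ adj Pi a a) -> exists Pi', phaseIII Pi Pi'.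
Proof.
have [n] := ubnP #|Pi|; elim: n Pi => // n IHn Pi ltn nl.
have [fd|] := boolP (fully_directed Pi); first by exists Pi; constructor.
case/forallPn => a /forallPn [b]; rewrite negbK => ab.
have aNb : a != b by apply: contraTneq (undir_adj ab) => ->.
have [Pi1 c1] := closes_exists rules1234_edges (orient Pi a b).
have [s1 a1] := closes_refinement rules1234_edges c1.
have [_ ao] : refinement Pi (orient Pi a b).
  by apply: orient_refinement => //; [exact: undir_adj|rewrite undir_dirF// undir_sym].
have [||Pi2 p2] := IHn Pi1.
- by apply: leq_ltn_trans (subset_leq_card s1) _; exact: leq_trans (orient_card aNb ab) ltn.
- by move=> u; rewrite a1 ao.
by exists Pi2; exact: phaseIII_choose ab c1 p2.
Qed.

Lemma phaseIII_refinement Pi Pi' : (forall a, ~~ adj Pi a a) -> phaseIII Pi Pi' ->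
  refinement Pi Pi' /\ fully_directed Pi'.
Proof.
move=> nl p; elim: p nl => {Pi Pi'} [Pi fd|Pi a b Pi1 Pi2 ab c _ IH] nl.
  by split=> //; exact: refinement_refl.
have aNb : a != b by apply: contraTneq (undir_adj ab) => ->.
have r1 : refinement Pi Pi1.
  apply: refinement_trans (closes_refinement rules1234_edges c).
  by apply: orient_refinement => //; [exact: undir_adj|rewrite undir_dirF// undir_sym].
have [|r2 fd] := IH; first by move=> u; have [_ ->] := r1.
by split=> //; exact: refinement_trans r2.
Qed.

Lemma phaseII_loop_exists (F : {set V * V}) Pi R : exists o, phaseII_loop F Pi R o.
Proof.
have [n] := ubnP #|R|; elim: n Pi R => // n IHn Pi R ltn.
have [fail|] := boolP (failS1 F Pi || failS1' R Pi).
  by exists None; constructor.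
rewrite negb_or => /andP [f1 f1'].
have [->|/set0Pn [[a b] abR]] := eqVneq R set0; first by exists (Some Pi); constructor.
have [Pi' c] := closes_exists rules1234_edges (orient Pi a b).
have [R0|R0] := eqVneq (R :\ (a, b)) set0.
  by exists (Some Pi'); exact: phaseII_last f1 f1' abR c R0.
have [|o po] := IHn Pi' (R :\ (a, b)).
  by apply: leq_trans (ltn : #|R| <= n); rewrite [in leqRHS](cardsD1 (a, b)) abR.
by exists o; exact: phaseII_next f1 f1' abR c R0 po.
Qed.

Lemma failS1'P (R : {set V * V}) Pi a b : ~~ failS1' R Pi -> (a, b) \in R ->
  ~~ dir Pi b a /\ adj Pi a b.
Proof.
move=> /existsPn /(_ a) /existsPn /(_ b) + abR.
by rewrite abR /= negb_or negbK => /andP [].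
Qed.

Lemma phaseII_loop_required (F : {set V * V}) Pi R o : phaseII_loop F Pi R o ->
  (forall a, ~~ adj Pi a a) ->
  if o is Some Pi' then refinement Pi Pi' /\ forall a b, (a, b) \in R -> dir Pi' a b
  else True.
Proof.
elim=> {Pi R o} [//|Pi _ _|Pi R a b Pi' _ f1 abR c R0 nl|Pi R a b Pi' [Pi2|//] _ f1 abR c _ _ IH nl].
- by split=> [|a b]; [exact: refinement_refl|rewrite inE].
- have [nba ab] := failS1'P f1 abR.
  have aNb : a != b by apply: contraTneq ab => ->.
  have rc := closes_refinement rules1234_edges c.
  split; first exact: refinement_trans (orient_refinement aNb ab nba) rc.
  move=> u v uvR; have := in_set0 (u, v); rewrite -R0 !inE uvR andbT => /negbFE/eqP[-> ->].
  by apply: (refinement_dir rc); exact: orient_dir.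
- have [nba ab] := failS1'P f1 abR.
  have aNb : a != b by apply: contraTneq ab => ->.
  have rc := closes_refinement rules1234_edges c.
  have rc' := refinement_trans (orient_refinement aNb ab nba) rc.
  have [|r2 h2] := IH; first by move=> u; have [_ ->] := rc'.
  split; first exact: refinement_trans rc' r2.
  move=> u v uvR; have [[-> ->]|uv] := eqVneq (u, v) (a, b).
    by apply: (refinement_dir r2); apply: (refinement_dir rc); exact: orient_dir.
  by apply: h2; rewrite !inE uv.
Qed.

End Refinement.

(** * Consistent extensions *)

Section Extends.
Variable V : finType.
Implicit Types (G Pi C : pdgraph V) (a b u v : V).

(* By the last condition G has no immoralities that are not already oriented in
   Pi. *)
Definition extends G Pi :=
  [/\ forall a b, adj Pi a b = adj G a b, forall a b, dir G a b -> (a, b) \in Pi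
    & forall a b c, vstructure G a b c -> dir Pi a b].

Lemma vstructure_sym G a b c : vstructure G a b c = vstructure G c b a.
Proof. by rewrite /vstructure [adj G c a]adj_sym eq_sym andbCA. Qed.

Section Extension.
Variables (G Pi : pdgraph V) (dG : is_dag G) (ext : extends G Pi).

Lemma extends_adj a b : adj Pi a b = adj G a b. Proof. by have [] := ext. Qed.

Lemma extends_sub a b : dir G a b -> (a, b) \in Pi. Proof. by have [_ h _] := ext; exact: h. Qed.

Lemma extends_vstructure a b c : vstructure G a b c -> dir Pi a b /\ dir Pi c b.
Proof.
have [_ _ h] := ext; move=> abc; split; first exact: h abc.
by apply: (h c b a); rewrite vstructure_sym.
Qed.

Lemma extends_dir a b : dir Pi a b -> dir G a b.
Proof.
move=> ab; have := dir_adj ab; rewrite extends_adj dag_adjE// => /orP [//|/extends_sub].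
by move: ab; rewrite /dir => /andP [_ /negPf ->].
Qed.

Lemma extends_irr a : adj Pi a a = false.
Proof. by rewrite extends_adj dag_adjE// dag_irr. Qed.

Lemma extends_neq a b : adj Pi a b -> a != b.
Proof. by apply: contraTneq => ->; rewrite extends_irr. Qed.

Lemma extends_orient a b : dir G a b -> extends G (orient Pi a b).
Proof.
move=> ab; have abPi : adj Pi a b by rewrite extends_adj dir_adj.
have nba : ~~ dir Pi b a by apply/negP => /extends_dir; rewrite (dag_asym ab).
have r := orient_refinement (extends_neq abPi) abPi nba.
split=> [u v|u v uv|u v w /extends_vstructure [uv _]]; last exact: refinement_dir r uv.
- by have [_ ->] := r; rewrite extends_adj.
- rewrite orient_arc extends_sub//=; apply/orP; right.
  by apply: contraTneq uv => -[-> ->]; rewrite (dag_asym ab).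
Qed.

Lemma extends_trans a b c : dir Pi a b -> dir Pi b c -> adj Pi a c -> dir G a c.
Proof. by move=> /extends_dir ab /extends_dir bc; rewrite extends_adj; exact: (dag_trans dG ab bc). Qed.

(** Suppose b -> a in G. Then R2 closes a directed cycle, and in the other rules two non-adjacent
    vertices point to a; Pi would have oriented this immorality, but one of its edges is undirected
    there. *)
Lemma rules1234_sound a b : rules1234 Pi a b -> dir G a b.
Proof.
move=> r; have [aNb uab] := rules1234_edges r.
have := undir_adj uab; rewrite extends_adj dag_adjE// => /orP [//|ba].
have nov y : dir G y a -> ~~ adj Pi y b -> y != b -> dir G a b.
  move=> ya nyb yb; have : vstructure G b a y.
    by rewrite /vstructure ba ya eq_sym yb adj_sym -extends_adj nyb.
  by case/extends_vstructure; rewrite undir_dirF// undir_sym.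
case: r => [[x [us xa _ nxb]]|[y [_ ay yb _]]|[y [z [us [ay az _] yb zb nyz]]]|[y [z [us [ay _] [yz zb] az nyb]]]].
- apply: nov nxb _; first exact: extends_dir.
  by move: us; rewrite /= !inE negb_or => /andP [/andP []].
- by apply: extends_trans ay yb _; exact: undir_adj.
- have ya : dir G y a.
    by apply: (dag_trans dG (extends_dir yb) ba); rewrite -extends_adj adj_sym undir_adj.
  have za : dir G z a.
    by apply: (dag_trans dG (extends_dir zb) ba); rewrite -extends_adj adj_sym undir_adj.
  have yNz : y != z by move: us; rewrite /= !inE !negb_or => /and3P [_ /andP []].
  have : vstructure G y a z by rewrite /vstructure ya za yNz -extends_adj.
  by case/extends_vstructure; rewrite undir_dirF// undir_sym.
- have za : dir G z a.
    by apply: (dag_trans dG (extends_dir zb) ba); rewrite -extends_adj adj_sym.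
  have ya : dir G y a.
    by apply: (dag_trans dG (extends_dir yz) za); rewrite -extends_adj adj_sym undir_adj.
  apply: nov ya nyb _.
  by move: us; rewrite /= !inE !negb_or => /and3P [_ /andP []].
Qed.

End Extension.

Lemma extends_closes rules G Pi Pi' : is_dag G ->
  (forall Pi a b, rules Pi a b -> rules1234 Pi a b) ->
  closes rules Pi Pi' -> extends G Pi -> extends G Pi'.
Proof.
move=> dG sub; elim=> {Pi Pi'} [//|Pi a b Pi' /sub r _ IH] ext; apply: IH.
by apply: extends_orient => //; exact: rules1234_sound r.
Qed.

Lemma extends_directed G Pi : is_dag G -> extends G Pi -> fully_directed Pi -> Pi = G.
Proof.
move=> dG ext fd; apply/setP => -[a b]; rewrite -(dag_dirE dG).
apply/idP/idP => [ab|]; last exact: (extends_sub ext).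
apply: (extends_dir dG ext); rewrite /dir ab.
by have /forallP /(_ a) /forallP /(_ b) := fd; rewrite /undir ab.
Qed.

Lemma extends_vstructureE G H C : is_dag G -> is_dag H -> extends G C -> extends H C ->
  forall a b c, vstructure G a b c = vstructure H a b c.
Proof.
move=> dG dH eG eH a b c.
have imp K L : is_dag L -> extends K C -> extends L C -> vstructure K a b c -> vstructure L a b c.
  move=> dL eK eL vK; have [/(extends_dir dL eL) ab /(extends_dir dL eL) cb] := extends_vstructure eK vK.
  rewrite /vstructure ab cb -(extends_adj eL) (extends_adj eK).
  by case/and3P: vK.
by apply/idP/idP; exact: imp.
Qed.

(** * Absence of flags after closing Phase I under R1, R2 and R3 *)

Section Flags.
Variables (G PiI C0 : pdgraph V) (dG : is_dag G) (eI : extends G PiI).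
Hypothesis PiI_dir : forall a b, dir PiI a b -> exists c, vstructure G a b c.
Hypothesis closC : closes (@rules123 V) PiI C0.

Let eC : extends G C0.
Proof. by apply: (extends_closes dG _ closC eI) => *; exact: rules123_1234. Qed.

Let nr : forall a b, ~ rules123 C0 a b. Proof. exact: closes_closed closC. Qed.

Let neq a b : adj C0 a b -> a != b. Proof. exact: (extends_neq dG eC). Qed.

Let r1 x a b : dir C0 x a -> undir C0 a b -> x != b -> adj C0 x b.
Proof.
move=> xa ab xb; apply/negPn/negP => nxb; apply: (@nr a b); constructor 1; exists x.
by split=> //=; rewrite !inE negb_or xb (neq (dir_adj xa)) (neq (undir_adj ab)).
Qed.

Let r2 a y b : dir C0 a y -> dir C0 y b -> undir C0 a b -> False.
Proof.
move=> ay yb ab; apply: (@nr a b); constructor 2; exists y; split=> //=.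
by rewrite !inE negb_or (neq (dir_adj ay)) (neq (dir_adj yb)) (neq (undir_adj ab)).
Qed.

Let r3 a y z b : undir C0 a y -> undir C0 a z -> undir C0 a b -> dir C0 y b -> dir C0 z b ->
  y != z -> adj C0 y z.
Proof.
move=> ay az ab yb zb yz; apply/negPn/negP => nyz; apply: (@nr a b); constructor 3; exists y, z.
split=> //=; rewrite !inE !negb_or (neq (undir_adj ay)) (neq (undir_adj az)) (neq (undir_adj ab)).
by rewrite yz (neq (dir_adj yb)) (neq (dir_adj zb)).
Qed.

Let flag_adj a b c : dir C0 a b -> undir C0 b c -> dir C0 a c \/ undir C0 a c.
Proof.
move=> ab bc; have aNc : a != c.
  by apply: contraTneq bc => <-; apply/negP => ba; have := dir_undirF ab; rewrite undir_sym ba.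
case: (adj_cases (r1 ab bc aNc)) => [|ca|]; [by left| |by right].
by case: (r2 ca ab); rewrite undir_sym.
Qed.

(* Meek's lemma: in the closure under R1-R3, an arc into an undirected
   component comes from a common parent of the whole component.  By induction
   on the order in which the arcs were found. *)
Lemma no_flag a b c : dir C0 a b -> undir C0 b c -> dir C0 a c.
Proof.
pose noflag Pi := forall a b c, dir Pi a b -> undir C0 b c -> dir C0 a c.
suff h Pi C : closes (@rules123 V) Pi C -> C = C0 -> extends G Pi -> noflag Pi -> noflag C.
  move: a b c; apply: (h _ _ closC) => // a b c abI bc.
  (* The arc comes from an immorality a -> b <- d. If a - c, then d -> c or d - c by [flag_adj], and
     R1 or R3 makes a and d adjacent. *)
  have [d abd] := PiI_dir abI; have [ab db] := extends_vstructure eC abd.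
  have [_ _ aNd nad] := and4P abd.
  have nadC : ~~ adj C0 a d by rewrite (extends_adj eC).
  have [//|ac] := flag_adj ab bc.
  have [dc|dc] := flag_adj db bc.
    by case/negP: nadC; rewrite adj_sym; apply: (r1 dc); rewrite 1?undir_sym 1?eq_sym.
  by case/negP: nadC; apply: (r3 (a := c) (b := b)); rewrite // undir_sym.
move=> cl; elim: cl => {Pi C} [//|Pi a0 b0 C r cl IH] EC ext nf.
have r' := rules123_1234 r.
apply: IH => //; first by apply: extends_orient => //; exact: rules1234_sound r'.
move=> {}a {}b {}c /orient_dirP [[-> ->]|]; last exact: nf.
move=> bc.
have [aNb uab] := rules1234_edges r'.
have ref : refinement Pi C0.
  rewrite -EC; apply: refinement_trans (closes_refinement (@rules123_edges V) cl).
  by apply: orient_refinement => //; [exact: undir_adj|rewrite undir_dirF// undir_sym].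
have a0b0 : dir C0 a0 b0.
  rewrite -EC; apply: (refinement_dir (closes_refinement (@rules123_edges V) cl)).
  exact: orient_dir.
have up u v : dir Pi u v -> dir C0 u v by exact: refinement_dir ref.
have adjPi u v : adj C0 u v = adj Pi u v by have [_ ->] := ref.
have [//|ac] := flag_adj a0b0 bc.
(* It remains to refute a0 - c for each rule that may have produced a0 -> b0. Arcs among the
   premises extend to c by induction. In R3 the edges y - a0 and z - a0 may have been oriented
   meanwhile, but in [C0] only y -> a0 and z -> a0 together escape the rules, and they form an
   immorality that [Pi] would have oriented. *)
case: r => [[x [us xa _ nxb]]|[y [_ ay yb _]]|[y [z [us [ay az _] yb zb nyz]]]].
- have xc := nf x a0 c xa ac.
  have cb : undir C0 c b0 by rewrite undir_sym.
  case/negP: nxb; rewrite -adjPi; apply: r1 xc cb _.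
  by move: us; rewrite /= !inE negb_or => /andP [/andP []].
- by case: (r2 (up _ _ ay) (nf y b0 c yb bc) ac).
- have yc := nf y b0 c yb bc; have zc := nf z b0 c zb bc.
  have yNz : y != z by move: us; rewrite /= !inE !negb_or => /and3P [_ /andP []].
  have nyzC : ~~ adj C0 y z by rewrite adjPi.
  have ay' : adj C0 a0 y by rewrite adjPi undir_adj.
  have az' : adj C0 a0 z by rewrite adjPi undir_adj.
  have [ayC|yaC|ayC] := adj_cases ay'; first by case: (r2 ayC yc ac).
    have [azC|zaC|azC] := adj_cases az'; first by case: (r2 azC zc ac).
      have : vstructure G y a0 z.
        rewrite /vstructure (extends_dir dG eC yaC) (extends_dir dG eC zaC) yNz.
        by rewrite -(extends_adj eC).
      case/(extends_vstructure ext) => ya _.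
      by have := dir_undirF ya; rewrite undir_sym ay.
    by case/negP: nyzC; exact: r1 yaC azC yNz.
  have [azC|zaC|azC] := adj_cases az'; first by case: (r2 azC zc ac).
    by case/negP: nyzC; rewrite adj_sym; apply: r1 zaC ayC _; rewrite eq_sym.
  by case/negP: nyzC; exact: r3 ayC azC ac yc zc yNz.
Qed.

(** In a premise of R4 both orientations of the edge between a and z fall to R2, and with a - z the
    arc y -> z would by [no_flag] give y -> a. This serves the case without required edges, in which
    Phase II closes under R1 to R3 only. *)
Lemma rules1234_closed a b : ~ rules1234 C0 a b.
Proof.
case=> [r|r|r|[y [z [us [ay ab] [yz zb] az nyb]]]]; try by apply: (@nr a b); first [by constructor 1|by constructor 2|by constructor 3].
have [az'|za|az'] := adj_cases az; first by case: (r2 az' zb ab).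
  by case: (r2 yz za); rewrite undir_sym.
have : dir C0 y a by apply: no_flag yz _; rewrite undir_sym.
by apply/negP; rewrite undir_dirF// undir_sym.
Qed.

End Flags.

End Extends.

(** * Meek's theorem *)

Section Gluing.
Variables (V : finType) (G C0 : pdgraph V) (dG : is_dag G) (eC : extends G C0).
Hypothesis flag : forall a b c, dir C0 a b -> undir C0 b c -> dir C0 a c.
Variable a0 : V.

Let U0 := [set v | connect (undir C0) a0 v].

Let flag_connect a b c : dir C0 a b -> connect (undir C0) b c -> dir C0 a c.
Proof.
move=> ab /connectP [p + ->]; elim: p b ab => //= d p IHp b ab /andP [bd].
by apply: IHp; exact: flag ab bd.
Qed.

Let connect_U0 u v : u \in U0 -> v \in U0 -> connect (undir C0) u v.
Proof.
rewrite !inE => u0 v0; apply: connect_trans v0.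
by rewrite (sym_connect_sym (@undir_sym _ C0)).
Qed.

Let into_U0 u v w : dir C0 u v -> v \in U0 -> w \in U0 -> dir C0 u w.
Proof. by move=> uv vU wU; apply: flag_connect uv _; exact: connect_U0. Qed.

Let no_dir_U0 u v : u \in U0 -> v \in U0 -> dir C0 u v = false.
Proof.
by move=> uU vU; apply/negP => uv; have := into_U0 uv vU uU; rewrite /dir andbN.
Qed.

Let cross u v : dir G u v -> (u \in U0) != (v \in U0) -> dir C0 u v.
Proof.
move=> uv uNv; have := extends_sub eC uv; rewrite /dir => uvC; rewrite uvC /=.
apply: contra uNv => vuC; rewrite !inE.
have c1 : connect (undir C0) u v by apply: connect1; rewrite /undir uvC.
apply/eqP; apply/idP/idP => h; apply: connect_trans h _ => //.
by rewrite (sym_connect_sym (@undir_sym _ C0)).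
Qed.

Lemma component_perfect a b c : a \in U0 -> b \in U0 -> c \in U0 ->
  dir G a c -> dir G b c -> a != b -> adj G a b.
Proof.
move=> aU bU cU ac bc ab; apply/negPn/negP => nab.
have : vstructure G a c b by rewrite /vstructure ac bc ab.
by case/(extends_vstructure eC); rewrite no_dir_U0.
Qed.

Variables (Pi : pdgraph V) (ePi : extends G Pi) (refPi : refinement C0 Pi).
Variable r : V -> nat.
Hypothesis er : extension_rank Pi G U0 r.

Definition reorient : pdgraph V :=
  [set p | adj G p.1 p.2 &&
     if (p.1 \in U0) && (p.2 \in U0) then r p.1 < r p.2 else p \in G].

Let reorientE u v : ((u, v) \in reorient) = adj G u v &&
     if (u \in U0) && (v \in U0) then r u < r v else dir G u v.
Proof. by rewrite inE /= -(dag_dirE dG). Qed.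

Let r_neq u v : u \in U0 -> v \in U0 -> adj G u v -> r u != r v.
Proof. by have [h _ _] := er; exact: h. Qed.

Let reorient_full : fully_directed reorient.
Proof.
apply/forallP => u; apply/forallP => v; rewrite /undir !reorientE andbC.
rewrite (andbC (v \in U0)); case: ifP => _; apply/negP => /andP [/andP [_ h] /andP [_ h']].
  by have := ltn_trans h h'; rewrite ltnn.
by rewrite (dag_asym h) in h'.
Qed.

Let reorient_dir u v : dir reorient u v = ((u, v) \in reorient).
Proof.
rewrite /dir; case uv: ((u, v) \in reorient) => //=.
by have /forallP /(_ u) /forallP /(_ v) := reorient_full; rewrite /undir uv.
Qed.

Let below v := [exists u in U0, connect (dir G) u v].

Let below_U0 v : v \in U0 -> below v.
Proof. by move=> vU; apply/existsP; exists v; rewrite vU connect0. Qed.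

Let below_dir u v : dir G u v -> below u -> below v.
Proof.
move=> uv /existsP [w /andP [wU wu]]; apply/existsP; exists w; rewrite wU.
by apply: connect_trans wu (connect1 _).
Qed.

(* No path leaves the component and comes back, so the contracted graph is
   still acyclic. *)
Let no_return u v : dir G u v -> v \in U0 -> u \notin U0 -> ~~ below u.
Proof.
move=> uv vU uU; apply/negP => /existsP [w /andP [wU wu]].
have : dir C0 u w by apply: (into_U0 (cross uv _) vU wU); rewrite vU (negPf uU).
move/(extends_dir dG eC)/(dag_rankP (dag_acyclic dG)).
rewrite ltnNge => /negP; apply; case/connectP: wu => p + ->.
elim: p w {wU} => //= c p IHp w /andP [/(dag_rankP (dag_acyclic dG)) wc /IHp].
by apply: leq_trans; exact: ltnW.
Qed.

(** Three layers: vertices that U0 does not reach, U0 ordered by r, and the other vertices below it.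
    [#|V|.+1] exceeds every [dag_rank], and the maximum plus one exceeds every rank in U0. *)
Let height v :=
  if v \in U0 then #|V|.+1 + r v
  else if below v then #|V|.+1 + (\max_(u in U0) r u).+1 + dag_rank G v
  else dag_rank G v.

Let dag_rank_lt v : dag_rank G v < #|V|.+1.
Proof. by rewrite ltnS max_card. Qed.

Let heightP u v : (u, v) \in reorient -> height u < height v.
Proof.
have rP := dag_rankP (dag_acyclic dG).
have rmax w : w \in U0 -> r w <= \max_(u in U0) r u by move=> wU; exact: leq_bigmax_cond.
rewrite reorientE => /andP [_]; rewrite /height; set m := \max_(i in U0) r i in rmax *.
have [uU|uU] /= := boolP (u \in U0); have [vU|vU] /= := boolP (v \in U0).
- by rewrite ltn_add2l.
- move=> uv; rewrite (below_dir uv (below_U0 uU)).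
  by have := rmax u uU; lia.
- move=> uv; rewrite (negPf (no_return uv vU uU)).
  exact: leq_trans (dag_rank_lt u) (leq_addr _ _).
- move=> uv; have [bu|bu] := boolP (below u).
    by rewrite (below_dir uv bu) ltn_add2l; exact: rP.
  case: (below v); last exact: rP.
  by rewrite -addnA; exact: leq_trans (dag_rank_lt u) (leq_addr _ _).
Qed.

Lemma reorient_dag : is_dag reorient.
Proof.
rewrite /is_dag reorient_full /=; apply: (rank_acyclic (rank := height)) => u v.
by rewrite reorient_dir; exact: heightP.
Qed.

Lemma reorient_adj u v : adj reorient u v = adj G u v.
Proof.
rewrite [LHS]/adj !reorientE (adj_sym G v u) [(v \in U0) && _]andbC.
case uv: (adj G u v) => //=.
case: ifP => [/andP [uU vU]|_]; first by rewrite -neq_ltn r_neq.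
by rewrite -dag_adjE.
Qed.

Lemma reorient_rank u v : u \in U0 -> v \in U0 -> adj G u v -> r u < r v -> dir reorient u v.
Proof. by move=> uU vU uv ruv; rewrite reorient_dir reorientE uv uU vU. Qed.

(** Inside U0 the ranks allow no immorality. An arc of G that enters U0 is an arc of C0 and so
    points to the whole component, which makes its tail adjacent to every vertex of U0. All other
    immoralities consist of arcs of G. *)
Let reorient_vstructure x y z : vstructure reorient x y z -> vstructure G x y z.
Proof.
rewrite /vstructure !reorient_dir !reorientE !reorient_adj.
case/and4P => /andP [xy xy'] /andP [zy zy'] xNz nxz; rewrite xNz nxz !andbT.
have [yU|yU] := boolP (y \in U0); last by move: xy' zy'; rewrite (negPf yU) !andbF => -> ->.
move: xy' zy'; rewrite yU !andbT.
have [xU|xU] := boolP (x \in U0); have [zU|zU] := boolP (z \in U0) => xy' zy'.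
- have [_ _ perf] := er.
  by case/negP: nxz; exact: (perf x z y).
- have zyC : dir C0 z y by apply: (cross zy'); rewrite yU (negPf zU).
  case/negP: nxz; rewrite adj_sym -(extends_adj eC); apply: dir_adj.
  exact: into_U0 zyC yU xU.
- have xyC : dir C0 x y by apply: (cross xy'); rewrite yU (negPf xU).
  case/negP: nxz; rewrite -(extends_adj eC); apply: dir_adj.
  exact: into_U0 xyC yU zU.
- by rewrite xy' zy'.
Qed.

Lemma reorient_extends : extends reorient Pi.
Proof.
split=> [u v|u v|u v w /reorient_vstructure]; first by rewrite reorient_adj (extends_adj ePi).
- rewrite reorient_dir reorientE => /andP [uv]; case: ifP => [/andP [uU vU]|_].
    by have [_ h _] := er; exact: h.
  exact: (extends_sub ePi).
- by case/(extends_vstructure ePi).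
Qed.

Lemma reorient_extends_component : extends reorient C0.
Proof.
have [_ sub vs] := reorient_extends; split=> [u v|u v /sub|u v w /reorient_vstructure].
- by rewrite reorient_adj (extends_adj eC).
- by have [/subsetP h _] := refPi; exact: h.
- by case/(extends_vstructure eC).
Qed.

End Gluing.

Section Meek.
Variables (V : finType) (C0 : pdgraph V).
Hypothesis flag : forall a b c, dir C0 a b -> undir C0 b c -> dir C0 a c.

Lemma extension_orienting G Pi a b : is_dag G -> extends G C0 -> extends G Pi ->
  refinement C0 Pi -> (forall u v, ~ rules1234 Pi u v) -> undir Pi a b ->
  exists G', [/\ is_dag G', extends G' C0, extends G' Pi & dir G' a b].
Proof.
move=> dG eC ePi ref ncl ab.
pose U0 := [set v | connect (undir C0) a v].
have aU : a \in U0 by rewrite inE connect0.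
have bU : b \in U0 by rewrite inE; apply/connect1/(refinement_undir ref).
have [||||||r er rab] := @extension_either V Pi G U0 dG _ _ _ _ _ _ U0 a b (subxx _) aU bU ab.
- exact: extends_adj ePi.
- exact: extends_sub ePi.
- exact: (component_perfect eC flag).
- by move=> u v r; apply: (ncl u v); constructor 1.
- by move=> u v r; apply: (ncl u v); constructor 2.
- by move=> u v r; apply: (ncl u v); constructor 4.
exists (reorient G C0 a r); split.
- exact: (reorient_dag dG eC flag).
- exact: (reorient_extends_component dG eC flag ePi ref er).
- exact: (reorient_extends dG eC flag ePi er).
- apply: (reorient_rank dG) => //.
  by rewrite -(extends_adj ePi) undir_adj.
Qed.

(** Invariant: some DAG extends both C0 and the current graph. It is chosen anew at each step, to
    agree with the orientation just made; a fully directed graph equals the DAG that extends it. *)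
Lemma phaseIII_extension G Pi Pi' : is_dag G -> extends G C0 -> extends G Pi ->
  refinement C0 Pi -> (forall u v, ~ rules1234 Pi u v) -> phaseIII Pi Pi' ->
  is_dag Pi' /\ extends Pi' C0.
Proof.
move=> dG eC ePi ref ncl p; elim: p G dG eC ePi ref ncl => {Pi Pi'}
  [Pi fd|Pi a b Pi1 Pi2 ab c _ IH] G dG eC ePi ref ncl.
  by rewrite (extends_directed dG ePi fd).
have [G' [dG' eC' ePi' ab']] := extension_orienting dG eC ePi ref ncl ab.
apply: (IH G') => //.
- by apply: (extends_closes dG' _ c) => //; exact: extends_orient.
- apply: refinement_trans ref _.
  apply: refinement_trans (closes_refinement (@rules1234_edges V) c).
  apply: orient_refinement; [|exact: undir_adj|by rewrite undir_dirF// undir_sym].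
  by apply: (extends_neq dG ePi); exact: undir_adj.
- exact: closes_closed c.
Qed.

End Meek.

(** * The phases of the procedure *)

Section PhaseI.
Variables (V : finType) (M : seq (ci_stmt V)).
Implicit Types (G Pi : pdgraph V) (a b c : V) (S : {set V}).

Lemma separates_sym a b S : separates M a b S = separates M b a S.
Proof. by rewrite /separates setUC orbC. Qed.

Lemma skeleton_sym a b : ((a, b) \in skeleton M) = ((b, a) \in skeleton M).
Proof.
rewrite !inE /= eq_sym; congr (_ && ~~ _).
by apply: eq_existsb => S; rewrite separates_sym.
Qed.

Lemma skeleton_adj a b : adj (skeleton M) a b = ((a, b) \in skeleton M).
Proof. by rewrite /adj -skeleton_sym orbb. Qed.

Lemma is_Sep_exists : exists Sep, is_Sep M Sep.
Proof.
exists (fun a b => odflt set0 [pick S | separates M a b S]) => a b _ /existsP [S abS].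
split; first by case: pickP => //= /(_ S); rewrite abS.
by congr odflt; apply: eq_pick => T; rewrite separates_sym.
Qed.

Lemma phaseI_exists : exists PiI, phaseI M PiI.
Proof.
have [Sep sepP] := is_Sep_exists.
eexists; exists Sep, (enum (collider_triple M Sep)); split; [exact: sepP| |reflexivity].
by move=> t; rewrite mem_enum.
Qed.

Definition orient_collider Pi (t : V * V * V) : pdgraph V :=
  let: (a, b, c) := t in orient (orient Pi a b) c b.

Lemma orient_colliders_no_loop Pi (ts : seq (V * V * V)) :
  (forall a b c, (a, b, c) \in ts -> a != b /\ b != c) ->
  (forall a, ~~ adj Pi a a) -> forall a, ~~ adj (foldl orient_collider Pi ts) a a.
Proof.
elim: ts Pi => //= -[[a b] c] ts IHts Pi ne nl; apply: IHts.
  by move=> u v w h; apply: (ne u v w); rewrite inE h orbT.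
have [ab bc] := ne a b c (mem_head _ _).
move=> u; rewrite /adj orbb !orient_arc !xpair_eqE negb_or.
have nu : (u, u) \notin Pi by have := nl u; rewrite /adj orbb.
rewrite (negPf nu) /= orbF.
apply/andP; split; first by apply: contra bc => /andP [/eqP <- /eqP ->].
by rewrite negb_and; apply/orP; left; apply: contra ab => /andP [/eqP <- /eqP ->].
Qed.

Variables (G : pdgraph V) (dG : is_dag G).

(** Invariant while the triples are processed: every arc so far belongs to an immorality of G, so no
    triple undoes the work of an earlier one. *)
Definition oriented_by Pi :=
  [/\ forall a b, adj Pi a b = adj G a b, forall a b, dir G a b -> (a, b) \in Pi
    & forall a b, dir Pi a b -> exists c, vstructure G a b c].

Lemma oriented_by_orient Pi a b c : vstructure G a b c -> oriented_by Pi ->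
  oriented_by (orient Pi a b) /\ refinement Pi (orient Pi a b) /\ dir (orient Pi a b) a b.
Proof.
move=> abc [adjE sub vs]; have ab : dir G a b by case/and4P: abc.
have aNb : a != b by apply: contraTneq ab => ->; rewrite dag_irr.
have nba : ~~ dir Pi b a.
  apply/negP => /vs [d /and4P [ba _ _ _]].
  by rewrite (dag_asym ab) in ba.
have abP : adj Pi a b by rewrite adjE dir_adj.
have r := orient_refinement aNb abP nba.
split; [split|split => //; exact: orient_dir].
- by move=> u v; have [_ ->] := r.
- move=> u v uv; rewrite orient_arc sub//=; apply/orP; right.
  by apply: contraTneq uv => -[-> ->]; rewrite (dag_asym ab).
- by move=> u v /orient_dirP [[-> ->]|/vs //]; exists c.
Qed.

Lemma orient_colliders Pi (ts : seq (V * V * V)) :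
  (forall a b c, (a, b, c) \in ts -> vstructure G a b c) -> oriented_by Pi ->
  let Pi' := foldl orient_collider Pi ts in
  [/\ oriented_by Pi', refinement Pi Pi' & forall a b c, (a, b, c) \in ts -> dir Pi' a b].
Proof.
elim: ts Pi => [|[[a b] c] ts IHts] Pi vs ob /=.
  by split => //; exact: refinement_refl.
have abc := vs a b c (mem_head _ _).
have [ob1 [r1 d1]] := oriented_by_orient abc ob.
have cba : vstructure G c b a by rewrite vstructure_sym.
have [ob2 [r2 d2]] := oriented_by_orient cba ob1.
have [|ob3 r3 d3] := IHts _ _ ob2.
  by move=> u v w h; apply: vs; rewrite inE h orbT.
split => //; first exact: refinement_trans (refinement_trans r1 r2) r3.
move=> u v w; rewrite inE => /predU1P [[-> -> _]|]; last exact: d3.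
exact: refinement_dir r3 (refinement_dir r2 d1).
Qed.

Hypothesis skE : forall a b, adj (skeleton M) a b = adj G a b.
Hypothesis colE : forall Sep, is_Sep M Sep -> forall a b c,
  collider_triple M Sep (a, b, c) = vstructure G a b c.

Lemma phaseI_extends PiI : phaseI M PiI ->
  extends G PiI /\ forall a b, dir PiI a b -> exists c, vstructure G a b c.
Proof.
move=> [Sep [ts [sepP tsE ->]]].
have ob0 : oriented_by (skeleton M).
  split=> // [a b ab|a b]; first by rewrite -skeleton_adj skE dir_adj.
  by rewrite /dir skeleton_sym andbN.
have [|[adjE sub vs] _ d] := orient_colliders (ts := ts) _ ob0.
  by move=> a b c; rewrite tsE => h; rewrite -(colE sepP).
split => //; split => // a b c abc; apply: (d a b c).
by rewrite tsE; rewrite -(colE sepP) in abc.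
Qed.

End PhaseI.

Lemma phaseI_no_loop (V : finType) (M : seq (ci_stmt V)) PiI : phaseI M PiI ->
  forall a, ~~ adj PiI a a.
Proof.
move=> [Sep [ts [_ tsE ->]]]; apply: orient_colliders_no_loop.
  move=> a b c; rewrite tsE => /and5P [_]; rewrite !skeleton_adj !inE /=.
  by move=> /andP [ab _] /andP [bc _].
by move=> a; rewrite skeleton_adj inE eqxx.
Qed.

Section PhaseII.
Variables (V : finType) (K : background V) (G : pdgraph V) (dG : is_dag G) (cG : consistent K G).

(** G has every required edge that S3 inserts and no forbidden one, so it keeps extending the
    current graph and neither test fails. Whether R was empty is recorded because S3 then never
    closes under R4. *)
Lemma phaseII_loop_sound Pi (R : {set V * V}) o : R \subset required K ->
  phaseII_loop (forbidden K) Pi R o -> extends G Pi ->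
  if o is Some Pi' then
    [/\ extends G Pi', R = set0 -> Pi' = Pi
      & R != set0 -> forall a b, ~ rules1234 Pi' a b]
  else False.
Proof.
have [req nforb] := cG => + l.
elim: l => {Pi R o} [Pi R fail|Pi _|Pi R a b Pi' _ f1 abR c R0|Pi R a b Pi' o _ f1 abR c R0 _ IH] RK ext.
- case/orP: fail => /existsP [a /existsP [b /andP [abF]]].
    by move/(extends_dir dG ext); apply/negP/nforb.
  have ab : dir G a b by apply: req; exact: (subsetP RK).
  case/orP => [/(extends_dir dG ext)|]; first by rewrite (dag_asym ab).
  by rewrite (extends_adj ext) dir_adj.
- by split=> //; rewrite eqxx.
- have ab : dir G a b by apply: req; exact: (subsetP RK).
  split=> [|E|_]; last exact: closes_closed c.
    by apply: (extends_closes dG _ c) => //; exact: extends_orient.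
  by rewrite E inE in abR.
- have ab : dir G a b by apply: req; exact: (subsetP RK).
  have ext' : extends G Pi'.
    by apply: (extends_closes dG _ c) => //; exact: extends_orient.
  have := IH (subset_trans (subsetDl _ _) RK) ext'. 
  case: o {IH} => // Pi2 [e2 _ c2]; split=> // [E|_]; first by rewrite E inE in abR.
  exact: c2.
Qed.

End PhaseII.

(** * Conditional independence of random variables *)

Module CondIndepTheory.
From mathcomp Require Import all_order all_algebra all_classical.
From mathcomp Require Import ereal topology normedtype sequences measure realfun.
From mathcomp Require Import measurable_realfun numfun lebesgue_measure.
From mathcomp Require Import lebesgue_integral charge probability.
Import Order.TTheory GRing.Theory Num.Theory.
Import numFieldNormedType.Exports.

Local Open Scope classical_set_scope.
Local Open Scope ring_scope.
Local Open Scope ereal_scope.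

(** * Restriction of measures to sub-sigma-algebras *)

Section SubSigmaAlgebra.
Context (R : realType) (d : measure_display) (W : measurableType d)
  (P : probability W R) (G : set (set W)) (Gm : G `<=` measurable).

Local Notation T := (g_sigma_algebraType G).
Local Notation H := (<<s G >>).

Lemma sub_measurable C : H C -> measurable C.
Proof.
move=> HC; rewrite -(sigma_algebra_id (@sigma_algebra_measurable _ W)).
exact: sub_sigma_algebra2 HC.
Qed.

Lemma measurable_id_sub : measurable_fun [set: W] (id : W -> T).
Proof. by move=> _ C HC; rewrite setTI preimage_id; exact: sub_measurable. Qed.

Lemma sub_measurable_fun (f : W -> \bar R) :
  measurable_fun [set: T] f -> measurable_fun [set: W] f.
Proof. by move=> mf; exact: (measurableT_comp mf measurable_id_sub). Qed.

Lemma sub_measurable_funP (g : W -> R) :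
  (forall Y : set R, measurable Y -> H (g @^-1` Y)) <->
  measurable_fun [set: T] g.
Proof.
split=> [Hg _ Y mY|Hg Y mY]; first by rewrite setTI; exact: Hg.
by rewrite -[_ @^-1` _]setTI; exact: Hg.
Qed.

End SubSigmaAlgebra.

Section SubMeasure.
Context (R : realType) (d : measure_display) (W : measurableType d)
  (mu : {measure set W -> \bar R}) (G : set (set W)) (Gm : G `<=` measurable).
Local Notation T := (g_sigma_algebraType G).
Local Notation H := (<<s G >>).

Definition sub_measure (_ : G `<=` measurable) : set T -> \bar R := mu.
Local Notation nu := (sub_measure Gm).

Let nu0 : nu set0 = 0. Proof. exact: measure0. Qed.

Let nu_ge0 A : 0 <= nu A. Proof. exact: measure_ge0. Qed.

Let nu_additive : semi_sigma_additive nu.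
Proof.
move=> F mF tF mUF; apply: measure_semi_sigma_additive => //.
- by move=> n; apply: (sub_measurable Gm); exact: mF.
- exact: (sub_measurable Gm).
Qed.

HB.instance Definition _ := isMeasure.Build _ _ _ nu nu0 nu_ge0 nu_additive.

Lemma ge0_integral_sub_measure (C : set W) (f : W -> \bar R) :
  H C -> measurable_fun [set: T] (f : T -> \bar R) -> (forall w, 0 <= f w) ->
  \int[nu]_(w in C) f w = \int[mu]_(w in C) f w.
Proof.
move=> HC mf f0.
have := @ge0_integral_pushforward _ _ _ _ _ _ (measurable_id_sub Gm) mu C f HC
  (measurable_funTS mf) (fun y _ => f0 y).
by rewrite preimage_id => <-.
Qed.

Lemma integral_sub_measure (C : set W) (f : W -> \bar R) :
  H C -> measurable_fun [set: T] (f : T -> \bar R) -> mu.-integrable setT f ->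
  \int[nu]_(w in C) f w = \int[mu]_(w in C) f w.
Proof.
move=> HC mf intf.
have := @integral_pushforward _ _ _ _ _ _ (measurable_id_sub Gm) mu C f mf
  (integrableS measurableT (sub_measurable Gm HC) (@subsetT _ _) intf) HC.
by rewrite preimage_id => <-.
Qed.

Lemma integrable_sub_measure (f : W -> \bar R) :
  measurable_fun [set: T] (f : T -> \bar R) ->
  mu.-integrable setT f -> nu.-integrable setT (f : T -> \bar R).
Proof.
move=> mf /integrableP[_ foo]; apply/integrableP; split => //.
rewrite ge0_integral_sub_measure//; first exact: (@measurableT _ T).
exact: measurableT_comp.
Qed.

End SubMeasure.

Section FiniteSubMeasure.
Context (R : realType) (d : measure_display) (W : measurableType d)
  (mu : {finite_measure set W -> \bar R}) (G : set (set W))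
  (Gm : G `<=` measurable).

Let fin : fin_num_fun (sub_measure mu Gm).
Proof. by move=> A mA; apply: fin_num_measure; exact: (sub_measurable Gm). Qed.

HB.instance Definition _ := @Measure_isFinite.Build _ _ _ (sub_measure mu Gm) fin.

End FiniteSubMeasure.

(** * Versions of conditional probabilities *)

Section CondProb.
Context (R : realType) (d : measure_display) (W : measurableType d)
  (P : probability W R) (G : set (set W)) (Gm : G `<=` measurable).
Local Notation T := (g_sigma_algebraType G).
Local Notation H := (<<s G >>).

Lemma ge0_integral_mrestr (mu : {finite_measure set W -> \bar R}) (E : set W) (mE : measurable E)
    (C : set W) (h : W -> \bar R) :
  measurable C -> measurable_fun [set: W] h -> (forall w, 0 <= h w) ->
  \int[mrestr mu mE]_(w in C) h w = \int[mu]_(w in E `&` C) h w.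
Proof.
move=> mC mh h0.
pose nu : {finite_measure set W -> \bar R} := mrestr mu mE.
have numu : nu `<< mu.
  apply/null_content_dominatesP => A mA muA0; apply/eqP.
  rewrite eq_le measure_ge0 andbT -[leRHS]muA0.
  by apply: le_measure; rewrite ?inE//; exact: measurableI.
rewrite -(Radon_Nikodym_SigmaFinite.change_of_variables numu)//; last exact: measurable_funTS.
set f := Radon_Nikodym_SigmaFinite.f _ _.
have intf : mu.-integrable setT f by exact: Radon_Nikodym_SigmaFinite.f_integrable.
have fE : ae_eq mu setT f (EFin \o \1_E).
  apply: integral_ae_eq => //.
    by apply/measurable_EFinP; exact: measurable_indic.
  move=> A _ mA; rewrite -Radon_Nikodym_SigmaFinite.f_integral//.
  by rewrite integral_indic// setIC.
rewrite setIC integral_mkcondr epatch_indic.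
apply: ge0_ae_eq_integral => //.
- by apply: emeasurable_funM; apply: measurable_funTS => //; exact: measurable_int intf.
- by apply: emeasurable_funM; apply: measurable_funTS => //; apply/measurable_EFinP; exact: measurable_indic.
- by move=> x _; rewrite mule_ge0//; exact: Radon_Nikodym_SigmaFinite.f_ge0.
- by move=> x _ /=; rewrite mule_ge0// lee_fin.
- by move: fE; apply: filterS => x /= + _ => ->.
Qed.

(** g is the Radon-Nikodym derivative of P restricted to E with respect to P, both on the smaller
    sigma-algebra. The last clause is the pull-out property; nonnegativity frees it from
    integrability. *)
Lemma cond_prob_exists (E : set W) : measurable E ->
  exists g : W -> R,
  [/\ forall w, (0 <= g w)%R, cond_prob P H E g
    & forall C (h : W -> \bar R), H C -> measurable_fun [set: T] (h : T -> \bar R) ->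
      (forall w, 0 <= h w) ->
      \int[P]_(w in C) (h w * (g w)%:E) = \int[P]_(w in E `&` C) h w].
Proof.
move=> mE.
pose PE : {finite_measure set W -> \bar R} := mrestr P mE.
pose nu : {finite_measure set T -> \bar R} := sub_measure PE Gm.
pose mu : {finite_measure set T -> \bar R} := sub_measure P Gm.
have numu : nu `<< mu.
  apply/null_content_dominatesP => A mA muA0; apply/eqP.
  rewrite eq_le measure_ge0 andbT -[leRHS]muA0.
  have mA' : d.-measurable A by exact: (sub_measurable Gm).
  change (P (A `&` E) <= P A); by apply: le_measure; rewrite ?inE//; exact: measurableI.
pose f := Radon_Nikodym_SigmaFinite.f nu mu.
have f0 w : 0 <= f w by exact: Radon_Nikodym_SigmaFinite.f_ge0.
have mf : measurable_fun [set: T] f.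
  exact: measurable_int (Radon_Nikodym_SigmaFinite.f_integrable numu).
have fE w : (fine (f w))%:E = f w.
  by rewrite fineK//; exact: Radon_Nikodym_SigmaFinite.f_fin_num.
have fint C : H C -> \int[P]_(w in C) f w = P (E `&` C).
  move=> HC; rewrite -(ge0_integral_sub_measure P Gm)//.
  by rewrite -(Radon_Nikodym_SigmaFinite.f_integral numu)// setIC.
exists (fine \o f); split.
- by move=> w; rewrite -lee_fin fE.
- split.
  + by apply/sub_measurable_funP; apply: measurableT_comp => //; exact: measurable_fine.
  + have -> : EFin \o (fine \o f) = f by apply/funext => w /=; rewrite fE.
    apply/integrableP; split; first exact: (sub_measurable_fun Gm).
    under eq_integral do rewrite gee0_abs//.
    by rewrite fint ?ltry//; [rewrite setIT -ge0_fin_numE// fin_num_measure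
      |exact: (@measurableT _ T)].
  + by move=> C HC /=; under eq_integral do rewrite fE; exact: fint.
- move=> C h HC mh h0 /=; under eq_integral do rewrite fE.
  rewrite -(ge0_integral_mrestr P mE)//; last 2 first.
  + exact: (sub_measurable Gm).
  + exact: (sub_measurable_fun Gm).
  rewrite -(ge0_integral_sub_measure P Gm)//; last 2 first.
  + exact: emeasurable_funM.
  + by move=> w; rewrite mule_ge0.
  rewrite -(ge0_integral_sub_measure PE Gm)//.
  by rewrite -(Radon_Nikodym_SigmaFinite.change_of_variables numu)//; exact: measurable_funTS.
Qed.

Lemma cond_prob_unique (E : set W) (g1 g2 : W -> R) :
  cond_prob P H E g1 -> cond_prob P H E g2 -> {ae P, forall w, g1 w = g2 w}.
Proof.
move=> [/sub_measurable_funP m1 i1 e1] [/sub_measurable_funP m2 i2 e2].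
have m1' : measurable_fun [set: T] (EFin \o g1 : T -> \bar R) by exact/measurable_EFinP.
have m2' : measurable_fun [set: T] (EFin \o g2 : T -> \bar R) by exact/measurable_EFinP.
have : ae_eq (sub_measure P Gm) [set: T] (EFin \o g1) (EFin \o g2).
  apply: integral_ae_eq => //; first exact: integrable_sub_measure.
  by move=> C _ mC; rewrite !integral_sub_measure// e1// e2.
move=> [A [mA A0 sA]]; exists A; split => //; first exact: (sub_measurable Gm).
by move=> w /= nw; apply: sA => /= /(_ I) [].
Qed.

End CondProb.

(** * Conditional independence as a separoid *)

Section CondIndep.
Context (V : finType) (R : realType) (d : measure_display)
  (W : measurableType d) (P : probability W R) (dT : V -> measure_display)
  (T : forall v, measurableType (dT v)) (X : forall v, {mfun W >-> T v}).
Implicit Types A B S : {set V}.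
Local Notation sv := (sigma_vars X).

Definition vars_gen A : set (set W) :=
  \bigcup_(v in [set` A]) preimage_set_system setT (X v) measurable.

Lemma vars_gen_measurable A : vars_gen A `<=` measurable.
Proof.
by move=> _ [v _ [Y mY <-]]; rewrite setTI; exact: measurable_funPTI.
Qed.

Lemma sigma_vars_measurable A E : sv A E -> measurable E.
Proof. exact/sub_measurable/vars_gen_measurable. Qed.

Lemma sigma_varsS A B : A \subset B -> sv A `<=` sv B.
Proof.
move=> /fintype.subsetP AB; apply: sub_sigma_algebra2 => _ [v vA [Y mY <-]].
by exists v; [exact: AB|exists Y].
Qed.

Lemma sigma_varsI A E F : sv A E -> sv A F -> sv A (E `&` F).
Proof. exact: (@measurableI _ (g_sigma_algebraType (vars_gen A))). Qed.

Lemma sigma_varsT A : sv A setT.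
Proof. exact: (@measurableT _ (g_sigma_algebraType (vars_gen A))). Qed.

Lemma sigma_varsU_gen B S :
  sv (B :|: S)%SET = <<s [set F `&` K | F in sv B & K in sv S] >>.
Proof.
rewrite eqEsubset; split.
- apply: smallest_sub; first exact: smallest_sigma_algebra.
  move=> E [v /=]; rewrite /mkset inE => /orP vBS Ev; apply: sub_sigma_algebra.
  case: vBS => vX.
  + exists E; first by apply: sub_sigma_algebra; exists v.
    by exists setT; [exact: sigma_varsT|rewrite setIT].
  + exists setT; first exact: sigma_varsT.
    by exists E; [apply: sub_sigma_algebra; exists v|rewrite setTI].
- apply: smallest_sub; first exact: smallest_sigma_algebra.
  move=> _ [F sF [K sK <-]]; apply: sigma_varsI.
  + apply: sigma_varsS sF; exact: finset.subsetUl.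
  + apply: sigma_varsS sK; exact: finset.subsetUr.
Qed.

(** Dynkin's lemma: the intersections of F with K form a pi-system that generates the sigma-algebra,
    and the sets C with the equality are closed under complements and disjoint countable unions. *)
Lemma integral_sigma_varsU B S (E : set W) (g : W -> R) :
  measurable E -> (forall w, (0 <= g w)%R) -> P.-integrable setT (EFin \o g) ->
  (forall F K, sv B F -> sv S K ->
     \int[P]_(w in F `&` K) (g w)%:E = P (E `&` (F `&` K))) ->
  forall C, sv (B :|: S)%SET C -> \int[P]_(w in C) (g w)%:E = P (E `&` C).
Proof.
move=> mE g0 ig FK C; rewrite sigma_varsU_gen.
pose U := g_sigma_algebraType (vars_gen (B :|: S)%SET).
have mU (D : set W) : @measurable _ U D -> measurable D by exact: sigma_vars_measurable.
have mg : measurable_fun setT (EFin \o g) by exact: measurable_int ig.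
have finE (D : set W) : measurable D -> P (E `&` D) \is a fin_num.
  by move=> mD; rewrite fin_num_measure//; exact: measurableI.
pose Q (D : set W) := \int[P]_(w in D) (g w)%:E = P (E `&` D).
have mG : @measurable _ U = <<s [set F `&` K | F in sv B & K in sv S] >>.
  exact: (sigma_varsU_gen B S).
apply: (@dynkin_induction _ U _ Q mG).
- move=> _ _ [F1 F1B [K1 K1S <-]] [F2 F2B [K2 K2S <-]].
  exists (F1 `&` F2); first exact: sigma_varsI.
  by exists (K1 `&` K2); [exact: sigma_varsI|rewrite setIACA].
- by rewrite /Q -[setT]setIT FK//; exact: sigma_varsT.
- by move=> _ [F F1 [K K1 <-]]; exact: FK.
- move=> D /mU mD PD.
  have mCD := measurableC mD.
  have DC : [disjoint D & ~` D] by rewrite disj_set_sym; apply/disj_setPS; rewrite setICl.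
  have : \int[P]_(w in D `|` ~` D) (g w)%:E = P (E `&` (D `|` ~` D)).
    by rewrite setUv -[setT]setIT FK//; exact: sigma_varsT.
  rewrite ge0_integral_setU//; last 2 first.
  + exact: measurable_funTS.
  + by move=> w _; rewrite lee_fin.
  rewrite setIUr measureU//; last 3 first.
  + exact: measurableI.
  + exact: measurableI.
  + by rewrite setIACA setICr setI0.
  rewrite PD => /(congr1 (fun x => x - P (E `&` D))).
  by rewrite ![P (E `&` D) + _]addeC !addeK// finE.
- move=> F mF tF PF; rewrite /Q ge0_integral_bigcup//; last 3 first.
  + by move=> k; exact/mU.
  + exact: measurable_funTS.
  + by move=> w _; rewrite lee_fin.
  rewrite setI_bigcupr measure_bigcup//.
  + rewrite [RHS](eq_eseriesl (Q := xpredT)); last by move=> k; apply: mem_set.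
    by apply: eq_eseriesr => k _; exact: PF.
  + by move=> k _; apply: measurableI => //; exact/mU.
  + by apply: trivIset_setIl.
Qed.


(* A version of P(E | S) is also a version of P(E | B, S). *)
Definition ci_version A B S := forall E, sv A E -> exists g : W -> R,
  [/\ forall w, (0 <= g w)%R, cond_prob P (sv S) E g
    & forall C, sv (B :|: S)%SET C -> \int[P]_(w in C) (g w)%:E = P (E `&` C)].

(** The conditional probability of the intersection of E and F is the product of the two versions,
    and the pull-out property turns the factor of F into a restriction of the domain to F. This is
    the equality on the generating sets. *)
Lemma cond_indep_version A B S : cond_indep P X A B S -> ci_version A B S.
Proof.
move=> ci E sE.
have [g [g0 cg pg]] := cond_prob_exists P (@vars_gen_measurable S) (sigma_vars_measurable sE).
have [/sub_measurable_funP mg ig _] := cg.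
exists g; split => //; apply: integral_sigma_varsU => //.
  exact: sigma_vars_measurable sE.
move=> F K sF sK.
have [gF [gF0 cgF pF]] := cond_prob_exists P (@vars_gen_measurable S) (sigma_vars_measurable sF).
have [gEF [gEF0 cgEF _]] := cond_prob_exists P (@vars_gen_measurable S)
  (measurableI _ _ (sigma_vars_measurable sE) (sigma_vars_measurable sF)).
have h := ci E F g gF gEF sE sF cg cgF cgEF.
have [_ iEF e] := cgEF; have [_ iF _] := cgF.
have mK := sigma_vars_measurable sK.
rewrite -(pF K (EFin \o g))//; last by apply/measurable_EFinP.
rewrite setIA -(e K sK); apply: ae_eq_integral => //.
- by apply: measurable_funTS; apply: emeasurable_funM; [exact: measurable_int ig|exact: measurable_int iF].
- by apply: measurable_funTS; exact: measurable_int iEF.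
- by move: h; apply: filterS => w /= -> _; rewrite EFinM.
Qed.

Lemma version_cond_indep A B S : ci_version A B S -> cond_indep P X A B S.
Proof.
move=> ci E F gE gF gEF sE sF cE cF cEF.
have Gm := @vars_gen_measurable S.
have [g [g0 cg gU]] := ci E sE.
have [f [f0 cf pf]] := cond_prob_exists P Gm (sigma_vars_measurable sF).
have [/sub_measurable_funP mg ig _] := cg.
have [/sub_measurable_funP mf jf _] := cf.
have [/sub_measurable_funP mEF iEF eEF] := cEF.
have key K : sv S K -> \int[P]_(w in K) ((g w)%:E * (f w)%:E) = P (E `&` F `&` K).
  move=> sK; rewrite (pf K (EFin \o g))//; last by apply/measurable_EFinP.
  rewrite gU ?setIA// sigma_varsU_gen; apply: sub_sigma_algebra.
  by exists F => //; exists K.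
have mgf : measurable_fun [set: g_sigma_algebraType (vars_gen S)]
    ((EFin \o g) \* (EFin \o f) : g_sigma_algebraType (vars_gen S) -> \bar R).
  by apply: emeasurable_funM; exact/measurable_EFinP.
have : ae_eq (sub_measure P Gm) [set: g_sigma_algebraType (vars_gen S)]
     (EFin \o gEF) ((EFin \o g) \* (EFin \o f)).
  apply: integral_ae_eq => //.
  - by apply: integrable_sub_measure => //; exact/measurable_EFinP.
  - move=> K _ sK; rewrite integral_sub_measure//; last exact/measurable_EFinP.
    rewrite ge0_integral_sub_measure//; first by rewrite key// eEF.
    by move=> w /=; rewrite mule_ge0// lee_fin.
move=> [N [mN N0 sN]].
have : {ae P, forall w, gEF w = (g w * f w)%R}.
  exists N; split => //; first exact: (sub_measurable Gm).
  by move=> w /= nw; apply: sN => /= /(_ I) [].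
apply: filterS3 (cond_prob_unique Gm cE cg) (cond_prob_unique Gm cF cf).
by move=> w -> -> ->.
Qed.

Lemma cond_indep_sym A B S : cond_indep P X A B S -> cond_indep P X B A S.
Proof.
move=> ci E F gE gF gEF sE sF cE cF cEF.
have := ci F E gF gE gEF sF sE cF cE; rewrite setIC => /(_ cEF).
by apply: filterS => w ->; rewrite mulrC.
Qed.

Lemma cond_indepS A B (C : {set V}) S : C \subset B -> cond_indep P X A B S -> cond_indep P X A C S.
Proof.
move=> CB ci E F gE gF gEF sE sF; apply: ci => //.
exact: sigma_varsS sF.
Qed.

Lemma cond_indep_weak_union A B (C : {set V}) S : C \subset B ->
  cond_indep P X A B S -> cond_indep P X A B (S :|: C)%SET.
Proof.
move=> CB /cond_indep_version ci; apply: version_cond_indep => E sE.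
have [g [g0 [mg ig eg] gU]] := ci E sE; exists g; split => //; last first.
  move=> D sD; apply: gU; apply: sigma_varsS sD.
  apply/fintype.subsetP => x; rewrite !finset.inE.
  by case/or3P => [->|->|/(fintype.subsetP CB) ->] //; rewrite orbT.
split => // [Y mY|D sD]; first by apply: sigma_varsS (mg Y mY); exact: finset.subsetUl.
apply: gU; apply: sigma_varsS sD; apply/fintype.subsetP => x; rewrite !finset.inE.
by case/orP => [->|/(fintype.subsetP CB) ->] //; rewrite orbT.
Qed.

(** A version of P(E | S) is one of P(E | S, B) by the first statement, and by uniqueness it agrees
    almost surely with one of P(E | S, B, C) given by the second. *)
Lemma cond_indep_contraction A B (C : {set V}) S :
  cond_indep P X A B S -> cond_indep P X A C (S :|: B)%SET ->
  cond_indep P X A (B :|: C)%SET S.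
Proof.
move=> /cond_indep_version ci1 /cond_indep_version ci2.
apply: version_cond_indep => E sE.
have [g1 [g10 [mg1 ig1 eg1] gU1]] := ci1 E sE.
have [g2 [g20 cg2 gU2]] := ci2 E sE.
exists g1; split => // D; rewrite (_ : _ :|: S = C :|: (S :|: B))%SET => [sD|]; last first.
  by rewrite (finset.setUC B) -finset.setUA (finset.setUC B).
rewrite -gU2//.
have c1 : cond_prob P (sv (S :|: B)%SET) E g1.
  split => // [Y mY|K sK]; first by apply: sigma_varsS (mg1 Y mY); exact: finset.subsetUl.
  by apply: gU1; rewrite finset.setUC.
have mD := sigma_vars_measurable sD.
have [_ ig2 _] := cg2.
apply: ae_eq_integral => //.
- by apply: measurable_funTS; exact: measurable_int ig1.
- by apply: measurable_funTS; exact: measurable_int ig2.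
- have := cond_prob_unique (@vars_gen_measurable _) c1 cg2.
  by apply: filterS => w /= -> _.
Qed.

Lemma cond_indep_self A S : cond_indep P X A S S.
Proof.
apply: version_cond_indep => E sE.
have [g [g0 [mg ig eg] _]] := cond_prob_exists P (@vars_gen_measurable S) (sigma_vars_measurable sE).
by exists g; split => //; rewrite finset.setUid.
Qed.

End CondIndep.

(** * Structural models on finitely many fair bits *)

Definition bits (I : finType) : Type := {ffun I -> bool}.

Section Bits.
Variable I : finType.
HB.instance Definition _ := Finite.on (bits I).
HB.instance Definition _ := isPointed.Build (bits I) [ffun _ => false].
HB.instance Definition _ := @isMeasurable.Build default_measure_display
  (bits I) discrete_measurable discrete_measurable0
  discrete_measurableC discrete_measurableU.

Variable R : realType.

Definition fair_weight : {nonneg R} := ((#|{: bits I}|%:R^-1 : R)%:nng)%R.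

Definition fair : set (bits I) -> \bar R :=
  mscale fair_weight (msum (fun k => \d_(nth point (enum {: bits I}) k)) #|{: bits I}|).

HB.instance Definition _ := Measure.on fair.

Lemma ge0_integral_fair (g : bits I -> R) (C : set (bits I)) : (forall w, (0 <= g w)%R) ->
  \int[fair]_(w in C) (g w)%:E = (#|{: bits I}|%:R^-1 * \sum_(w : bits I | w \in C) g w)%R%:E.
Proof.
move=> g0; rewrite ge0_integral_mscale//; last by move=> w _; rewrite lee_fin.
rewrite ge0_integral_measure_sum//; last by move=> w _; rewrite lee_fin.
rewrite EFinM; congr (_ * _).
under eq_bigr do rewrite integral_dirac//.
rewrite -sumEFin [RHS]big_mkcond /= -[RHS]big_enum /= (big_nth point) big_mkord -cardE.
apply: eq_bigr => i _; rewrite diracE.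
by case: ifPn => _; rewrite ?mul1e ?mul0e.
Qed.

Lemma fairE (C : set (bits I)) :
  fair C = (#|{: bits I}|%:R^-1 * (#|[set w : bits I | w \in C]%SET|)%:R)%R%:E.
Proof.
rewrite -[LHS]mul1e -(@integral_cst _ _ _ fair C)//.
have := @ge0_integral_fair (fun=> 1%R) C (fun=> ler01) => /= ->.
rewrite sumr_const; congr (_ * _%:R)%:E.
by apply: eq_card => w; rewrite !inE.
Qed.

Lemma card_bits_neq0 : (#|{: bits I}|%:R : R) != 0%R.
Proof. by rewrite pnatr_eq0 -lt0n; apply/card_gt0P; exists point. Qed.

Let fairT : fair setT = 1.
Proof.
rewrite fairE -[RHS]/(1%R%:E); congr (_%:E).
rewrite (_ : [set w : bits I | w \in setT]%SET = [set: bits I]%SET).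
  by rewrite cardsT mulVf// card_bits_neq0.
by apply/setP => w; rewrite !inE; apply: mem_set.
Qed.

HB.instance Definition _ := Measure_isProbability.Build _ _ _ fair fairT.

End Bits.

Section StructuralModel.
Context (V I : finType) (R : realType).

Definition bits_rv (f : bits I -> nat) : bits I -> nat := f.
HB.instance Definition _ f := @isMeasurableFun.Build _ _ (bits I) nat (bits_rv f)
  (fun _ _ _ => Logic.I : measurable (_ : set (bits I))).

Variables (f : V -> bits I -> nat) (own : I -> V).
Local Notation X := (fun v => bits_rv (f v)).
Local Notation sv := (@sigma_vars V _ (bits I) (fun=> default_measure_display)
  (fun=> nat) X).

(** The sample space is finite, so the sigma-algebra consists of the unions of joint level sets of
    the variables. *)
Lemma sigma_vars_bits (A : {set V}) (E : set (bits I)) :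
  sv A E <-> forall w w', (forall v, v \in A -> f v w = f v w') -> E w -> E w'.
Proof.
split=> [sE|satE].
- suff : [set D : set (bits I) | forall w w',
      (forall v, v \in A -> f v w = f v w') -> D w <-> D w'] E.
    by move=> h w w' /h [].
  move: E sE; apply: smallest_sub; first split.
  + by [].
  + move=> D satD w w' ww'; have := satD _ _ ww'.
    by rewrite setTD => h; split=> nD /h.
  + move=> F satF w w' ww'; split=> -[k _ Fk]; exists k => //.
      exact/(satF k _ _ ww').
    exact/(satF k _ _ ww').
  + move=> _ [v /= vA [Y mY <-]] w w' /(_ v vA) e.
    by rewrite setTI /preimage /= /bits_rv e.
- pose atom (w : bits I) := \bigcap_(v in [set` A]) (f v @^-1` [set f v w]).
  have -> : E = \bigcup_(w in E) atom w.
    rewrite eqEsubset; split=> [w Ew|w' [w Ew aw]]; first by exists w => // v _.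
    by apply: satE Ew => v vA; rewrite (aw v vA).
  pose U := g_sigma_algebraType (vars_gen X A).
  apply: (@fin_bigcup_measurable _ U) => [|w _]; first exact: finite_finset.
  apply: (@fin_bigcap_measurable _ U) => [|v vA]; first exact: finite_finset.
  apply: sub_sigma_algebra; exists v => //; exists [set f v w] => //.
  by rewrite setTI.
Qed.

(** Otherwise some version g of P(E | S) would also be one of P(E | B, S), hence vanish outside E.
    As [flip] preserves the variables of S and leads out of E, g vanishes on E too, although every
    sample has positive mass. *)
Lemma not_cond_indep_bits (A B S : {set V}) (E : set (bits I)) (flip : bits I -> bits I) :
  sv A E -> sv (B :|: S)%SET E ->
  (forall v w, v \in S -> f v (flip w) = f v w) ->
  (forall w, E w -> ~ E (flip w)) -> E !=set0 ->
  ~ cond_indep (@fair I R) X A B S.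
Proof.
move=> sA sB flipS flipE [w0 Ew0] /cond_indep_version /(_ E sA) [g [g0 [mg _ _] gU]].
have N0 : (#|{: bits I}|%:R^-1 != 0 :> R)%R by rewrite invr_eq0 card_bits_neq0.
have gC w : ~ E w -> g w = 0%R.
  move=> nEw; have := gU (~` E) (sigma_algebraC sB).
  rewrite setICr measure0 ge0_integral_fair// => -[/eqP].
  rewrite mulf_eq0 (negbTE N0) /= psumr_eq0// => /allP /(_ w).
  by rewrite mem_index_enum => /(_ isT); rewrite (mem_set (A := ~` E) nEw) => /eqP.
have gE w : E w -> g w = 0%R.
  move=> Ew; have satg := (sigma_vars_bits _ _).1 (mg [set g w] (measurable_set1 _)).
  have : (g @^-1` [set g w]) (flip w).
    by apply: satg (erefl (g w)) => v /flipS ->.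
  by move=> /= <-; apply/gC/flipE.
have := gU E sB; rewrite setIid -[RHS]/(@fair I R E) ge0_integral_fair// big1 => [|w /set_mem /gE//].
rewrite mulr0 fairE => -[/esym/eqP].
rewrite mulf_eq0 (negbTE N0) /= pnatr_eq0 cards_eq0 => /eqP /setP /(_ w0).
by rewrite !inE (mem_set Ew0).
Qed.

Variable G : pdgraph V.
Hypothesis sem : forall v w w',
  (forall p, p \in pa G v -> f p w = f p w') ->
  (forall i, own i = v -> w i = w' i) -> f v w = f v w'.
Variable rank : V -> nat.
Hypothesis rankP : forall a b, dir G a b -> (rank a < rank b)%N.

Lemma rank_connect a b : connect (dir G) a b -> (rank a <= rank b)%N.
Proof.
case/connectP => p + ->; elim: p a => //= c p IHp a /andP[/rankP ac /IHp].
by apply: leq_trans; exact: ltnW.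
Qed.

Lemma sem_ancestors u (w w' : bits I) :
  (forall i, connect (dir G) (own i) u -> w i = w' i) -> f u w = f u w'.
Proof.
have [n] := ubnP (rank u); elim: n u => // n IHn u ru ww'.
apply: sem => [p|i oi]; last by apply: ww'; rewrite oi; exact: connect0.
rewrite inE => pu; apply: IHn => [|i ip].
  by rewrite (leq_trans (rankP pu)).
by apply: ww'; apply: connect_trans ip _; exact: connect1.
Qed.

(* The sample w with the bits of v drawn anew, from u. *)
Let mix v (u w : bits I) : bits I := [ffun i => if own i == v then u i else w i].

Let mix_invol v (u w : bits I) : mix v (mix v w u) (mix v u w) = w.
Proof. by apply/ffunP => i; rewrite !ffunE; case: ifP => // ->. Qed.

Let mix_nondesc v (u w : bits I) x : x \in nondesc G v :|: pa G v -> f x (mix v u w) = f x w.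
Proof.
move=> xN; apply: sem_ancestors => i ix; rewrite ffunE; case: eqP => // oi.
rewrite oi in ix; move: xN; rewrite !inE ix /= => /rankP.
by rewrite ltnNge rank_connect.
Qed.

(** The version g at w is the probability of E when the bits of v are drawn anew. Exchanging the
    bits of v between two samples is a bijection of pairs that respects every event about
    non-descendants and parents; double counting gives the integral. *)
Theorem structural_model_Markov : Markov G (@fair I R) X.
Proof.
move=> v; apply: version_cond_indep => E sE.
pose N : R := #|{: bits I}|%:R.
pose g (w : bits I) : R := (N^-1 * #|[set u | mix v u w \in E]%SET|%:R)%R.
have N0 : N != 0%R by exact: card_bits_neq0.
have g0 w : (0 <= g w)%R by rewrite mulr_ge0// invr_ge0.
have satg w w' : (forall p, p \in pa G v -> f p w = f p w') -> g w = g w'.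
  move=> ww'; congr (_ * _%:R)%R; apply: eq_card => u; rewrite !inE.
  have e : f v (mix v u w) = f v (mix v u w').
    apply: sem => [p pv|i oi]; last by rewrite !ffunE oi eqxx.
    by rewrite !mix_nondesc ?ww'// inE pv orbT.
  apply/idP/idP => /set_mem uE; apply: mem_set.
    by apply: ((sigma_vars_bits _ _).1 sE) uE => x /set1P ->.
  by apply: ((sigma_vars_bits _ _).1 sE) uE => x /set1P ->.
have key C : sv (nondesc G v :|: pa G v)%SET C ->
    \int[@fair I R]_(w in C) (g w)%:E = @fair I R (E `&` C).
  move=> sC; rewrite ge0_integral_fair// fairE; congr (_ * _)%R%:E.
  rewrite -mulr_sumr; apply: (canLR (mulKf N0)).
  have -> : (\sum_(w : bits I | w \in C) #|[set u | mix v u w \in E]%SET|%:R =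
     (\sum_(w : bits I) \sum_(u : bits I) ((w \in C) && (mix v u w \in E)))%N%:R :> R)%R.
    rewrite natr_sum big_mkcond; apply: eq_bigr => w _.
    case: (w \in C); last by rewrite big1.
    by rewrite -sum1dep_card big_mkcond.
  pose swap (p : bits I * bits I) := (mix v p.2 p.1, mix v p.1 p.2).
  have swap_inj : injective swap.
    by apply: (can_inj (g := swap)) => -[a b]; rewrite /swap /= !mix_invol.
  have -> : (\sum_(w : bits I) \sum_(u : bits I) ((w \in C) && (mix v u w \in E)) =
     \sum_(w : bits I) \sum_(u : bits I) ((mix v u w \in C) && (w \in E)))%N.
    rewrite !pair_bigA /= (reindex_inj swap_inj) /=.
    by apply: eq_bigr => -[w u] _; rewrite /swap /= mix_invol.
  have -> : (\sum_(w : bits I) \sum_(u : bits I) ((mix v u w \in C) && (w \in E)) =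
     #|{: bits I}| * #|[set w : bits I | w \in E `&` C]%SET|)%N.
    rewrite -sum1dep_card big_distrr [RHS]big_mkcond /=; apply: eq_bigr => w _.
    have wC u : (mix v u w \in C) = (w \in C).
      apply/idP/idP => /set_mem wC.
        by apply: mem_set; apply: ((sigma_vars_bits _ _).1 sC) wC => x /mix_nondesc.
      by apply: mem_set; apply: ((sigma_vars_bits _ _).1 sC) wC => x /mix_nondesc ->.
    under eq_bigr => u _ do rewrite wC.
    rewrite sum_nat_const muln1 classical_sets.in_setI andbC.
    by case: (_ && _); rewrite ?muln1 ?muln0.
  by rewrite natrM.
have mg Y : measurable Y -> sv (pa G v) (g @^-1` Y).
  by move=> mY; apply/sigma_vars_bits => w w' /satg; rewrite /preimage /= => ->.
exists g; split => //; split => //.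
- apply/integrableP; split => //.
  under eq_integral do rewrite gee0_abs ?lee_fin//.
  rewrite key; last exact: sigma_varsT.
  by rewrite (le_lt_trans (probability_le1 _ _))// ltry.
- by move=> C sC; apply: key; apply: sigma_varsS sC; exact: finset.subsetUr.
Qed.

End StructuralModel.

Local Open Scope nat_scope.

Section ActiveNotEntails.
Variables (R : realType) (V : finType) (G : pdgraph V) (A B S : {set V}).

(** [inord j.2.+1] is the true successor wherever it matters, because in an [active_model] [xr v i]
    holds only for [i < k]. *)
Definition model_value (k : nat) (cp xr : V -> nat -> bool) (v : V)
    (w : bits 'I_k.+1) : {ffun bool * 'I_k.+1 -> bool} :=
  [ffun j : bool * 'I_k.+1 => if j.1 then xr v j.2 && (w j.2 (+) w (inord j.2.+1))
             else cp v j.2 && w j.2].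

(** The witness is the event that bit 0 is set. A sees it at the start of the walk; B and S
    determine it from bit k at v and the sums at the colliders. Flipping all bits at once preserves
    these sums, which are all that S shows. *)
Lemma active_not_entails b v : ~~ cyclic G -> active G A S b v ->
  v \in B -> v \notin S -> ~ entails R G A B S.
Proof.
move=> acy av vB vS; have [k [own [cp [xr [am vk J]]]]] := active_final_model av vS.
have [[a aA a0] xrP link le] := am.
pose f (u : V) (w : bits 'I_k.+1) : nat := pickle (model_value cp xr u w).
have fE u w w' : f u w = f u w' -> forall j, model_value cp xr u w j = model_value cp xr u w' j.
  by move=> /(pcan_inj pickleK) ->.
have fcp u (w w' : bits 'I_k.+1) (i : 'I_k.+1) : cp u i -> f u w = f u w' -> w i = w' i.
  by move=> ui /fE /(_ (false, i)); rewrite !ffunE /= ui.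
have fcpn u (w w' : bits 'I_k.+1) i (ik : i <= k) : cp u i -> f u w = f u w' -> w (inord i) = w' (inord i).
  by move=> ui; apply: fcp; rewrite inordK.
have fext u (w w' : bits 'I_k.+1) : (forall i : 'I_k.+1, cp u i -> w i = w' i) ->
    (forall i : 'I_k.+1, xr u i -> w i (+) w (inord i.+1) = w' i (+) w' (inord i.+1)) ->
    f u w = f u w'.
  move=> h1 h2; congr (pickle _); apply/ffunP => -[[] i]; rewrite !ffunE /=.
    by case ui: (xr u i) => //=; exact: h2.
  by case ui: (cp u i) => //=; exact: h1.
move=> ent.
have sem u (w w' : bits 'I_k.+1) : (forall p, p \in pa G u -> f p w = f p w') ->
    (forall i : 'I_k.+1, own i = u -> w i = w' i) -> f u w = f u w'.
  move=> fp ow; have cpi p (i : 'I_k.+1) : dir G p u -> cp p i -> w i = w' i.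
    by move=> pu /fcp; apply; apply: fp; rewrite inE.
  apply: fext => i ui.
    by case: (J _ _ ui) => _ [/ow//|[p pu pi]]; exact: cpi pu pi.
  have [ik [p pu pi] [q qu qi]] := xrP _ _ ui.
  by rewrite (cpi p)// (cpi q)// inordK.
have := ent _ (bits 'I_k.+1) (@fair 'I_k.+1 R) (fun=> default_measure_display)
  (fun=> nat) (fun u => bits_rv (f u))
  (@structural_model_Markov V _ R f (fun i : 'I_k.+1 => own i) G sem _ (dag_rankP acy)).
pose flip (w : bits 'I_k.+1) : bits 'I_k.+1 := [ffun i => ~~ w i].
move=> ci; apply: (@not_cond_indep_bits V 'I_k.+1 R f A B S [set w : bits 'I_k.+1 | w ord0]%classic flip _ _ _ _ _ ci).
- apply/sigma_vars_bits => w w' /(_ a aA) /(fcp _ _ _ ord0 a0) /= e.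
  by rewrite e.
- apply/sigma_vars_bits => w w' ww' /=.
  have fB u : u \in B -> f u w = f u w' by move=> uB; apply: ww'; rewrite inE uB.
  have fS u : u \in S -> f u w = f u w' by move=> uS; apply: ww'; rewrite inE uS orbT.
  suff : w ord0 = w' ord0 by move=> ->.
  have step i : i <= k -> w (inord (k - i)) = w' (inord (k - i)).
    elim: i => [_|i IHi ik]; first by rewrite subn0; apply: fcpn (fB v vB).
    have ki : k - i.+1 < k by lia.
    have [s sS si] := link _ ki.
    have := fE _ _ _ (fS s sS) (true, inord (k - i.+1)).
    rewrite !ffunE /= !inordK ?si /=; last by lia.
    rewrite (_ : (k - i.+1).+1 = k - i); last by lia.
    by rewrite (IHi (ltnW ik)) => /addIb.
  have := step k (leqnn k); rewrite subnn.
  by rewrite (_ : inord 0 = ord0)//; apply: val_inj; rewrite /= inordK.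
- move=> u w uS; apply: fext => i ui.
    by case: (J _ _ ui) => /negP.
  by rewrite !ffunE addbN addNb negbK.
- by move=> w /= w0; rewrite ffunE w0.
- by exists [ffun=> true] => /=; rewrite ffunE.
Qed.

End ActiveNotEntails.

End CondIndepTheory.

Import CondIndepTheory.

(** * Entailment *)

Section Entailment.
Variables (R : realType) (V : finType).
Implicit Types (G H : pdgraph V) (A B S : {set V}) (a b c : V).

Lemma cond_indep_separoid (d : measure_display) (W : measurableType d)
    (P : probability W R) (dT : V -> measure_display)
    (T : forall v, measurableType (dT v)) (X : forall v, {mfun W >-> T v}) :
  separoid (cond_indep P X).
Proof.
split.
- exact: cond_indep_sym.
- exact: cond_indepS.
- exact: cond_indep_weak_union.
- exact: cond_indep_contraction.
- exact: cond_indep_self.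
Qed.

Lemma entails_equivalent G H : is_dag G -> is_dag H ->
  (forall a b, adj G a b = adj H a b) ->
  (forall a b c, vstructure G a b c = vstructure H a b c) ->
  forall A B S, entails R G A B S <-> entails R H A B S.
Proof.
have imp K L : is_dag K -> is_dag L -> (forall a b, adj K a b = adj L a b) ->
    (forall a b c, vstructure K a b c = vstructure L a b c) ->
    forall A B S, entails R K A B S -> entails R L A B S.
  move=> dK dL adjE vE A B S ent d W P dT T X mL; apply: ent.
  apply: (Markov_equivalent (cond_indep_separoid P X) dL dK _ _ mL) => *.
    exact/esym/adjE.
  exact/esym/vE.
move=> dG dH adjE vE A B S; by split; apply: imp.
Qed.

Section Explanation.
Variables (M : seq (ci_stmt V)) (hM : dependency_model M) (G : pdgraph V).
Hypotheses (dG : is_dag G) (same : same_statements R M G).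

Let acy : ~~ cyclic G. Proof. exact: dag_acyclic. Qed.

Lemma listed_entailed A B S : (A, B, S) \in M -> entails R G A B S.
Proof. by move=> ABS; apply/same => //; exact: hM. Qed.

Lemma separates_inactive a b S : separates M a b S ->
  [/\ a \notin S, b \notin S & (forall d, ~ active G [set a] S d b) \/
    (forall d, ~ active G [set b] S d a)].
Proof.
move=> /andP [/subsetP Sab abS].
have aS : a \notin S by apply/negP => /Sab; rewrite !inE eqxx.
have bS : b \notin S by apply/negP => /Sab; rewrite !inE eqxx orbT.
split=> //; case/orP: abS => /listed_entailed ent; [left|right] => d act.
  by apply: (active_not_entails acy act _ bS ent); rewrite inE.
by apply: (active_not_entails acy act _ aS ent); rewrite inE.
Qed.

Lemma adj_active a b S : adj G a b -> a \notin S -> exists d, active G [set a] S d b.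
Proof.
move=> ab aS; have aa : active G [set a] S true a by apply: active_start; rewrite inE.
move: ab; rewrite dag_adjE// => /orP [ab|ba].
  by exists false; exact: active_up_down aa aS ab.
by exists true; exact: active_up_up aa aS ba.
Qed.

Lemma nondesc_separates a b : a != b -> ~~ adj G a b -> b \in nondesc G a ->
  separates M a b (pa G a).
Proof.
move=> ab nab bN; have apa : a \notin pa G a by rewrite inE dag_irr.
have bpa : b \notin pa G a.
  by rewrite inE; apply: contra nab; rewrite adj_sym; exact: dir_adj.
apply/andP; split.
  by apply/subsetP => x xa; rewrite !inE negb_or; apply/andP; split; apply: contraTneq xa => ->.
apply/orP; left; apply/same; first by rewrite /disjoint3 !disjoints1 apa bpa in_set1 ab.
move=> d W P dT T X mG; apply: cond_indepS (mG a).
by rewrite sub1set.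
Qed.

(** Of two non-adjacent vertices, one is a non-descendant of the other and separated from it by the
    parents of that other; an edge is an active walk given any S. *)
Lemma skeleton_adjE a b : adj (skeleton M) a b = adj G a b.
Proof.
rewrite skeleton_adj inE /=; have [<-|ab] := eqVneq a b.
  by rewrite dag_adjE// dag_irr.
apply/idP/idP => /= [nsep|abG].
  apply: contraR nsep => nab; apply/existsP.
  have [bN|bN] := boolP (b \in nondesc G a).
    by exists (pa G a); exact: nondesc_separates.
  have aN : a \in nondesc G b.
    move: bN; rewrite !inE negbK => cab; apply/negP => cba.
    case/connectP: cab => -[|c p] /= cp Eb; first by rewrite Eb eqxx in ab.
    case/andP: cp => ac cp; case/negP: acy; apply/existsP; exists a; apply/existsP; exists c.
    by rewrite ac; apply: connect_trans cba; apply/connectP; exists p.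
  exists (pa G b); rewrite separates_sym; apply: nondesc_separates => //.
    by rewrite eq_sym.
  by rewrite adj_sym.
apply/existsP => -[S /separates_inactive [aS bS [nact|nact]]].
  by have [d] := adj_active abG aS; exact: nact.
have baG : adj G b a by rewrite adj_sym.
by have [d] := adj_active baG bS; exact: nact.
Qed.

Lemma noncollider_active a b c S : adj G a b -> adj G b c -> a \notin S -> b \notin S ->
  ~~ (dir G a b && dir G c b) -> exists d, active G [set a] S d c.
Proof.
move=> ab bc aS bS ncol.
have aa : active G [set a] S true a by apply: active_start; rewrite inE.
move: ab bc; rewrite !dag_adjE// => /orP [ab|ba] /orP [bc|cb].
- by exists false; apply: active_down_down bS bc; exact: active_up_down aa aS ab.
- by rewrite ab cb in ncol.
- by exists false; apply: active_up_down bS bc; exact: active_up_up aa aS ba.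
- by exists true; apply: active_up_up bS cb; exact: active_up_up aa aS ba.
Qed.

Lemma collider_active a b c S : dir G a b -> dir G c b -> a \notin S -> b \in S ->
  active G [set a] S true c.
Proof.
move=> ab cb aS bS; apply: active_down_up bS cb.
by apply: active_up_down aS ab; apply: active_start; rewrite inE.
Qed.

(** Any choice of separating set S works: with b outside S the walk a, b, c is active unless b is a
    collider, and with b in S it is active if b is one. *)
Lemma collider_tripleE Sep : is_Sep M Sep -> forall a b c,
  collider_triple M Sep (a, b, c) = vstructure G a b c.
Proof.
move=> sepP a b c; rewrite /collider_triple /vstructure !skeleton_adjE.
have [<-|ac] /= := eqVneq a c; first by rewrite !andbF.
have [_|nac] := boolP (adj G a c); first by rewrite !andbF.
have [|ac_sep _] := sepP a c ac.
  by move: nac; rewrite -skeleton_adjE skeleton_adj inE /= ac negbK.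
have [aS cS nact] := separates_inactive ac_sep.
rewrite !andbT /=; apply/and3P/andP => [[ab bc bS]|[ab cb]].
  apply/andP; apply: contraT => ncol; case: nact => nact.
    by have [d /nact] := noncollider_active ab bc aS bS ncol.
  rewrite andbC in ncol; rewrite adj_sym in ab; rewrite adj_sym in bc.
  by have [d /nact] := noncollider_active bc ab cS bS ncol.
split; first exact: dir_adj.
  by rewrite adj_sym dir_adj.
apply/negP => bS; case: nact => nact.
  by apply: (nact true); exact: collider_active ab cb aS bS.
by apply: (nact true); exact: collider_active cb ab cS bS.
Qed.

End Explanation.

End Entailment.

Theorem mainTheorem5 (R : realType) (V : finType) (hV : 0 < #|V|)
    (M : seq (ci_stmt V)) (hM : dependency_model M) (K : background V)
    (form : phaseIV_form) (hform : graphoid M \/ form = Alternative) :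
  ((exists G, complete_causal_explanation R M G /\ consistent K G) ->
     [/\ ~ phasesI_II M K None,
         exists PiII PiIII, phasesI_II M K (Some PiII) /\ phaseIII PiII PiIII
       & forall PiII PiIII,
           phasesI_II M K (Some PiII) -> phaseIII PiII PiIII ->
           [/\ complete_causal_explanation R M PiIII,
               has_required K PiIII
             & forbidden_settled K PiII -> consistent K PiIII]])
  /\
  (~ (exists G, complete_causal_explanation R M G /\ consistent K G) ->
     forall PiII PiIII,
       phasesI_II M K (Some PiII) -> phaseIII PiII PiIII ->
       forbidden_settled K PiII -> ~~ failS1 (forbidden K) PiII ->
       fails_phaseIV R form M PiIII).
Proof.
have basic PiII PiIII : phasesI_II M K (Some PiII) -> phaseIII PiII PiIII ->
    [/\ refinement PiII PiIII, fully_directed PiIII & has_required K PiIII].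
  move=> [PiI p1 [C0 cl loop]] p3.
  have [_ adjC] := closes_refinement (@rules123_edges V) cl.
  have nlC a : ~~ adj C0 a a by rewrite adjC; exact: phaseI_no_loop p1 a.
  have [[_ adjII] req] := phaseII_loop_required loop nlC.
  have [|ref fd] := phaseIII_refinement _ p3; first by move=> a; rewrite adjII.
  by split=> // a b /req; exact: refinement_dir.
(* A forbidden arc of [PiIII] would be in [PiII] an arc, excluded by [failS1], or an undirected
   edge, excluded by [forbidden_settled]. *)
have settled PiII PiIII : refinement PiII PiIII -> ~~ failS1 (forbidden K) PiII ->
    forbidden_settled K PiII -> has_no_forbidden K PiIII.
  move=> [/subsetP sub _] nf1 fs a b abF; apply/negP => /andP [/sub abII _].
  have := fs a b abF; rewrite /undir abII /= => nba.
  move/existsPn: nf1 => /(_ a) /existsPn /(_ b); rewrite abF /= /dir abII.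
  by rewrite nba.
split.
- move=> [G [[dG same] cG]].
  have ext PiI := phaseI_extends (skeleton_adjE hM dG same) (collider_tripleE hM dG same) (PiI := PiI).
  have sound o : phasesI_II M K o -> if o is Some PiII then exists C0,
      [/\ extends G C0, forall a b c, dir C0 a b -> undir C0 b c -> dir C0 a c,
          refinement C0 PiII & extends G PiII /\ forall a b, ~ rules1234 PiII a b]
      else False.
    move=> [PiI /ext [eI dirI] [C0 cl loop]].
    have eC : extends G C0 by apply: (extends_closes dG _ cl eI) => *; exact: rules123_1234.
    have nl a : ~~ adj C0 a a by rewrite (extends_irr dG eC).
    have := phaseII_loop_required loop nl.
    have := phaseII_loop_sound dG cG (subxx _) loop eC.
    case: o loop => // PiII loop [eII R0 closedII] [ref _]; exists C0; split=> //.
      exact: no_flag dG eI dirI cl.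
    split=> //; have [E|] := eqVneq (required K) set0; last exact: closedII.
    rewrite (R0 E); exact: rules1234_closed dG eI dirI cl.
  split.
  + exact: sound.
  + have [PiI p1] := phaseI_exists M.
    have [C0 cl] := closes_exists (@rules123_edges V) PiI.
    have [o loop] := phaseII_loop_exists (forbidden K) C0 (required K).
    have p12 : phasesI_II M K o by exists PiI => //; exists C0.
    have := sound o p12; case: o p12 {loop} => // PiII p12 [C1 [_ _ _ [eII _]]].
    have [|PiIII p3] := @phaseIII_exists V PiII; first by move=> a; rewrite (extends_irr dG eII).
    by exists PiII, PiIII.
  + move=> PiII PiIII p12 p3; have [ref fd req] := basic _ _ p12 p3.
    have [C0 [eC flag refC [eII closedII]]] := sound _ p12.
    have [dIII eIII] := phaseIII_extension flag dG eC eII refC closedII p3.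
    (* G and [PiIII] both extend [C0], so they share skeleton and immoralities and entail the same
       statements. *)
    have adjE a b : adj G a b = adj PiIII a b.
      by rewrite -(extends_adj eC) (extends_adj eIII).
    have vE := extends_vstructureE dG dIII eC eIII.
    split=> //.
      split=> // A B S dABS; apply: (iff_trans (same A B S dABS)).
      exact: entails_equivalent.
    move=> fs; split=> //; apply: settled ref _ fs.
    apply/existsPn => a; apply/existsPn => b; apply/negP => /andP [abF].
    move=> /(extends_dir dG eII); apply/negP.
    by have [_ nf] := cG; exact: nf.
- move=> nexpl PiII PiIII p12 p3 fs nf1.
  have [ref fd req] := basic _ _ p12 p3.
  have cK : consistent K PiIII by split=> //; exact: settled ref nf1 fs.
  have [cyc|acy] := boolP (cyclic PiIII); first by left.
  have dIII : is_dag PiIII by rewrite /is_dag fd.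
  right; case: form hform => [[gM|//]|_].
    move=> prec ato [p2 p3']; apply: nexpl; exists PiIII; split=> //; split=> // A B S dABS.
    (* For the converse of S2: an entailed statement has no active walk, and then S3 puts it into
       the graphoid. *)
    split=> [|ent]; first exact: p2.
    apply: (inactive_listed gM hV dIII ato p3' dABS) => d b bB act.
    have bS : b \notin S by have /and3P [_ _ dBS] := dABS; rewrite (disjointFr dBS bB).
    exact: (active_not_entails acy act bB bS ent).
  by move=> same; apply: nexpl; exists PiIII.
Qed.
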